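(* Let $V$ be a finite dimensional vector space over a field $k$ (of arbitrary characteristic) and let $G<\operatorname{GL}(V)$ be a finite abelian group. Then the action of $G$ on $V$ is coregular if and only if $G$ is a pseudo-reflection group and the direct summand property holds for the action of $G$ on $V$.
   Context: Let $n=\dim V$. The coordinate ring $k[V]$ is the symmetric algebra on the dual space $V^*$, with its standard grading; $G$ acts on it by graded $k$-algebra automorphisms, and $k[V]^G$ is the ring of invariants. A linear transformation $\tau:V\to V$ is a pseudo-reflection if its fixed-points space $V^\tau=\{v\in V:\tau(v)=v\}$ is a linear subspace of codimension one. $G$ is a pseudo-reflection group if it is generated by pseudo-reflections. The action is coregular if $k[V]^G$ is generated as a $k$-algebra by $n$ algebraically independent homogeneous invariants. The direct summand property holds if there is a surjective $k[V]^G$-linear map $\pi:k[V]\to k[V]^G$ respecting the gradings. *)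

(* Defs.v *)
From HB Require Import structures.
From mathcomp Require Import all_boot all_order all_algebra all_fingroup.
From mathcomp Require Import mpoly.

Set Implicit Arguments.
Unset Strict Implicit.
Unset Printing Implicit Defensive.

Import GRing.Theory.
Local Open Scope ring_scope.

(* The coordinate ring k[V] = Sym(V^* ), as the polynomial ring in the linear *)
(* coordinates attached to the basis vbasis {:V} of V. The standard grading   *)
(* is the one by total degree, i.e. the predicates d.-homog.                  *)

Section Definitions.

Variables (k : fieldType) (V : vectType k).
Local Notation kV := {mpoly k[\dim {:V}]}.

(* The canonical embedding of V^* as the degree one part of k[V]. *)
Definition linear_form (phi : 'Hom(V, k^o)) : kV :=
  \sum_(i < \dim {:V}) phi (vbasis {:V})`_i *: 'X_i.

Definition coord_form (i : 'I_(\dim {:V})) : 'Hom(V, k^o) :=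
  linfun (coord (vbasis {:V}) i : V -> k^o).

Variable gT : finGroupType.
Implicit Types (G : {set gT}) (rho : gT -> 'End(V)) (f : kV).

(* rho identifies G with a finite subgroup of GL(V); the values of rho are    *)
(* invertible on G since rho 1 = 1. Nothing is required of rho outside G.     *)
Definition faithful_linear_action G rho : Prop :=
  [/\ rho 1%g = \1%VF,
      {in G &, forall g h, rho (g * h)%g = (rho g \o rho h)%VF}
    & {in G &, injective rho}].

(* (g f)(v) = f (g^-1 v): the algebra endomorphism of k[V] that sends the     *)
(* i-th coordinate form x_i to the form x_i \o g^-1.                          *)
Definition coord_act rho (g : gT) f : kV :=
  f \mPo [tuple linear_form (coord_form i \o rho g^-1%g)%VF | i < \dim {:V}].

Definition invariants G rho : {pred kV} :=
  [pred f : kV | [forall g in G, coord_act rho g f == f]].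

Definition pseudo_reflection (tau : 'End(V)) : bool :=
  (\dim (fixedSpace tau)).+1 == \dim {:V}.

Definition pseudo_reflection_group G rho : Prop :=
  <<[set g in G | pseudo_reflection (rho g)]>>%g = G.

Definition alg_independent m (t : m.-tuple kV) : Prop :=
  forall p : {mpoly k[m]}, p \mPo t = 0 -> p = 0.

Definition coregular G rho : Prop :=
  exists t : (\dim {:V}).-tuple kV,
    [/\ forall i, tnth t i \in invariants G rho,
        forall i, exists d : nat, tnth t i \is d.-homog,
        alg_independent t
      & forall f, f \in invariants G rho ->
          exists p : {mpoly k[\dim {:V}]}, f = p \mPo t].

(* The map pi : k[V] -> k[V]^G is given as a self-map of k[V] with values in  *)
(* the invariants; respecting the gradings means preserving the degree.       *)
Definition direct_summand_property G rho : Prop :=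
  exists pi : kV -> kV,
    [/\ forall f, pi f \in invariants G rho,
        forall a f1 f2, a \in invariants G rho ->
          pi (a * f1 + f2) = a * pi f1 + pi f2,
        forall a, a \in invariants G rho -> exists f, pi f = a
      & forall (d : nat) f, f \is d.-homog -> pi f \is d.-homog].

Lemma linear_form_eval phi (v : V) :
  (linear_form phi).@[fun i => coord (vbasis {:V}) i v] = phi v.
Proof.
rewrite /linear_form raddf_sum {2}(coord_vbasis (memvf v)) linear_sum /=.
by apply: eq_bigr => i _; rewrite mevalZ mevalXU linearZ /= mulrC.
Qed.

Lemma coord_act_eval rho g f (v : V) :
  (coord_act rho g f).@[fun i => coord (vbasis {:V}) i v]
  = f.@[fun i => coord (vbasis {:V}) i (rho g^-1%g v)].
Proof.
rewrite /coord_act comp_mpoly_meval; apply: meval_eq => i.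
by rewrite tnth_mktuple linear_form_eval comp_lfunE lfunE.
Qed.

Lemma coord_act_linear_form rho g phi :
  coord_act rho g (linear_form phi) = linear_form (phi \o rho g^-1%g)%VF.
Proof.
rewrite /coord_act {1}/linear_form linear_sum /=.
under eq_bigr => i _ do
  rewrite comp_mpolyZ comp_mpolyXU (nth_map i) ?size_enum_ord ?ltn_ord // nth_ord_enum scaler_sumr.
rewrite exchange_big; apply: eq_bigr => j _ /=.
under eq_bigr => i _ do rewrite scalerA.
rewrite -scaler_suml; congr (_ *: _).
rewrite comp_lfunE [in RHS](coord_vbasis (memvf (rho _ _))) linear_sum /=.
by apply: eq_bigr => i _; rewrite linearZ /= comp_lfunE lfunE mulrC.
Qed.

End Definitions.

(* Main.v *)
(* Write S = k[V] and A = S^G.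

   If A = k[f_1, ..., f_n], then S is a finite A-module on which residues give
   an explicit projective dual basis: 1 = sum_m q_m theta_m(1) with theta_m
   : S -> A linear over A. Some theta_m(1) has a nonzero constant term, and its
   degree 0 part is, up to a scalar, a graded retraction of S onto A. Let W be
   the subgroup generated by the reflections. Over S^W, each theta_m is a
   combination of the cosets of W with denominator a product of linear forms l;
   as an element outside W is never congruent to 1 modulo a linear form, those
   denominators can be cleared. So theta_m does not lower degrees on S^W, which
   forces S^W = A and W = G.

   Conversely, let G be abelian, generated by reflections, with a retraction pi.
   There are coordinates z = (w, y, x): the w are semi-invariant, the y
   invariant, and g x - x lies in the span of the y. The group T fixing all the
   w is an elementary abelian p-group. Killing the w in pi and taking a minimal
   denominator yields a product L of linear forms in y such that L divides every
   transfer Tr_T(s) while L itself is a transfer. Consider the additive functions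
   col_c(t) = t x_i^(p^a) - x_i^(p^a) on T, c = (i, a). Among the lists J of total
   weight deg L with sum_t prod_(c in J) col_c(t) nonzero, one that is minimal in
   size and then in position involves exactly dim T columns, p - 1 times each, and
   these span all the columns with polynomial coefficients. Every column outside
   J thus gives an invariant with leading term x_i^(p^a), and the first such
   column for each i gives polynomial generators of S^T over which S is spanned
   by |T| monomials. Finally G acts on these generators diagonally, each
   reflection outside T moving only one of them, so suitable powers generate A. *)

Require Import Defs.
From HB Require Import structures.
From mathcomp Require Import all_boot all_order all_algebra all_fingroup all_solvable all_character.
From mathcomp Require Import ssrcomplements mpoly ring zify.
From Stdlib Require Import Classical.

Set Implicit Arguments.
Unset Strict Implicit.
Unset Printing Implicit Defensive.

Import GRing.Theory Pdiv.Ring Pdiv.RingMonic.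

(** * Residues *)

(** In the modular case |G| may vanish in k, so averaging gives no projection onto A; residues
    replace it. Let X be a second copy of the variables, a_i the norm polynomial of x_i over G, and
    F_i = f_i(X) - f_i(x). Write a_i(X_i) = sum_j C_ij F_j and F_i = sum_j h_ij (X_j - x_j). Then
    theta_m(s) = res(s(X) X^m det C) is A-linear, because det C carries every F_j into the ideal of
    the a_i(X_i), where the residue vanishes; and s(X) det(C h) has residue s, so the coefficients
    of det h are the q_m. Divisibilities rest on one principle: morphisms stay independent modulo an
    ideal, up to a product of their differences. Over a finite field no linear form need separate
    the morphisms, whence an inhomogeneous separating element. In the converse, the number p - 1
    comes from two opposite bounds. By Frobenius, p equal columns merge into one column of the same
    total weight, so a shortest list repeats none more than p - 1 times; and fewer than (p - 1) dim
    T additive functions on T have a product summing to zero. *)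

HB.lock Definition mlin (n : nat) (S : comNzRingType) (M : lmodType S)
    (w : 'X_{1..n} -> M) (p : {mpoly S[n]}) : M :=
  (\sum_(m <- msupp p) p@_m *: w m)%R.

Section MonomialLinear.
Local Open Scope ring_scope.
Variables (n : nat) (S : comNzRingType) (M : lmodType S) (w : 'X_{1..n} -> M).

Lemma mlinE (p : {mpoly S[n]}) : mlin w p = \sum_(m <- msupp p) p@_m *: w m.
Proof. by rewrite unlock. Qed.

Lemma mlinwE l (p : {mpoly S[n]}) : (msize p <= l)%N ->
  mlin w p = \sum_(m : 'X_{1..n < l}) p@_m *: w m.
Proof.
move=> le_pi; rewrite mlinE (big_mksub [the subFinType _ of 'X_{1..n < l}]) ?msupp_uniq //=; last first.
  by move=> x /msize_mdeg_lt /leq_trans; apply.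
rewrite big_rmcond //= => j /memN_msupp_eq0 ->.
by rewrite scale0r.
Qed.

Fact mlin_is_linear : linear (mlin w).
Proof.
move=> c p q; pose l := maxn (msize (c *: p + q)) (maxn (msize p) (msize q)).
rewrite !(@mlinwE l) ?leq_max ?leqnn ?orbT //.
rewrite scaler_sumr -big_split /=; apply: eq_bigr => m _.
by rewrite linearP /= scalerDl scalerA.
Qed.

HB.instance Definition _ :=
  GRing.isLinear.Build S {mpoly S[n]} M _ (mlin w) mlin_is_linear.

Lemma mlinX m : mlin w 'X_[m] = w m.
Proof. by rewrite mlinE msuppX big_seq1 mcoeffX eqxx scale1r. Qed.

End MonomialLinear.

Section Residue.
Local Open Scope ring_scope.
Variables (S : idomainType) (n : nat) (a : 'I_n -> {poly S}).
Hypothesis a_monic : forall i, a i \is monic.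
Local Notation R := {mpoly S[n]}.

(** The index is the degree of [a i] minus one, so this is the coefficient of 1/X in the expansion
    of [p / a i] at infinity. For [a i = 1] the remainder is 0, and so is the value. *)
Definition res1 i (p : {poly S}) : S := (rmodp p (a i))`_(size (a i)).-2.

Fact res1_is_linear i : linear_for *%R (res1 i).
Proof. by move=> c p q; rewrite /res1 rmodpD // rmodpZ // coefD coefZ. Qed.

HB.instance Definition _ i :=
  GRing.isLinear.Build S {poly S} S *%R (res1 i) (res1_is_linear i).

Lemma res1_mul i p : res1 i (a i * p) = 0.
Proof. by rewrite /res1 mulrC rmodp_mull // coef0. Qed.

Lemma res1_monic i (p : {poly S}) : p \is monic -> size (a i) = (size p).+1 -> res1 i p = 1.
Proof.
move=> pm sp; rewrite /res1 rmodp_small ?sp //=.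
exact/monicP.
Qed.

Definition univ i (p : {poly S}) : R := (map_poly (@mpolyC n S) p).['X_i].

Fact univ_is_additive i : additive (univ i).
Proof. by move=> p q; rewrite /univ rmorphB hornerD hornerN. Qed.
Fact univ_is_multiplicative i : multiplicative (univ i).
Proof. by split=> [p q|]; rewrite /univ ?rmorphM ?hornerM // rmorph1 hornerC. Qed.
HB.instance Definition _ i := GRing.isAdditive.Build {poly S} R (univ i) (univ_is_additive i).
HB.instance Definition _ i := GRing.isMultiplicative.Build {poly S} R (univ i) (univ_is_multiplicative i).

Lemma univE i (p : {poly S}) B : (size p <= B)%N ->
  univ i p = \sum_(e < B) p`_e *: 'X_[U_(i) *+ e].
Proof.
move=> sp; rewrite /univ (@horner_coef_wide _ B); last exact: leq_trans (size_poly _ _) sp.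
apply: eq_bigr => e _; rewrite coef_map /= mul_mpolyC; congr (_ *: _).
by rewrite mpolyXn.
Qed.

Lemma univX i : univ i 'X = 'X_i.
Proof. by rewrite /univ map_polyX hornerX. Qed.
Lemma univC i c : univ i c%:P = c%:MP.
Proof. by rewrite /univ map_polyC hornerC. Qed.

(* The Grothendieck residue of [p / (a_1 ... a_n)], read off as the top coefficient *)
(* after reduction modulo the [a_i]; [res_but i] leaves the [i]-th variable alone. *)
Definition res : R -> S := mlin (fun m => \prod_i res1 i 'X^(m i) : S^o).
Definition res_but i : R -> {poly S} :=
  mlin (fun m => (\prod_(l | l != i) res1 l 'X^(m l)) *: 'X^(m i)).

Fact res_is_linear : linear_for *%R res.
Proof. by move=> c p q; rewrite /res linearP. Qed.
Fact res_but_is_linear i : linear (res_but i).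
Proof. by move=> c p q; rewrite /res_but linearP. Qed.
HB.instance Definition _ := GRing.isLinear.Build S R S *%R res res_is_linear.
HB.instance Definition _ i := GRing.isLinear.Build S R {poly S} *:%R (res_but i) (res_but_is_linear i).

Lemma resX m : res 'X_[m] = \prod_i res1 i 'X^(m i).
Proof. by rewrite /res mlinX. Qed.

Lemma res_butX i m : res_but i 'X_[m] = (\prod_(l | l != i) res1 l 'X^(m l)) *: 'X^(m i).
Proof. by rewrite /res_but mlinX. Qed.

Lemma res_butE i p : res p = res1 i (res_but i p).
Proof.
rewrite /res /res_but !mlinE linear_sum; apply: eq_bigr => m _.
rewrite !linearZ /=; congr (_ * _).
by rewrite (bigD1 i) //= mulrC.
Qed.

(** No reduction is made in the variable [i], so polynomials in it come out. A factor ['X - x] can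
    therefore be cancelled before the last residue is taken. *)
Lemma res_but_univ i q p : res_but i (univ i q * p) = q * res_but i p.
Proof.
rewrite (mpolyE p) mulr_sumr !linear_sum mulr_sumr; apply: eq_bigr => m _.
rewrite -scalerAr !linearZ /= -scalerAr; congr (_ *: _).
rewrite (univE i (leqnn _)) mulr_suml linear_sum /= res_butX.
rewrite -scalerAr -[X in _ = _ *: (X * _)](coefK q).
rewrite poly_def mulr_suml scaler_sumr; apply: eq_bigr => e _.
rewrite -scalerAl linearZ /= -mpolyXD res_butX -scalerAl scalerA mulrC -scalerA -exprD.
congr (_ *: (_ *: _)); last by rewrite mnmDE mulmnE mnm1E eqxx mul1n.
apply: eq_bigr => l li; rewrite mnmDE mulmnE mnm1E eq_sym (negPf li) //.
Qed.

Lemma res_but_kill i l p : l != i -> res_but i (univ l (a l) * p) = 0.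
Proof.
move=> li; rewrite (mpolyE p) mulr_sumr !linear_sum big1 // => m _.
rewrite -scalerAr linearZ /= (univE l (leqnn _)) mulr_suml linear_sum /=.
set Z := (X in _ *: X); suff -> : Z = 0 by rewrite scaler0.
rewrite {}/Z.
transitivity ((\prod_(j | (j != i) && (j != l)) res1 j 'X^(m j))
   *: (res1 l (a l * 'X^(m l)) *: 'X^(m i)) : {poly S}); last first.
  by rewrite res1_mul scale0r scaler0.
rewrite -[X in res1 l (X * _)](coefK (a l)) poly_def mulr_suml linear_sum /=.
rewrite scaler_suml scaler_sumr; apply: eq_bigr => e _.
rewrite -scalerAl linearZ /= -mpolyXD res_butX -scalerAl linearZ /= !scalerA -exprD.
rewrite linearZ /= mnmDE mulmnE mnm1E (negPf li); congr (_ *: _).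
rewrite mulrCA mulrC; congr (_ * _); rewrite (bigD1 l) //= mulrC; congr (_ * _).
  by apply: eq_bigr => j /andP[_ jl]; rewrite mnmDE mulmnE mnm1E eq_sym (negPf jl).
by rewrite mnmDE mulmnE mnm1E eqxx mul1n.
Qed.

Lemma res_kill l p : res (univ l (a l) * p) = 0.
Proof. by rewrite (res_butE l) res_but_univ res1_mul. Qed.

Lemma res_prod (q : 'I_n -> {poly S}) : res (\prod_i univ i (q i)) = \prod_i res1 i (q i).
Proof.
pose B := (\max_i size (q i))%N.
have sq i : (size (q i) <= B)%N by apply: leq_bigmax.
under eq_bigr do rewrite (univE _ (sq _)).
rewrite bigA_distr_bigA /= linear_sum /=.
have -> : \prod_i res1 i (q i) = \prod_i \sum_(e < B) (q i)`_e * res1 i 'X^e.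
  apply: eq_bigr => i _; rewrite -[in LHS](coefK (q i)) poly_def linear_sum /=.
  rewrite (big_ord_widen _ (fun e => res1 i ((q i)`_e *: 'X^e)) (sq i)) /=.
  rewrite big_mkcond /=; apply: eq_bigr => e _; rewrite linearZ /=.
  by case: ltnP => // ge; rewrite nth_default ?mul0r.
rewrite bigA_distr_bigA /=; apply: eq_bigr => f _.
rewrite scaler_prod linearZ /= big_split /=; congr (_ * _).
have -> : \prod_(i < n) 'X_[U_(i) *+ f i] = 'X_[[multinom f i : nat | i < n]] :> R.
  rewrite [RHS]mpolyXE_id; apply: eq_bigr => i _; by rewrite mnmE mpolyXn.
by rewrite resX; apply: eq_bigr => i _; rewrite mnmE.
Qed.

End Residue.

Section AlgebraInduction.
Local Open Scope ring_scope.

Lemma mpoly_alg_ind (n : nat) (k : comNzRingType) (P : {mpoly k[n]} -> Prop) :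
  (forall c, P c%:MP) -> (forall i, P 'X_i) ->
  (forall p q, P p -> P q -> P (p + q)) -> (forall p q, P p -> P q -> P (p * q)) ->
  forall p, P p.
Proof.
move=> PC PX PD PM; elim/mpolyind => [|c m p _ _ Pp]; first by rewrite -mpolyC0.
apply: PD => //; rewrite -mul_mpolyC; apply: (PM _ _) => //.
rewrite mpolyXE_id; elim/big_ind: _ => [|? ?|i _]; [by rewrite -mpolyC1 | exact: PM |].
by elim: (m i) => [|e IH]; rewrite ?expr0 -?mpolyC1 // exprS; apply: (PM _ _).
Qed.

End AlgebraInduction.

(** Ideal membership below records a subring that contains the coefficients. It is used with the
    whole ring and with the polynomials having coefficients in [A]. *)
Definition whole_ring (R : nzRingType) : {pred R} := predT.
Fact whole_ring_closed (R : nzRingType) : subring_closed (@whole_ring R).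
Proof. by []. Qed.
HB.instance Definition _ (R : nzRingType) :=
  GRing.isSubringClosed.Build R (@whole_ring R) (@whole_ring_closed R).

Definition coefs_in (n : nat) (S : nzRingType) (A : subringClosed S) : {pred {mpoly S[n]}} :=
  fun p => p \is a mpolyOver n A.
Fact coefs_in_closed n S A : subring_closed (@coefs_in n S A).
Proof.
split=> [|p q|p q]; rewrite /coefs_in !unfold_in -/(_ \is a mpolyOver n A).
- exact: rpred1.
- exact: rpredB.
- exact: rpredM.
Qed.
HB.instance Definition _ n (S : nzRingType) (A : subringClosed S) :=
  GRing.isSubringClosed.Build {mpoly S[n]} (@coefs_in n S A) (@coefs_in_closed n S A).

(** * Ideal membership with coefficients in a subring *)

Section IdealMembership.
Local Open Scope ring_scope.
Variables (R : comNzRingType) (n : nat) (B : subringClosed R) (F : 'I_n -> R).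

Definition in_span (P : R) :=
  exists2 C : 'I_n -> R, (forall j, C j \in B) & P = \sum_j C j * F j.

Lemma in_span0 : in_span 0.
Proof. by exists (fun=> 0) => [j|]; rewrite ?rpred0 // big1 // => j; rewrite mul0r. Qed.

Lemma in_spanD P Q : in_span P -> in_span Q -> in_span (P + Q).
Proof.
move=> [C CB ->] [D DB ->]; exists (fun j => C j + D j) => [j|]; first exact: rpredD.
by rewrite -big_split; apply: eq_bigr => j _; rewrite mulrDl.
Qed.

Lemma in_spanM P Q : P \in B -> in_span Q -> in_span (P * Q).
Proof.
move=> PB [D DB ->]; exists (fun j => P * D j) => [j|]; first exact: rpredM.
by rewrite mulr_sumr; apply: eq_bigr => j _; rewrite mulrA.
Qed.

Lemma in_span_gen j : in_span (F j).
Proof.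
exists (fun i => (i == j)%:R) => [i|]; first by rewrite rpred_nat.
rewrite (bigD1 j) //= eqxx mul1r big1 ?addr0 // => i /negPf->; by rewrite mul0r.
Qed.

Lemma in_span_sum (I : Type) (r : seq I) (P : I -> R) :
  (forall i, in_span (P i)) -> in_span (\sum_(i <- r) P i).
Proof.
move=> h; elim/big_ind: _ => //; [exact: in_span0 | exact: in_spanD].
Qed.

(** The difference of two products telescopes into differences of the factors. The values of [phi]
    and [psi] become coefficients in this step, so their membership in [B] is part of the
    induction. *)
Lemma in_span_rmorphB (k : comNzRingType) (m : nat)
    (phi psi : {rmorphism {mpoly k[m]} -> R}) :
  (forall c, phi c%:MP = psi c%:MP) -> (forall c, phi c%:MP \in B) ->
  (forall i, phi 'X_i \in B) -> (forall i, psi 'X_i \in B) ->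
  (forall i, in_span (phi 'X_i - psi 'X_i)) ->
  forall p, in_span (phi p - psi p).
Proof.
move=> eqC CB phiB psiB XF p.
suff [] : [/\ phi p \in B, psi p \in B & in_span (phi p - psi p)] by [].
elim/mpoly_alg_ind: p => [c|i|p q [p1 p2 p3] [q1 q2 q3]|p q [p1 p2 p3] [q1 q2 q3]].
- split; rewrite -?eqC ?CB // subrr; exact: in_span0.
- by split.
- rewrite !rmorphD; split; rewrite ?rpredD //.
  by rewrite opprD addrACA; apply: in_spanD.
- rewrite !rmorphM; split; rewrite ?rpredM //.
  have -> : phi p * phi q - psi p * psi q = phi p * (phi q - psi q) + psi q * (phi p - psi p).
    by rewrite !mulrBr [psi q * phi p]mulrC addrA subrK [psi q * _]mulrC.
  by apply: in_spanD; apply: in_spanM.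
Qed.

End IdealMembership.

Section ResidueOver.
Local Open Scope ring_scope.
Variables (S : idomainType) (A : subringClosed S).

Lemma res1_over n (a : 'I_n -> {poly S}) i e :
  a i \is monic -> a i \is a polyOver A -> res1 a i 'X^e \in A.
Proof.
move=> am aA; suff : rmodp 'X^e (a i) \is a polyOver A by move/polyOverP; apply.
have a0 : a i != 0 by apply: monic_neq0.
elim: e => [|e IH].
  case: (ltnP 1 (size (a i))) => s1.
    by rewrite expr0 rmodp_small ?size_poly1 ?rpred1.
  have -> : a i = 1.
    move: s1; rewrite leq_eqVlt ltnS leqn0 size_poly_eq0 (negPf a0) orbF => /eqP s1.
    move/size1_polyC: (eq_leq s1) => e1; move: am.
    by rewrite e1 monicE lead_coefC => /eqP->; rewrite polyC1.
  by rewrite rmodp1 rpred0.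
rewrite exprS -rmodp_mulmr //; set r := rmodp _ _ in IH *.
have sr : (size r < size (a i))%N by rewrite ltn_rmodpN0.
have sz := ltn_predK sr.
(* One step of long division: subtracting the top coefficient of [r] times the monic [a i] brings
   ['X * r] below the degree of [a i]. *)
rewrite (_ : 'X * r = (r`_(size (a i)).-2)%:P * a i + ('X * r - (r`_(size (a i)).-2)%:P * a i)); last first.
  by rewrite addrC subrK.
rewrite rmodp_addl_mul_small //; last first.
  rewrite -(ltn_predK sr) ltnS; apply/leq_sizeP => j sj.
  rewrite coefB coefXM coefCM; case: eqVneq => [j0|j0].
    move: sj; rewrite j0 leqn0 => /eqP s1.
    have r0 : r = 0.
      apply/eqP; rewrite -size_poly_eq0 -leqn0 -ltnS; apply: leq_trans sr _.
      by rewrite -sz s1.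
    by rewrite r0 coef0 mul0r subrr.
  move: sj; rewrite leq_eqVlt => /orP[/eqP ej|lj].
    have -> : (a i)`_j = 1 by rewrite -ej; exact/monicP.
    by rewrite mulr1 -ej subrr.
  rewrite (nth_default 0 (s := r)) ?(nth_default 0 (s := a i)) ?mulr0 ?subrr //.
    by rewrite -sz.
  by rewrite -ltnS prednK ?lt0n //; apply: leq_trans sr _; rewrite -sz.
have rA j : r`_j \in A by move/polyOverP: IH.
by rewrite rpredB ?rpredM ?polyOverX ?polyOverC.
Qed.

Lemma res_over n (a : 'I_n -> {poly S}) P :
  (forall i, a i \is monic) -> (forall i, a i \is a polyOver A) ->
  P \is a mpolyOver n A -> res a P \in A.
Proof.
move=> am aA /mpolyOverP PA; rewrite /res mlinE rpred_sum // => m _.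
by rewrite rpredM // rpred_prod // => i _; rewrite res1_over.
Qed.

End ResidueOver.

(** * Wiebe's lemma: residues of determinants *)

Section WiebeLemma.
Local Open Scope ring_scope.
Variables (S : idomainType) (n : nat) (a b : 'I_n -> {poly S}) (x : 'I_n -> S).
Hypothesis b_monic : forall i, b i \is monic.
Hypothesis abx : forall i, a i = b i * ('X - (x i)%:P).
Local Notation R := {mpoly S[n]}.

Let a_monic i : a i \is monic.
Proof. by rewrite abx monicMr ?monicXsubC. Qed.

Let Y : 'cV[R]_n := \col_j ('X_j - (x j)%:MP).
Let aX : 'cV[R]_n := \col_j univ j (a j).

Lemma univ_XsubC j : univ j ('X - (x j)%:P) = Y j 0.
Proof. by rewrite rmorphB /= univX univC mxE. Qed.

Lemma adj_mul_col (E : 'M[R]_n) (v : 'cV[R]_n) j :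
  \det E * v j 0 = \sum_l \adj E j l * (E *m v) l 0.
Proof.
have := mul_adj_mx E; move/(congr1 (mulmx^~ v)).
rewrite -mulmxA mul_scalar_mx => /matrixP/(_ j 0); rewrite mxE => ->.
by rewrite !mxE.
Qed.

(** Cramer's rule puts [\det E * Y i 0] in the ideal of the [univ l (a l)] with [l != i], which
    [res_but i] kills. The factor ['X - x i] then cancels in [{poly S}]. *)
Lemma res_det_row0 (E : 'M[R]_n) (i : 'I_n) P :
  (E *m Y) i 0 = 0 -> (forall l, l != i -> (E *m Y) l 0 = aX l 0) ->
  res a (P * \det E) = 0.
Proof.
move=> Ei El; rewrite (res_butE a_monic i).
suff -> : res_but a i (P * \det E) = 0 by rewrite linear0.
apply/eqP; rewrite -(mulrI_eq0 _ (lreg_lead (p := 'X - (x i)%:P) _)); last first.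
  by rewrite lead_coefXsubC; exact: lreg1.
rewrite -res_but_univ univ_XsubC mulrC -mulrA adj_mul_col mulr_sumr linear_sum big1 //= => l _.
have [->|li] := eqVneq l i; first by rewrite Ei !mulr0 linear0.
by rewrite El // [aX l 0]mxE mulrA [_ * univ _ _]mulrC (res_but_kill a_monic).
Qed.

(* Exchange the rows one at a time: the difference has a row that kills [Y]. *)
Lemma res_det_eq (H H' : 'M[R]_n) P :
  H *m Y = aX -> H' *m Y = aX -> res a (P * \det H) = res a (P * \det H').
Proof.
move=> HY HY'.
pose Hy j : 'M[R]_n := \matrix_(r, c) if (r < j)%N then H r c else H' r c.
have HyY j : Hy j *m Y = aX.
  apply/colP => r; rewrite mxE; case: (ltnP r j) => rj.
    by rewrite -HY mxE; apply: eq_bigr => c _; rewrite mxE rj.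
  by rewrite -HY' mxE; apply: eq_bigr => c _; rewrite mxE ltnNge rj.
suff HH j : (j <= n)%N -> res a (P * \det (Hy j)) = res a (P * \det H').
  rewrite -(HH n) //; congr (res a (P * \det _)).
  by apply/matrixP => r c; rewrite mxE ltn_ord.
elim: j => [_|j IH jn].
  by congr (res a (P * \det _)); apply/matrixP => r c; rewrite mxE.
rewrite -IH; last exact: ltnW.
pose i := Ordinal jn.
pose E : 'M[R]_n := \matrix_(r, c) if r == i then H i c - H' i c else Hy j r c.
have Hr (r c : 'I_n) : r != i -> Hy j.+1 r c = Hy j r c.
  move=> ri; rewrite !mxE ltnS leq_eqVlt.
  by have -> : (r == j :> nat) = false by apply: negbTE.
rewrite (@determinant_multilinear _ _ (Hy j.+1) (Hy j) E i 1 1).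
- rewrite !mul1r mulrDr linearD /= [X in _ + X](@res_det_row0 E i) ?addr0 //.
    have -> : (E *m Y) i 0 = ((H *m Y) i 0 - (H' *m Y) i 0).
      by rewrite !mxE -sumrB; apply: eq_bigr => c _; rewrite !mxE eqxx mulrBl.
    by rewrite HY HY' subrr.
  move=> l li; rewrite -(HyY j) !mxE; apply: eq_bigr => c _.
  by rewrite !mxE (negPf li).
- by apply/rowP => c; rewrite !mxE eqxx ltnn ltnSn !mul1r addrC subrK.
- apply/matrixP => r c; rewrite !mxE.
  by have := Hr (lift i r) c; rewrite !mxE => ->//; rewrite eq_sym neq_lift.
- apply/matrixP => r c; rewrite !mxE eq_sym (negPf (neq_lift _ _)).
  by have := Hr (lift i r) c; rewrite !mxE => ->//; rewrite eq_sym neq_lift.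
Qed.

Lemma res_det_diag P : res a (P%:MP * \prod_j univ j (b j)) = P.
Proof.
rewrite mul_mpolyC linearZ /=.
have -> : res a (\prod_j univ j (b j)) = \prod_i res1 a i (b i) by exact: res_prod.
rewrite big1 ?mulr1 // => i _.
by rewrite res1_monic // abx size_Mmonic ?monicXsubC ?monic_neq0 // size_XsubC addn2.
Qed.

(** [H] may be traded for the diagonal matrix of the [b j], for which the residue of a constant is
    the constant. Replacing [s] by [P] costs multiples of [Y j * b j = a j], of residue 0. *)
Lemma res_det_lift (s : R) (P : S) (H : 'M[R]_n) (C : 'I_n -> R) : H *m Y = aX ->
  s - P%:MP = \sum_j C j * Y j 0 -> res a (s * \det H) = P.
Proof.
move=> HY sP.
have -> : res a (s * \det H) = res a (s * \det (diag_mx (\row_j univ j (b j)))).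
  apply: res_det_eq => //; apply/colP => j; rewrite mul_diag_mx !mxE.
  by rewrite abx rmorphM rmorphB /= univX univC.
rewrite det_diag; under eq_bigr do rewrite mxE.
rewrite -[RHS]res_det_diag -(subrK (P%:MP) s) mulrDl linearD /= [X in X + _](_ : _ = 0) ?add0r //.
rewrite sP mulr_suml linear_sum big1 //= => j _.
rewrite (bigD1 j) // -(univ_XsubC j) mulrA -(mulrA (C j)) [univ j _ * _]mulrC -rmorphM -abx.
by rewrite [C j * _]mulrC -mulrA (res_kill a_monic).
Qed.

End WiebeLemma.

(** * The dual basis over the invariants *)

Section DualBasis.
Local Open Scope ring_scope.
Variables (S : idomainType) (n : nat) (A : subringClosed S).
Local Notation R := {mpoly S[n]}.
Local Notation AX := (coefs_in (n := n) A).
Variables (x : 'I_n -> S) (lft : {rmorphism S -> R}) (f : 'I_n -> S) (b : 'I_n -> {poly S}).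
Let a i := b i * ('X - (x i)%:P).
Hypothesis b_monic : forall i, b i \is monic.
Hypothesis a_over : forall i, a i \is a polyOver A.
Let Y j : R := 'X_j - (x j)%:MP.
Let F j : R := lft (f j) - (f j)%:MP.
Hypothesis lift_var : forall i, lft (x i) = 'X_i.
Hypothesis lift_over : forall s, lft s \is a mpolyOver n A.
Hypothesis lift_sub_cst : forall s, in_span (@whole_ring R) Y (lft s - s%:MP).
Hypothesis lift_sub_over : forall c, c \in A -> in_span AX F (c%:MP - lft c).

Let a_monic i : a i \is monic.
Proof. by rewrite monicMr ?monicXsubC. Qed.

(** Lifting the value at [x] amounts to replacing each coefficient [c] in [A] by [lft c]. As [a i]
    vanishes at [x i], this puts [univ i (a i)] in the ideal of the [F j]. *)
Lemma over_sub_lift (P : R) : P \is a mpolyOver n A ->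
  in_span AX F (P - lft P.@[x]).
Proof.
move=> /mpolyOverP PA.
have -> : lft P.@[x] = \sum_(e <- msupp P) lft P@_e * 'X_[e].
  rewrite {1}[P]mpolyE (rmorph_sum (meval (x))) (rmorph_sum lft) /=.
  apply: eq_bigr => e _.
  rewrite mevalZ rmorphM /=; congr (_ * _).
  rewrite mevalX rmorph_prod mpolyXE_id; apply: eq_bigr => i _.
  by rewrite rmorphXn /= lift_var.
rewrite {1}[P]mpolyE -sumrB; apply: in_span_sum => e.
rewrite -mul_mpolyC -mulrBl mulrC; apply: in_spanM; first exact: mpolyOverX.
exact: lift_sub_over.
Qed.

Lemma dual_basis : exists (D : R) (theta : 'X_{1..n} -> S -> S),
  [/\ forall e s, theta e s \in A,
      forall e c s t, c \in A -> theta e (c * s + t) = c * theta e s + theta e t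
    & forall s, s = \sum_(e <- msupp D) D@_e * theta e s].
Proof.
have aF i : in_span AX F (univ i (a i)).
  have ev0 : (univ i (a i)).@[x] = 0.
    rewrite rmorphM rmorphB rmorphM rmorphB /= univX univC mevalXU mevalC subrr mulr0 //.
  have ua : univ i (a i) \is a mpolyOver n A.
    rewrite (univE i (leqnn _)) rpred_sum // => e _.
    by rewrite mpolyOverZ ?mpolyOverX //; have /polyOverP := a_over i; apply.
  by have := over_sub_lift ua; rewrite ev0 rmorph0 subr0.
have [C CP] : exists C : 'I_n -> 'I_n -> R,
    forall i, (forall j, C i j \is a mpolyOver n A) /\ univ i (a i) = \sum_j C i j * F j.
  apply: (fin_all_exists (P := fun i (C : 'I_n -> R) =>
      (forall j, C j \is a mpolyOver n A) /\ univ i (a i) = \sum_j C j * F j)) => i.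
    by have [C ? ?] := aF i; exists C.
have [h hP] : exists h : 'I_n -> 'I_n -> R, forall i, F i = \sum_j h i j * Y j.
  apply: (fin_all_exists (P := fun i (h : 'I_n -> R) => F i = \sum_j h j * Y j)) => i.
  by have [h _ hE] := lift_sub_cst (f i); exists h.
pose Cm : 'M[R]_n := \matrix_(i, j) C i j.
pose hm : 'M[R]_n := \matrix_(i, j) h i j.
pose aX : 'cV[R]_n := \col_j univ j (a j).
pose Fc : 'cV[R]_n := \col_j F j.
have CF : Cm *m Fc = aX.
  apply/colP => i; rewrite !mxE (CP i).2; apply: eq_bigr => j _; by rewrite !mxE.
have hY : hm *m (\col_j ('X_j - (x j)%:MP)) = Fc.
  apply/colP => i; rewrite !mxE hP; apply: eq_bigr => j _; by rewrite !mxE.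
(* Of [\det (Cm *m hm)], the factor [\det Cm] stays inside the residue, having coefficients in [A];
   the factor [\det hm] is expanded in monomials, which supply the index [e]. *)
exists (\det hm), (fun e s => res a (lft s * 'X_[e] * \det Cm)); split.
- move=> e s; apply: res_over => //; rewrite rpredM ?rpredM ?lift_over ?mpolyOverX //.
  rewrite /determinant rpred_sum // => sg _; rewrite rpredM ?rpred_sign //.
  by rewrite rpred_prod // => i _; rewrite mxE; case: (CP i) => + _; apply.
- move=> e c s t cA.
  (* By Cramer's rule [\det Cm * F j] lies in the ideal of the [univ l (a l)], so [c] and [lft c]
     cannot be told apart. *)
  have key Q : res a ((c%:MP - lft c) * (Q * \det Cm)) = 0.
    have [E _ ->] := lift_sub_over cA.
    rewrite mulr_suml linear_sum big1 //= => j _.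
    have -> : E j * F j * (Q * \det Cm) = E j * Q * (\det Cm * Fc j 0).
      by rewrite [Fc j 0]mxE mulrACA [F j * _]mulrC.
    rewrite adj_mul_col CF mulr_sumr linear_sum big1 //= => l _.
    by rewrite [aX l 0]mxE mulrA [_ * univ _ _]mulrC (res_kill a_monic).
  have key2 Q : res a (lft c * (Q * \det Cm)) = c * res a (Q * \det Cm).
    transitivity (res a (c%:MP * (Q * \det Cm))); last by rewrite mul_mpolyC linearZ.
    by apply/eqP; rewrite eq_sym -subr_eq0 -linearB /= -mulrBl key.
  have -> : lft (c * s + t) * 'X_[e] * \det Cm =
      lft c * (lft s * 'X_[e] * \det Cm) + lft t * 'X_[e] * \det Cm.
    by rewrite rmorphD rmorphM /= !mulrDl !mulrA.
  by rewrite linearD /= key2.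
- move=> s; have [B _ BP] := lift_sub_cst s.
  have := @res_det_lift _ _ a b x b_monic (fun i => erefl) (lft s) s (Cm *m hm) B.
  rewrite -mulmxA hY CF => /(_ erefl) E.
  have {}E : res a (lft s * \det (Cm *m hm)) = s.
    by apply: E; rewrite BP; apply: eq_bigr => j _; rewrite mxE.
  rewrite -[LHS]E det_mulmx; move: (\det hm) => P.
  rewrite {1}[P]mpolyE !mulr_sumr linear_sum; apply: eq_bigr => e _.
  have -> : lft s * (\det Cm * (P@_e *: 'X_[e])) =
      P@_e *: (lft s * 'X_[e] * \det Cm).
    by rewrite -2!scalerAr [\det Cm * _]mulrC mulrA.
  by rewrite linearZ.
Qed.

End DualBasis.

Section MpolyDualBasis.
Local Open Scope ring_scope.
Variables (k : fieldType) (n : nat).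
Local Notation S := {mpoly k[n]}.
Local Notation R := {mpoly S[n]}.
Variables (A : subringClosed S) (f : n.-tuple S) (b : 'I_n -> {poly S}).
Hypothesis A_const : forall c, c%:MP \in A.
Hypothesis f_in : forall i, tnth f i \in A.
Hypothesis f_gen : forall a, a \in A -> exists p : {mpoly k[n]}, a = p \mPo f.
Hypothesis b_monic : forall i, b i \is monic.
Hypothesis a_over : forall i, b i * ('X - ('X_i)%:P) \is a polyOver A.

(** The same polynomial read in the second set of variables: s(x) becomes s(X). *)
Let lft : {rmorphism S -> R} := map_mpoly (@mpolyC n k).

Lemma mpoly_dual_basis : exists (D : R) (theta : 'X_{1..n} -> S -> S),
  [/\ forall e s, theta e s \in A,
      forall e c s t, c \in A -> theta e (c * s + t) = c * theta e s + theta e t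
    & forall s, s = \sum_(e <- msupp D) D@_e * theta e s].
Proof.
have lift_over (s : S) : lft s \is a mpolyOver n A.
  by apply/mpolyOverP => e; rewrite mcoeff_map_mpoly A_const.
apply: (@dual_basis S n A (fun i => 'X_i) lft (tnth f) b) => // [i|s|c cA].
- by rewrite /lft /= map_mpolyX.
- apply: (in_span_rmorphB (phi := lft) (psi := @mpolyC n S)) => // [c|i].
    by rewrite /= /lft map_mpolyC.
  by rewrite /= /lft map_mpolyX; exact: in_span_gen.
have [p ->] := f_gen cA.
apply: (in_span_rmorphB (phi := @mpolyC n S \o comp_mpoly f)
  (psi := lft \o comp_mpoly f)) => [c'|c'|i|i|i] /=.
- by rewrite comp_mpolyC /lft map_mpolyC.
- by rewrite comp_mpolyC unfold_in mpolyOverC A_const.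
- by rewrite comp_mpolyXU -tnth_nth unfold_in mpolyOverC f_in.
- exact: lift_over.
- rewrite comp_mpolyXU -tnth_nth -opprB -mulN1r; apply: in_spanM.
    by rewrite rpredN rpred1.
  exact: (in_span_gen _ (fun j => lft (tnth f j) - (tnth f j)%:MP) i).
Qed.

End MpolyDualBasis.

(** * Graded morphisms and linear forms *)

Section GradedMorphisms.
Local Open Scope ring_scope.
Variables (k : fieldType) (n : nat).
Local Notation S := {mpoly k[n]}.
Implicit Types (s l r : S) (phi psi : {lrmorphism S -> S}).

Lemma lrmorph_mpolyC phi c : phi c%:MP = c%:MP.
Proof. by rewrite -[c%:MP]mulr1 mul_mpolyC linearZ rmorph1 /= -mul_mpolyC mulr1. Qed.

Lemma lrmorph_ext phi psi : (forall i, phi 'X_i = psi 'X_i) -> phi =1 psi.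
Proof.
move=> h; elim/mpoly_alg_ind => [c|//|p q hp hq|p q hp hq].
- by rewrite !lrmorph_mpolyC.
- by rewrite !rmorphD /= hp hq.
- by rewrite !rmorphM /= hp hq.
Qed.

Lemma lrmorphX phi m : phi 'X_[m] = \prod_i phi 'X_i ^+ m i.
Proof. by rewrite mpolyXE_id rmorph_prod; apply: eq_bigr => i _; rewrite rmorphXn. Qed.

Lemma dhomog_expand_prod (I : finType) (F : I -> S) (d : I -> nat) (P : pred I) :
  (forall i, P i -> F i \is (d i).-homog) ->
  \prod_(i | P i) F i \is (\sum_(i | P i) d i)%N.-homog.
Proof.
move=> h; elim/big_rec2: _ => [|i e s Pi hs]; first exact: dhomog1.
exact: dhomogM (h _ Pi) hs.
Qed.

Lemma dhomog_var (i : 'I_n) : ('X_i : S) \is 1.-homog.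
Proof. by rewrite dhomogX; apply/eqP; exact: mdeg1. Qed.

Definition graded phi := forall i, phi 'X_i \is 1.-homog.

Lemma graded_homog phi d s : graded phi -> s \is d.-homog -> phi s \is d.-homog.
Proof.
move=> gr /dhomogP sd; rewrite (mpolyE s) linear_sum big_seq rpred_sum // => m ms.
rewrite linearZ rpredZ //= lrmorphX.
have <- : mdeg m = d := sd _ ms.
rewrite mdegE.
apply: dhomog_expand_prod => i _.
by have := dhomogMn (m i) (gr i); rewrite mul1n.
Qed.

Lemma pihomog_sum d s : \sum_(e < msize s) pihomog mdeg d (pihomog mdeg e s) = pihomog mdeg d s.
Proof. by rewrite -linear_sum -pihomog_partitionE. Qed.

Lemma graded_pihomog phi d s : graded phi -> phi (pihomog mdeg d s) = pihomog mdeg d (phi s).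
Proof.
move=> gr; have -> : phi s = \sum_(e < msize s) phi (pihomog mdeg e s).
  by rewrite {1}(pihomog_partitionE (leqnn (msize s))) linear_sum.
rewrite [RHS]linear_sum -(pihomog_sum d s) [LHS]linear_sum; apply: eq_bigr => e _ /=.
have gh := graded_homog gr (pihomogP mdeg e s).
have [de|de] := eqVneq (e : nat) d.
  by rewrite -de (pihomog_dE gh) pihomog_id.
by rewrite (pihomog_ne0 de gh) (pihomog_ne0 de (pihomogP mdeg e s)) rmorph0.
Qed.

Lemma pihomogM d e l r : l \is d.-homog ->
  pihomog mdeg (d + e) (l * r) = l * pihomog mdeg e r.
Proof.
move=> ld; rewrite {1}(pihomog_partitionE (leqnn (msize r))) mulr_sumr [LHS]linear_sum.
rewrite -(pihomog_sum e r) mulr_sumr; apply: eq_bigr => j _ /=.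
have lj : l * pihomog mdeg j r \is (d + j).-homog by rewrite dhomogM // pihomogP.
have [je|je] := eqVneq (j : nat) e.
  by rewrite -je (pihomog_dE lj) pihomog_id.
rewrite (pihomog_ne0 je (pihomogP _ _ _)) mulr0.
by apply: pihomog_ne0 lj; rewrite eqn_add2l.
Qed.

Lemma pihomogM_small d e l r : l \is d.-homog -> (e < d)%N ->
  pihomog mdeg e (l * r) = 0.
Proof.
move=> ld ed; rewrite (pihomog_partitionE (leqnn (msize r))) mulr_sumr linear_sum big1 //= => j _.
have lj : l * pihomog mdeg j r \is (d + j).-homog by rewrite dhomogM // pihomogP.
by apply: pihomog_ne0 lj; apply: contraTneq ed => <-; rewrite -leqNgt leq_addr.
Qed.

Lemma dhomog0E s : s \is 0.-homog -> s = (s@_0)%:MP.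
Proof.
move=> s0; apply: msize1_polyC; rewrite msizeE; apply/bigmax_leqP_seq => m ms _.
by have /dhomogP/(_ m ms) -> := s0.
Qed.

Lemma mcoeff_pihomog d s m : (pihomog mdeg d s)@_m = s@_m *+ (mdeg m == d).
Proof.
have [md|md] := eqVneq (mdeg m) d; last first.
  exact: dhomog_nemf_coeff (pihomogP _ _ _) md.
have -> : s@_m = \sum_(e < msize s) (pihomog mdeg e s)@_m.
  by rewrite {1}(pihomog_partitionE (leqnn (msize s))) linear_sum.
rewrite mulr1n -(pihomog_sum d s) [LHS]linear_sum; apply: eq_bigr => e _ /=.
have [->|ed] := eqVneq (e : nat) d; first by rewrite pihomog_id.
rewrite (pihomog_ne0 ed (pihomogP _ _ _)) mcoeff0.
by rewrite (dhomog_nemf_coeff (pihomogP _ e s)) //= md eq_sym.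
Qed.

Lemma pihomog0E s : pihomog mdeg 0 s = (s@_0)%:MP.
Proof. by rewrite (dhomog0E (pihomogP _ 0 s)) mcoeff_pihomog mdeg0. Qed.

(** Below degree [d] the factor [t] has nothing, so only the constant term of [s] reaches degree
    [d]. This turns a map that does not lower degrees into a source of invariants. *)
Lemma pihomog_mul_low d s t : (forall j, (j < d)%N -> pihomog mdeg j t = 0) ->
  pihomog mdeg d (s * t) = s@_0 *: pihomog mdeg d t.
Proof.
move=> low; rewrite {1}(pihomog_partitionE (leqnn (msize t))) mulr_sumr [LHS]linear_sum.
rewrite -(pihomog_sum d t) scaler_sumr; apply: eq_bigr => j _ /=.
have tj := pihomogP mdeg j t; rewrite mulrC.
case: (ltngtP j d) => jd.
- by rewrite low // mul0r linear0 scaler0.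
- by rewrite (pihomogM_small _ tj jd) (pihomog_ne0 _ tj) ?scaler0 // gtn_eqF.
- by rewrite -jd -{1}(addn0 j) (pihomogM _ _ tj) pihomog0E pihomog_id mulrC mul_mpolyC.
Qed.

Lemma dhomog1E l : l \is 1.-homog -> l = \sum_i l@_U_(i) *: 'X_i.
Proof.
move=> l1; apply/mpolyP => m; rewrite linear_sum /=.
under eq_bigr do rewrite mcoeffZ mcoeffX.
have [m1|m1] := eqVneq (mdeg m) 1%N; last first.
  rewrite (dhomog_nemf_coeff l1 m1) big1 // => i _.
  by have [e|_] := eqVneq; rewrite ?mulr0 //; move: m1; rewrite -e mdeg1.
have /mdeg1P[i /eqP ->] : mdeg m == 1%N by rewrite m1.
rewrite (bigD1 i) //= eqxx mulr1 big1 ?addr0 // => j ji.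
by rewrite eq_mnm1 (negPf ji) mulr0.
Qed.

(* The consecutive exponents make this element separate graded morphisms: its components *)
(* of degree [2 i + 2] and [2 i + 3] recover ['X_i]. *)
Definition separator : S := \sum_(i < n) ('X_i ^+ (2 * i).+2 + 'X_i ^+ (2 * i).+3).

(** Two consecutive powers of [phi 'X_i] agree with those of [psi 'X_i]; cancelling one from the
    other leaves the values themselves, unless they vanish. The parity of the exponents keeps the
    two kinds of summands apart. *)
Lemma separatorP phi psi : graded phi -> graded psi ->
  phi separator = psi separator -> forall i, phi 'X_i = psi 'X_i.
Proof.
move=> gphi gpsi hz i.
have comp d : phi (pihomog mdeg d separator) = psi (pihomog mdeg d separator).
  by rewrite !graded_pihomog ?hz.
have Xh (j : 'I_n) e : ('X_j : S) ^+ e \is e.-homog.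
  by rewrite -[X in X.-homog]mul1n dhomogMn // dhomogX; apply/eqP; exact: mdeg1.
have pX (j : 'I_n) d e : pihomog mdeg d ('X_j ^+ e : S) = if e == d then 'X_j ^+ e else 0.
  case: eqP => [<-|/eqP ed]; first by rewrite pihomog_dE.
  exact: pihomog_ne0 ed (Xh j e).
have c2 : pihomog mdeg (2 * i).+2 separator = 'X_i ^+ (2 * i).+2.
  rewrite linear_sum (bigD1 i) //= linearD /= !pX eqxx eqSS (gtn_eqF (ltnSn _)) addr0.
  rewrite big1 ?addr0 // => j; rewrite -val_eqE /= => ji; rewrite linearD /= !pX !eqSS eqn_pmul2l // (negPf ji) add0r.
  by case: eqP => // /(congr1 odd) /=; rewrite !oddM.
have c3 : pihomog mdeg (2 * i).+3 separator = 'X_i ^+ (2 * i).+3.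
  rewrite linear_sum (bigD1 i) //= linearD /= !pX eqxx !eqSS (ltn_eqF (ltnSn _)) add0r.
  rewrite big1 ?addr0 // => j; rewrite -val_eqE /= => ji; rewrite linearD /= !pX !eqSS eqn_pmul2l // (negPf ji) addr0.
  by case: eqP => // /(congr1 odd) /=; rewrite !oddM.
have := comp (2 * i).+2; have := comp (2 * i).+3; rewrite c2 c3 !rmorphXn /=.
have [p0|p0] := eqVneq (phi 'X_i) 0.
  move=> _ /esym/eqP; rewrite p0 expr0n expf_eq0 /= => /eqP->; by [].
move=> h3 h2; move: h3; rewrite exprS [RHS]exprS h2.
by apply: mulIf; rewrite -h2 expf_neq0.
Qed.
End GradedMorphisms.

Section LinearFormsPrime.
Local Open Scope ring_scope.
Variables (k : fieldType) (n : nat).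
Local Notation S := {mpoly k[n]}.
Implicit Types (s l r : S).

(* Substituting [X_i0 := X_i0 - l / l_i0] kills exactly the multiples of [l]. *)
Lemma linear_form_quotient l : l \is 1.-homog -> l != 0 ->
  exists2 t : n.-tuple S, (forall i, tnth t i \is 1.-homog) &
    forall s, s \mPo t = 0 <-> exists r, s = l * r.
Proof.
move=> l1 l0.
have [i0 c0] : exists i0, l@_U_(i0) != 0.
  apply/existsP; apply: contraNT l0 => /existsPn h.
  rewrite (dhomog1E l1) big1 // => i _; have := h i; rewrite negbK => /eqP ->.
  by rewrite scale0r.
pose c := l@_U_(i0).
pose t := [tuple ('X_i - (if i == i0 then c^-1 else 0) *: l : S) | i < n].
have tE i : tnth t i = 'X_i - (if i == i0 then c^-1 else 0) *: l by rewrite tnth_mktuple.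
exists t => [i|s]; first by rewrite tE rpredB ?rpredZ // dhomogX; apply/eqP; exact: mdeg1.
have lt : l \mPo t = 0.
  rewrite {1}(dhomog1E l1) linear_sum /=.
  under eq_bigr do rewrite comp_mpolyZ comp_mpolyXU -tnth_nth tE scalerBr.
  rewrite sumrB -(dhomog1E l1) (bigD1 i0) //= eqxx scalerA divff // scale1r big1 ?addr0 ?subrr //.
  by move=> i /negPf ->; rewrite scale0r scaler0.
split=> [st|[r ->]]; last by rewrite rmorphM /= lt mul0r.
have : in_span (@whole_ring S) (fun _ : 'I_1 => l) (s - (s \mPo t)).
  apply: (in_span_rmorphB (phi := idfun) (psi := comp_mpoly t)) => //= [c'|i].
    by rewrite comp_mpolyC.
  rewrite comp_mpolyXU -tnth_nth tE opprB addrC subrK -mul_mpolyC.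
  by apply: in_spanM => //; exact: (in_span_gen _ (fun=> l) ord0).
rewrite st subr0 => -[C _ ->]; exists (C ord0).
by rewrite big_ord1 mulrC.
Qed.

Lemma linear_form_prime l s r : l \is 1.-homog -> l != 0 ->
  (exists u, s * r = l * u) -> (exists u, s = l * u) \/ (exists u, r = l * u).
Proof.
move=> l1 l0; have [t _ tP] := linear_form_quotient l1 l0.
move/tP; rewrite rmorphM => /eqP; rewrite mulf_eq0 => /orP[]/eqP/tP; by [left|right].
Qed.

End LinearFormsPrime.

(** * Expansion of semilinear maps over a group *)

Section CharacterIndependence.
Local Open Scope ring_scope.
Variables (S S' : comNzRingType) (I : finType) (X : {pred I}).
Variables (phi : I -> {rmorphism S -> S'}) (B : S -> Prop) (J : S' -> Prop).
Hypothesis JB : forall a b, J a -> J b -> J (a - b).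
Hypothesis JM : forall r a, J a -> J (r * a).

(* Combining the relation at [b * x h] with [phi h (x h)] times the relation at *)
(* [b] removes the term of index [h].                                           *)
Lemma morphism_independence (C : I -> S') (x : I -> S) :
  B 1 -> (forall b h, B b -> B (b * x h)) ->
  (forall b, B b -> J (\sum_(g in X) C g * phi g b)) ->
  forall g0, g0 \in X ->
  J (C g0 * \prod_(g in X | g != g0) (phi g0 (x g) - phi g (x g))).
Proof.
move=> B1 BM BJ g0 g0X.
have key (r : seq I) b : B b ->
    J (\sum_(g in X) C g * \prod_(h <- r) (phi g (x h) - phi h (x h)) * phi g b).
  elim: r b => [|h r IH] b Bb.
    by under eq_bigr do rewrite big_nil mulr1; apply: BJ.
  have := JB (IH _ (BM _ h Bb)) (JM (phi h (x h)) (IH _ Bb)).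
  rewrite mulr_sumr -sumrB; congr J; apply: eq_bigr => g _.
  by rewrite big_cons rmorphM /=; ring.
have := key [seq g <- enum X | g != g0] 1 B1.
rewrite (bigD1 g0) //= rmorph1 mulr1 [X in _ + X]big1 ?addr0 => [|g /andP[gX gg0]].
  by rewrite big_filter big_enum_cond.
rewrite big_filter big_enum_cond (bigD1 g) ?gX //= subrr mul0r mulr0 mul0r //.
Qed.

End CharacterIndependence.

Definition graded_action (k : fieldType) (n : nat) (gT : finGroupType) (G : {group gT})
    (act : gT -> {lrmorphism {mpoly k[n]} -> {mpoly k[n]}}) : Prop :=
  [/\ forall s, act 1%g s = s,
      {in G &, forall g h s, act (g * h)%g s = act g (act h s)},
      forall g, graded (act g)
    & {in G, forall g, (forall i, act g 'X_i%R = 'X_i%R) -> g = 1%g}].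

Section GradedAction.
Local Open Scope ring_scope.
Variables (k : fieldType) (n : nat) (gT : finGroupType) (G : {group gT}).
Local Notation S := {mpoly k[n]}.
Variable act : gT -> {lrmorphism S -> S}.
Hypothesis actG : graded_action G act.

Definition fixed (H : {set gT}) : {pred S} := [pred s : S | [forall g in H, act g s == s]].

Lemma fixedP (H : {set gT}) s : reflect (forall g, g \in H -> act g s = s) (s \in fixed H).
Proof.
apply: (iffP forallP) => [h g gH|h g]; last by apply/implyP => /h ->.
by have /implyP/(_ gH)/eqP := h g.
Qed.

Fact fixed_closed H : subring_closed (fixed H).
Proof.
split=> [|s t|s t]; first by apply/fixedP => g _; rewrite rmorph1.
  by move=> /fixedP hs /fixedP ht; apply/fixedP => g gH; rewrite rmorphB /= hs ?ht.
by move=> /fixedP hs /fixedP ht; apply/fixedP => g gH; rewrite rmorphM /= hs ?ht.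
Qed.
HB.instance Definition _ H := GRing.isSubringClosed.Build S (fixed H) (fixed_closed H).

Lemma fixed_const H c : c%:MP \in fixed H.
Proof. by apply/fixedP => g _; rewrite lrmorph_mpolyC. Qed.

Lemma fixed_scale H c s : s \in fixed H -> c *: s \in fixed H.
Proof. by move=> hs; rewrite -mul_mpolyC rpredM ?fixed_const. Qed.

Lemma graded_act1 s : act 1%g s = s. Proof. by case: actG. Qed.
Lemma graded_actM g h s : g \in G -> h \in G -> act (g * h)%g s = act g (act h s).
Proof. by case: actG => _ hM _ _ gG hG; apply: hM. Qed.
Lemma graded_act_graded g : graded (act g). Proof. by case: actG. Qed.
Lemma graded_act_faithful g h : g \in G -> h \in G ->
  (forall i, act g 'X_i = act h 'X_i) -> g = h.
Proof.
case: actG => _ _ _ hF gG hG e; apply/eqP; rewrite eq_mulVg1; apply/eqP/hF.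
  by rewrite groupM ?groupV.
by move=> i; rewrite graded_actM ?groupV // -e -graded_actM ?groupV // mulVg graded_act1.
Qed.

Lemma fixed_pihomog H d s : s \in fixed H -> pihomog mdeg d s \in fixed H.
Proof.
move=> /fixedP hs; apply/fixedP => g gH.
by rewrite graded_pihomog ?hs //; exact: graded_act_graded.
Qed.

Lemma graded_actKV g s : g \in G -> act g (act g^-1%g s) = s.
Proof. by move=> gG; rewrite -graded_actM ?groupV // mulgV graded_act1. Qed.
Lemma prod_act (H : {group gT}) (s : S) : H \subset G -> \prod_(g in H) act g s \in fixed H.
Proof.
move=> sHG; apply/fixedP => u uH; rewrite rmorph_prod /= [RHS](reindex_inj (mulgI u)) /=.
by apply: eq_big => g; rewrite ?groupMl // => gH; rewrite graded_actM // (subsetP sHG).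
Qed.

(* Lagrange interpolation at the conjugates of [z] writes [theta] as a       *)
(* combination of the group elements, up to a denominator.                   *)
Lemma semilinear_expansion (H : {group gT}) (eps : {rmorphism S -> S}) (theta : S -> S) z :
  H \subset G -> {morph theta : s t / s + t} ->
  (forall c s, c \in fixed H -> theta (c * s) = eps c * theta s) ->
  {in H &, forall g h, eps (act g z) = eps (act h z) -> g = h} ->
  exists2 delta, delta != 0 & exists C : gT -> S,
    forall s, delta * theta s = \sum_(g in H) C g * eps (act g s).
Proof.
move=> sHG thetaD thetaM zinj.
have thetaS (J : Type) (r : seq J) (P : pred J) (F : J -> S) :
    theta (\sum_(j <- r | P j) F j) = \sum_(j <- r | P j) theta (F j).
  elim/big_rec2: _ => [|i t u _ <-]; last by rewrite thetaD.
  by apply: (addrI (theta 0)); rewrite -thetaD !addr0.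
pose E g : {poly S} := \prod_(h in H | h != g) ('X - (act h z)%:P).
pose N := (\max_(g in H) size (E g))%N.
pose P s : {poly S} := \sum_(g in H) (act g s)%:P * E g.
have Esize g : g \in H -> (size (E g) <= N)%N by move=> gH; apply: (leq_bigmax_cond (F := fun g => size (E g))).
have Psize s : (size (P s) <= N)%N.
  apply: leq_trans (size_sum _ _ _) _; apply/bigmax_leqP => g gH.
  by rewrite mul_polyC (leq_trans (size_scale_leq _ _)) ?Esize.
have actE u g : u \in H -> g \in H -> map_poly (act u) (E g) = E (u * g)%g.
  move=> uH gH; rewrite rmorph_prod /= [RHS](reindex_inj (mulgI u)) /=.
  apply: eq_big => h; first by rewrite groupMl // (inj_eq (mulgI u)).
  by case/andP=> hH _; rewrite map_polyXsubC graded_actM // (subsetP sHG).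
have Pinv s j : (P s)`_j \in fixed H.
  apply/fixedP => u uH; suff Pu : map_poly (act u) (P s) = P s by rewrite -coef_map Pu.
  rewrite /P rmorph_sum /= [RHS](reindex_inj (mulgI u)) /=.
  apply: eq_big => g; rewrite ?groupMl // => gH.
  rewrite rmorphM /= map_polyC (actE _ _ uH gH); congr (_%:P * _).
  by rewrite graded_actM ?(subsetP sHG).
pose d := \prod_(h in H | h != 1%g) (z - act h z).
have Pz s : (P s).[z] = s * d.
  rewrite /P horner_sum (bigD1 1%g) //= [X in _ + X]big1 ?addr0; last first.
    move=> g /andP[gH g1]; rewrite /E (bigD1 1%g) /= ?group1 1?eq_sym // hornerM.
    by rewrite graded_act1 [X in _ * X]hornerM hornerXsubC subrr mul0r mulr0.
  rewrite hornerM hornerC graded_act1 horner_prod; congr (_ * _).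
  by apply: eq_bigr => h _; rewrite hornerXsubC.
(* The cofactor completes [d] to its norm over [H], a fixed element that [theta] lets out through
   [eps]. *)
pose dc := \prod_(g in H | g != 1%g) act g d.
have ddc : d * dc = \prod_(g in H) act g d by rewrite [RHS](bigD1 1%g) //= graded_act1.
exists (eps (d * dc)).
  rewrite ddc rmorph_prod; apply/prodf_neq0 => g gH.
  rewrite !rmorph_prod; apply/prodf_neq0 => h /andP[hH h1].
  rewrite !rmorphB /= -graded_actM ?(subsetP sHG) // subr_eq0; apply: contraNneq h1 => /zinj.
  by rewrite groupM // => /(_ gH isT) /eqP; rewrite eq_sym -[g in _ == g]mulg1 (inj_eq (mulgI g)).
exists (fun g => eps (act g dc) * \sum_(j < N) eps (E g)`_j * theta (z ^+ j)) => s.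
rewrite -thetaM; last by rewrite ddc prod_act.
have -> : d * dc * s = (P (s * dc)).[z] by rewrite Pz mulrC [d * dc]mulrC mulrA.
rewrite (horner_coef_wide _ (Psize _)) thetaS.
under eq_bigr do rewrite thetaM ?Pinv // coef_sum rmorph_sum mulr_suml.
rewrite exchange_big; apply: eq_bigr => g gH /=.
rewrite mulr_sumr mulr_suml; apply: eq_bigr => j _.
by rewrite coefCM !rmorphM /=; ring.
Qed.

Definition prod_of (Q : S -> Prop) (L : S) :=
  exists2 ls : seq S, (forall l, l \in ls -> Q l) & L = \prod_(l <- ls) l.

Lemma prod_of_prod (Q : S -> Prop) (I : finType) (P : pred I) (F : I -> S) :
  (forall i, P i -> prod_of Q (F i)) -> prod_of Q (\prod_(i | P i) F i).
Proof.
move=> h; elim/big_ind: _ => //; first by exists [::]; rewrite ?big_nil.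
move=> _ _ [ls hs ->] [lt ht ->]; exists (ls ++ lt); last by rewrite big_cat.
by move=> l; rewrite mem_cat => /orP[/hs|/ht].
Qed.

Lemma prod_of1 (Q : S -> Prop) l : Q l -> prod_of Q l.
Proof. by move=> Ql; exists [:: l]; rewrite ?big_seq1 // => r; rewrite inE => /eqP->. Qed.

(** The denominator [delta] of the previous expansion is no product of linear forms. Independence
    modulo [delta] shows that [delta] divides [C g * Lam g], with [Lam g] a product of differences
    of linear forms; so [delta] can be traded for the product of all [Lam g]. *)
Lemma semilinear_expansion_linear_forms (H : {group gT}) (eps : {lrmorphism S -> S}) (theta : S -> S) :
  H \subset G -> {morph theta : s t / s + t} ->
  (forall c s, c \in fixed H -> theta (c * s) = eps c * theta s) ->
  graded eps ->
  {in H &, forall g h, (forall i, eps (act g 'X_i) = eps (act h 'X_i)) -> g = h} ->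
  exists2 L, prod_of (fun l => l != 0 /\ exists g h i, [/\ g \in H, h \in H &
      l = eps (act g 'X_i) - eps (act h 'X_i)]) L & exists D : gT -> S,
    forall s, L * theta s = \sum_(g in H) D g * eps (act g s).
Proof.
move=> sHG thetaD thetaM geps epsF.
have gr g : graded (eps \o act g).
  by move=> i /=; apply: graded_homog => //; exact: graded_act_graded.
have [delta d0 [C CP]] := semilinear_expansion sHG thetaD thetaM
  (z := separator k n) (fun g h gH hH e => epsF g h gH hH
    (separatorP (phi := eps \o act g) (psi := eps \o act h) (gr g) (gr h) e)).
have [ix ixP] : exists ix : gT * gT -> S, forall p, p.1 \in H -> p.2 \in H -> p.1 != p.2 ->
    exists2 i, ix p = 'X_i & eps (act p.1 'X_i) != eps (act p.2 'X_i).
  apply: (fin_all_exists (P := fun p x => p.1 \in H -> p.2 \in H -> p.1 != p.2 ->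
    exists2 i, x = 'X_i & eps (act p.1 'X_i) != eps (act p.2 'X_i))) => -[g h] /=.
  case: (boolP [exists i, eps (act g 'X_i) != eps (act h 'X_i)]) => [/existsP[i ne]|/existsPn e].
    by exists 'X_i => _ _ _; exists i.
  exists 0 => gH hH /eqP[]; apply: epsF => // i; apply/eqP.
  by have := e i; rewrite negbK.
pose Lam g := \prod_(h in H | h != g) (eps (act g (ix (g, h))) - eps (act h (ix (g, h)))).
have CL g : g \in H -> exists D, C g * Lam g = delta * D.
  move=> gH; apply: (@morphism_independence S S gT H (fun g => eps \o act g) (fun=> True)
    (fun s => exists D, s = delta * D) _ _ C (fun h => ix (g, h))) => //.
  - by move=> _ _ [a ->] [b ->]; exists (a - b); rewrite mulrBr.
  - by move=> r _ [a ->]; exists (r * a); rewrite mulrCA.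
  - by move=> b _; exists (theta b); rewrite CP.
exists (\prod_(g in H) Lam g).
  apply: prod_of_prod => g gH; apply: prod_of_prod => h /andP[hH hg]; apply: prod_of1.
  have [|i e ne] := ixP (g, h) gH hH; first by rewrite eq_sym.
  by rewrite subr_eq0 e; split=> //; exists g, h, i.
have [D DP] : exists D : gT -> S, forall g, g \in H -> C g * \prod_(h in H) Lam h = delta * D g.
  apply: (fin_all_exists (P := fun g D => g \in H -> C g * \prod_(h in H) Lam h = delta * D)) => g.
  case: (boolP (g \in H)) => [gH|_]; last by exists 0.
  have [D e] := CL g gH; exists (D * \prod_(h in H | h != g) Lam h) => _.
  by rewrite (bigD1 g gH) [LHS]mulrA e mulrA.
exists D => s; apply: (mulfI d0); rewrite mulrCA CP !mulr_sumr; apply: eq_bigr => g gH.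
by rewrite mulrA [_ * C g]mulrC DP // mulrA.
Qed.

End GradedAction.

(** * Coregular actions *)

Lemma horner_map_prod_XsubC (R R' : comNzRingType) (phi : {rmorphism R -> R'})
    (I : finType) (A : {pred I}) (c : I -> R) (y : R') :
  ((map_poly phi (\prod_(i in A) ('X - (c i)%:P))).[y] = \prod_(i in A) (y - phi (c i)))%R.
Proof.
rewrite rmorph_prod horner_prod; apply: eq_bigr => i _.
by rewrite /= map_polyXsubC hornerXsubC.
Qed.

Section Forward.
Local Open Scope ring_scope.
Variables (k : fieldType) (n : nat) (gT : finGroupType) (G : {group gT}).
Local Notation S := {mpoly k[n]}.
Variable act : gT -> {lrmorphism S -> S}.
Hypothesis actG : graded_action G act.
Local Notation fixed := (fixed act).

Lemma norm_poly_invariant (H : {group gT}) s : H \subset G ->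
  forall j, (\prod_(g in H) ('X - (act g s)%:P))`_j \in fixed H.
Proof.
move=> sHG j; set P := \prod_(g in H) _; apply/fixedP => u uH.
suff Pu : map_poly (act u) P = P by rewrite -coef_map Pu.
rewrite /P rmorph_prod /= [RHS](reindex_inj (mulgI u)) /=.
apply: eq_big => g; rewrite ?groupMl // => gH.
by rewrite map_polyXsubC (graded_actM actG) // (subsetP sHG).
Qed.

(** A form of the transitivity of [W] on primes above a prime. The norm polynomial of the separator
    [z] has coefficients in [fixed W], so [rho (act g' z)] is a root of its image under
    [rho \o act g], hence some [rho (act (g * w) z)]; and [z] determines a graded morphism. *)
Lemma inertia (W : {group gT}) (rho : {lrmorphism S -> S}) g g' :
  W \subset G -> graded rho -> g \in G -> g' \in G ->
  (forall x, x \in fixed W -> rho (act g x) = rho (act g' x)) ->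
  exists2 w, w \in W & forall i, rho (act g' 'X_i) = rho (act (g * w)%g 'X_i).
Proof.
move=> sWG grho gG gG' eqW.
have gr h : graded (rho \o act h).
  by move=> i /=; apply: graded_homog => //; exact: (graded_act_graded actG h).
pose z := separator k n.
pose P : {poly S} := \prod_(w in W) ('X - (act w z)%:P).
have eqQ : map_poly (rho \o act g) P = map_poly (rho \o act g') P.
  by apply/polyP => j; rewrite !coef_map /=; apply/eqW/norm_poly_invariant.
have : (map_poly (rho \o act g) P).[rho (act g' z)] == 0.
  rewrite eqQ (horner_map_prod_XsubC (rho \o act g')) (bigD1 1%g) //=.
  by rewrite (graded_act1 actG) subrr mul0r.
rewrite (horner_map_prod_XsubC (rho \o act g)) => /prodf_eq0[w wW].
rewrite /= subr_eq0 -(graded_actM actG _ gG (subsetP sWG w wW)) => /eqP e.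
exists w => //.
exact: (separatorP (phi := rho \o act g') (psi := rho \o act (g * w)%g)).
Qed.

Hypothesis abG : abelian G.
Variable W : {group gT}.
Hypothesis sWG : W \subset G.
Hypothesis W_refl : forall h l, h \in G -> l \is 1.-homog -> l != 0 ->
  (forall i, exists c, act h 'X_i - 'X_i = c *: l) -> h \in W.

(** Modulo the prime [l], distinct members of [X] remain distinct on [fixed W]: otherwise [inertia]
    yields a product congruent to 1 modulo [l], which [W_refl] places in [W]. Independence modulo
    [l] then makes each coefficient divisible. *)
Lemma transversal_descent (X : {set gT}) (C : gT -> S) (l : S) :
  X \subset G -> {in X &, forall g h, (g^-1 * h)%g \in W -> g = h} ->
  l \is 1.-homog -> l != 0 ->
  (forall b, b \in fixed W -> exists r, \sum_(g in X) C g * act g b = l * r) ->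
  forall g, g \in X -> exists r, C g = l * r.
Proof.
move=> sXG Xinj l1 l0 CP g gX.
have [t t1 tP] := linear_form_quotient l1 l0.
pose rho : {lrmorphism S -> S} := comp_mpoly t.
have grho : graded rho by move=> i; rewrite /= comp_mpolyXU -tnth_nth.
have [x xP] : exists x : gT -> S, forall h, x h \in fixed W /\
    (h \in X -> h != g -> rho (act g (x h)) != rho (act h (x h))).
  apply: (fin_all_exists (P := fun h x => x \in fixed W /\
    (h \in X -> h != g -> rho (act g x) != rho (act h x)))) => h.
  case: (boolP ((h \in X) && (h != g))) => [/andP[hX hg]|nh]; last first.
    by exists 0; split=> [|hX hg]; [exact: rpred0 | rewrite hX hg in nh].
  have gG := subsetP sXG _ gX; have hG := subsetP sXG _ hX.
  apply: NNPP => nx.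
  have [w wW e] : exists2 w, w \in W &
      forall i, rho (act h 'X_i) = rho (act (g * w)%g 'X_i).
    apply: inertia => // x xW; apply/eqP/negPn/negP => ne.
    by apply: nx; exists x.
  have wG := subsetP sWG _ wW.
  have ee := lrmorph_ext (phi := rho \o act h) (psi := rho \o act (g * w)%g) e.
  have uW : (g * w * h^-1)%g \in W.
    apply: (W_refl (l := l)) => // [|i]; first by rewrite !groupM ?groupV.
    have := ee (act h^-1%g 'X_i); rewrite /= (graded_actKV actG) // -(graded_actM actG) ?groupM ?groupV //.
    move=> /esym/eqP; rewrite -subr_eq0 -(rmorphB rho) => /eqP/tP[r e2].
    exists r@_0; rewrite -mul_mpolyC -pihomog0E mulrC -(pihomogM 0 r l1) -e2 pihomog_dE //.
    by rewrite rpredB ?(graded_act_graded actG) // dhomogX; apply/eqP; exact: mdeg1.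
  case/negP: hg; rewrite eq_sym; apply/eqP/Xinj => //.
  (* Commutativity passes from [g * w * h^-1] in [W] to [g^-1 * h] in [W], that is, to equal
     cosets. *)
  have cGW u v : u \in G -> v \in G -> (u * v = v * u)%g by move=> *; apply: (centsP abG).
  rewrite -groupV invMg invgK (cGW h^-1%g) ?groupV //.
  by move: uW; rewrite -mulgA (cGW w) ?groupV // mulgA groupMr.
have Cg : exists r, C g * \prod_(h in X | h != g) (act g (x h) - act h (x h)) = l * r.
  apply: (@morphism_independence S S gT X act (fun b => b \in fixed W)
    (fun s => exists r, s = l * r)) => // [_ _ [u ->] [v ->]|r _ [u ->]||b h bW].
  - by exists (u - v); rewrite mulrBr.
  - by exists (r * u); rewrite mulrCA.
  - exact: rpred1.
  - by rewrite rpredM //; case: (xP h).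
have := Cg; rewrite -tP rmorphM => /eqP; rewrite mulf_eq0 => /orP[/eqP/tP //|].
rewrite rmorph_prod => /prodf_eq0[h /andP[hX hg]].
rewrite rmorphB subr_eq0 => e; have [_ /(_ hX hg)] := xP h; by rewrite /= e.
Qed.

Lemma expansion_on_fixed (theta : S -> S) :
  {morph theta : s t / s + t} ->
  (forall c s, c \in fixed G -> theta (c * s) = c * theta s) ->
  exists C : gT -> S, forall b, b \in fixed W -> theta b = \sum_(g in G) C g * act g b.
Proof.
move=> thetaD thetaM.
have gid : graded (idfun : {lrmorphism S -> S}) by move=> i; exact: dhomog_var.
have [_ [ls lsQ ->] [D DP]] := semilinear_expansion_linear_forms actG
  (eps := idfun) (subxx G) thetaD thetaM gid (fun g h gG hG => graded_act_faithful actG gG hG).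
pose X := [set g in G | repr (g *: W)%g == g].
have sXG : X \subset G by apply/subsetP => g; rewrite inE => /andP[].
have Xinj : {in X &, forall g h, (g^-1 * h)%g \in W -> g = h}.
  move=> g h; rewrite !inE => /andP[_ /eqP eg] /andP[_ /eqP eh] ghW.
  by rewrite -eg -eh; congr (repr _); apply/esym/lcoset_eqP; rewrite mem_lcoset.
have reprG g : g \in G -> repr (g *: W)%g \in G.
  move=> gG; have /lcosetP[w wW ->] : repr (g *: W)%g \in (g *: W)%g by exact: mem_repr (lcoset_refl _ _).
  by rewrite groupM // (subsetP sWG).
(* On [fixed W] the members of a coset act alike, so the coefficients are summed coset by coset; the
   denominator is then removed one linear form at a time. *)
suff key : forall ls, (forall l, l \in ls -> l != 0 /\ l \is 1.-homog) ->
   forall C : gT -> S,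
   (forall b, b \in fixed W -> (\prod_(l <- ls) l) * theta b = \sum_(g in X) C g * act g b) ->
   exists C : gT -> S, forall b, b \in fixed W -> theta b = \sum_(g in X) C g * act g b.
  have lsP l : l \in ls -> l != 0 /\ l \is 1.-homog.
    move=> /lsQ[l0 [g [h [i [gG hG e]]]]]; split=> //.
    by rewrite e /= rpredB ?(graded_act_graded actG).
  have [|C CP] := key ls lsP (fun x => \sum_(g in G | repr (g *: W)%g == x) D g).
    move=> b bW; rewrite DP (partition_big (fun g => repr (g *: W)%g) (mem X)) /=.
      apply: eq_bigr => x xX; rewrite mulr_suml; apply: eq_bigr => g /andP[gG /eqP e].
      congr (_ * _); rewrite -e; have : repr (g *: W)%g \in (g *: W)%g by exact: mem_repr (lcoset_refl _ _).
      case/lcosetP=> w wW ->; rewrite (graded_actM actG _ gG (subsetP sWG w wW)).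
      by have /fixedP/(_ _ wW) -> := bW.
    move=> g gG; rewrite inE reprG //=; apply/eqP; congr (repr _); apply/lcoset_eqP.
    exact: mem_repr (lcoset_refl _ _).
  exists (fun g => if g \in X then C g else 0) => b bW; rewrite CP //.
  rewrite [RHS](bigID (mem X)) /= [X in _ + X]big1 ?addr0 => [|g /andP[_ /negPf ->]]; last by rewrite mul0r.
  apply: eq_big => g; first by rewrite andb_idl // => /(subsetP sXG).
  by move=> ->.
elim=> [|l lr IH] lsP C CP.
  by exists C => b bW; rewrite -CP // big_nil mul1r.
have [l0 l1] := lsP l (mem_head _ _).
have lC : exists C' : gT -> S, forall g, g \in X -> C g = l * C' g.
  apply: (fin_all_exists (P := fun g r => g \in X -> C g = l * r)) => g.
  case: (boolP (g \in X)) => [gX|_]; last by exists 0.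
  have [|r ->] := transversal_descent sXG Xinj l1 l0 (C := C) _ gX; last by exists r.
  by move=> b bW; exists (\prod_(l' <- lr) l' * theta b); rewrite -CP // big_cons mulrA.
have [C' C'P] := lC; apply: (IH _ C') => [r rlr|b bW].
  by apply: lsP; rewrite inE rlr orbT.
apply: (mulfI l0); have := CP b bW; rewrite big_cons -mulrA => ->; rewrite mulr_sumr.
by apply: eq_bigr => g gX; rewrite C'P // mulrA.
Qed.

Section Generated.
Variable f : n.-tuple S.
Hypothesis f_fixed : forall i, tnth f i \in fixed G.
Hypothesis f_gen : forall a, a \in fixed G -> exists p : {mpoly k[n]}, a = p \mPo f.

Lemma fixed_dual_basis : exists (D : {mpoly S[n]}) (theta : 'X_{1..n} -> S -> S),
  [/\ forall e s, theta e s \in fixed G,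
      forall e c s t, c \in fixed G -> theta e (c * s + t) = c * theta e s + theta e t
    & forall s, s = \sum_(e <- msupp D) D@_e * theta e s].
Proof.
pose A : subringClosed S := fixed G.
pose b (i : 'I_n) : {poly S} := \prod_(g in G | g != 1%g) ('X - (act g 'X_i)%:P).
have b_monic i : b i \is monic by rewrite rpred_prod // => g _; exact: monicXsubC.
have a_over i : b i * ('X - ('X_i)%:P) \is a polyOver A.
  apply/polyOverP => j; have := norm_poly_invariant 'X_i (subxx G) j.
  by rewrite (bigD1 1%g) //= (graded_act1 actG) mulrC.
exact: (@mpoly_dual_basis k n A f b (fixed_const act G) f_fixed f_gen b_monic a_over).
Qed.

(** For [s] homogeneous of degree d in [fixed W], each [theta e s] is a combination of conjugates of
    [s], so it has no component below d. In degree d the dual basis identity thus involves only the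
    constant terms of [D], and its right side is invariant. *)
Lemma fixed_reflections_sub : {subset fixed W <= fixed G}.
Proof.
have [D [theta [thG thM thE]]] := fixed_dual_basis.
have th0 e : theta e 0 = 0.
  by have := thM e 1 0 0 (rpred1 _); rewrite !mul1r addr0 => /esym/eqP; rewrite -subr_eq0 addrK => /eqP.
move=> b bW; suff bd d : pihomog mdeg d b \in fixed G.
  by rewrite (pihomog_partitionE (leqnn (msize b))) rpred_sum.
have {bW} : pihomog mdeg d b \in fixed W by exact: (fixed_pihomog actG).
have := pihomogP mdeg d b; set s := pihomog _ _ _ => sd sW.
rewrite -(pihomog_dE sd) (thE s) linear_sum rpred_sum //= => e _.
have [C CP] : exists C : gT -> S, forall b, b \in fixed W -> theta e b = \sum_(g in G) C g * act g b.
  apply: expansion_on_fixed => [u v|c u cG].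
    by have := thM e 1 u v (rpred1 _); rewrite !mul1r.
  by have := thM e c u 0 cG; rewrite !addr0 th0 addr0.
have low j : (j < d)%N -> pihomog mdeg j (theta e s) = 0.
  move=> jd; rewrite CP // linear_sum big1 //= => g _; rewrite mulrC.
  by apply: pihomogM_small jd; exact: graded_homog (graded_act_graded actG g) sd.
have -> : pihomog mdeg d (D@_e * theta e s) = (D@_e)@_0 *: pihomog mdeg d (theta e s).
  exact: pihomog_mul_low.
by rewrite fixed_scale // (fixed_pihomog actG).
Qed.

Lemma reflections_generate : W = G :> {set gT}.
Proof.
apply/eqP; rewrite eqEsubset sWG; apply/subsetP => g gG.
have gid : graded (idfun : {lrmorphism S -> S}) by move=> i; exact: dhomog_var.
have [x xW|w wW e] := inertia sWG gid gG (group1 G).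
  have xG := fixed_reflections_sub xW.
  by rewrite /= (graded_act1 actG); have /fixedP -> := xG.
have wG := subsetP sWG _ wW.
have /eqP : (g * w = 1)%g by apply/esym/(graded_act_faithful actG); rewrite ?groupM.
by rewrite -eq_invg_mul => /eqP e1; rewrite -groupV e1.
Qed.

Lemma equivariant_retraction : exists pi : S -> S,
  [/\ forall s, pi s \in fixed G,
      forall a s t, a \in fixed G -> pi (a * s + t) = a * pi s + pi t,
      forall a, a \in fixed G -> pi a = a
    & forall d s, s \is d.-homog -> pi s \is d.-homog].
Proof.
have [D [theta [thG thM thE]]] := fixed_dual_basis.
have th0 e : theta e 0 = 0.
  by have := thM e 1 0 0 (rpred1 _); rewrite !mul1r addr0 => /esym/eqP; rewrite -subr_eq0 addrK => /eqP.
(* Were all these constant terms zero, the identity for 1 would have constant term 0. *)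
have [e e0] : exists e, (theta e 1)@_0%MM != 0.
  apply: NNPP => ne; have : (1 : S)@_0%MM = 0; last first.
    by rewrite mcoeff1 eqxx => /eqP; rewrite oner_eq0.
  rewrite (thE 1) linear_sum big1 //= => e _.
  rewrite (rmorphM (mcoeff 0%MM)) /=; have [->|e0] := eqVneq ((theta e 1)@_0%MM) 0; first by rewrite mulr0.
  by case: ne; exists e.
pose th := theta e.
have thD u v : th (u + v) = th u + th v.
  by have := thM e 1 u v (rpred1 _); rewrite !mul1r.
have thL a u : a \in fixed G -> th (a * u) = a * th u.
  by move=> aG; have := thM e a u 0 aG; rewrite !addr0 th0 addr0.
have thZ c u : th (c *: u) = c *: th u.
  by rewrite -!mul_mpolyC thL ?fixed_const.
have thS (J : Type) (r : seq J) (F : J -> S) : th (\sum_(j <- r) F j) = \sum_(j <- r) th (F j).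
  elim/big_rec2: _ => [|i u v _ <-]; [exact: th0 | exact: thD].
(* Each homogeneous input keeps only the component of its own degree in the output. Linearity
   survives since the components of an invariant are invariant, and [T 1] is the constant term of
   [th 1]. *)
pose T : {linear S -> S} := mlin (fun m => pihomog mdeg (mdeg m) (th 'X_[m])).
have Td d s : s \is d.-homog -> T s = pihomog mdeg d (th s).
  move=> /dhomogP sd; rewrite /T /= mlinE [in RHS](mpolyE s) thS [RHS]linear_sum /= !big_seq.
  by apply: eq_bigr => m ms; rewrite thZ linearZ /= (sd m ms).
have TM a s : a \in fixed G -> T (a * s) = a * T s.
  move=> aG; rewrite (pihomog_partitionE (leqnn (msize a))) !mulr_suml linear_sum /=.
  apply: eq_bigr => i _; set ai := pihomog _ _ a.
  have aiG : ai \in fixed G by exact: (fixed_pihomog actG).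
  have aid : ai \is (i : nat).-homog := pihomogP _ _ _.
  rewrite (mpolyE s) mulr_sumr !linear_sum mulr_sumr /=; apply: eq_bigr => m _.
  rewrite -scalerAr !linearZ /= -scalerAr; congr (_ *: _).
  rewrite (Td (i + mdeg m)%N) ?dhomogM ?dhomogX // thL // (pihomogM _ _ aid).
  by rewrite /T /= mlinX.
pose c := (theta e 1)@_0%MM.
have T1 : T 1 = c%:MP by rewrite (Td 0) ?dhomog1 // pihomog0E.
exists (fun s => c^-1 *: T s); split.
- move=> s; apply: fixed_scale; rewrite /T /= mlinE rpred_sum // => m _.
  by rewrite fixed_scale // (fixed_pihomog actG) // /th thG.
- by move=> a s t aG; rewrite linearD /= TM // scalerDr scalerAr.
- by move=> a aG; rewrite -[a in T a]mulr1 TM // T1 scalerAr -mul_mpolyC -rmorphM /= mulVf // mulr1.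
- by move=> d s sd; rewrite rpredZ // (Td d) // pihomogP.
Qed.

End Generated.

End Forward.

(** * Coordinates adapted to the reflections *)

Lemma gen_ind (gT : finGroupType) (A : {set gT}) (P : gT -> Prop) :
  P 1%g -> (forall r g, r \in A -> g \in <<A>>%g -> P g -> P (r * g)%g) ->
  forall g, g \in <<A>>%g -> P g.
Proof.
move=> P1 PM g /gen_prodgP[m [c cA ->]].
elim: m c cA => [|m IH] c cA; first by rewrite big_ord0.
rewrite big_ord_recl; apply: PM; first exact: cA.
  by apply: group_prod => i _; apply/mem_gen/cA.
by apply: IH => i; apply: cA.
Qed.

Lemma exists_free_subseq (K : fieldType) (E : vectType K) (s : seq E) :
  exists2 t, {subset t <= s} & free t /\ <<t>>%VS = <<s>>%VS.
Proof.
elim: s => [|x s [t ts [ft et]]].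
  by exists [::] => //; split=> //; exact: nil_free.
case: (boolP (x \in <<s>>%VS)) => xs.
  exists t => [y yt|]; first by rewrite inE ts ?orbT.
  by split=> //; rewrite et span_cons; apply/esym/addv_idPr; rewrite -memvE.
exists (x :: t) => [y|]; first by rewrite !inE => /orP[->//|/ts->]; rewrite orbT.
by rewrite free_cons et xs ft !span_cons et.
Qed.

Section AdaptedBasis.
Local Open Scope ring_scope.
Variables (k : fieldType) (n : nat) (gT : finGroupType) (G : {group gT}).
Local Notation S := {mpoly k[n]}.
Local Notation E := 'rV[k]_n.
Variable act : gT -> {lrmorphism S -> S}.
Hypothesis actG : graded_action G act.
Hypothesis abG : abelian G.

(** Linear forms are transported to row vectors, a finite dimensional space in which kernels,
    complements and bases can be taken. *)
Definition lform (u : E) : S := \sum_i u 0 i *: 'X_i.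

Fact lform_is_linear : linear lform.
Proof.
move=> c u v; rewrite /lform scaler_sumr -big_split; apply: eq_bigr => i _.
by rewrite !mxE scalerDl scalerA.
Qed.
HB.instance Definition _ := GRing.isLinear.Build k E S *:%R lform lform_is_linear.

Lemma lform_homog u : lform u \is 1.-homog.
Proof. by rewrite rpred_sum // => i _; rewrite rpredZ // dhomog_var. Qed.

Definition lcoefs (s : S) : E := \row_j s@_U_(j).
Fact lcoefs_is_linear : linear lcoefs.
Proof. by move=> c s t; apply/rowP => j; rewrite !mxE linearP. Qed.
HB.instance Definition _ := GRing.isLinear.Build k S E *:%R lcoefs lcoefs_is_linear.

Lemma lformK : cancel lform lcoefs.
Proof.
move=> u; apply/rowP => j; rewrite mxE linear_sum (bigD1 j) //= mcoeffZ mcoeffXU eqxx mulr1.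
by rewrite big1 ?addr0 // => i ij; rewrite mcoeffZ mcoeffXU (negPf ij) mulr0.
Qed.

Lemma lcoefsK s : s \is 1.-homog -> lform (lcoefs s) = s.
Proof. by move=> s1; rewrite [RHS](dhomog1E s1); apply: eq_bigr => i _; rewrite mxE. Qed.

Definition actV g : 'End(E) := linfun (lcoefs \o act g \o lform).

Lemma lform_actV g u : lform (actV g u) = act g (lform u).
Proof. by rewrite lfunE /= lcoefsK // graded_homog ?lform_homog //; exact: graded_act_graded actG g. Qed.

Lemma lform_inj : injective lform. Proof. exact: can_inj lformK. Qed.

Lemma actVM g h u : g \in G -> h \in G -> actV (g * h)%g u = actV g (actV h u).
Proof. by move=> gG hG; apply: lform_inj; rewrite !lform_actV (graded_actM actG). Qed.

Lemma actV1 u : actV 1%g u = u.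
Proof. by apply: lform_inj; rewrite lform_actV (graded_act1 actG). Qed.

Variable Refl : {set gT}.
Hypothesis G_gen : <<Refl>>%g = G.
Hypothesis ReflP : forall r, r \in Refl ->
  exists2 l, l \is 1.-homog /\ l != 0 & forall i, exists c, act r 'X_i - 'X_i = c *: l.

Let ReflG r : r \in Refl -> r \in G.
Proof. by move=> rR; rewrite -G_gen mem_gen. Qed.

Lemma reflection_rank1 : exists (a : gT -> 'Hom(E, k^o)) (l : gT -> E),
  forall r, r \in Refl -> l r != 0 /\ forall u, actV r u = u + a r u *: l r.
Proof.
have [F FP] : exists F : gT -> 'Hom(E, k^o) * E, forall r, r \in Refl ->
    (F r).2 != 0 /\ forall u, actV r u = u + (F r).1 u *: (F r).2.
  apply: (fin_all_exists (P := fun r (F : 'Hom(E, k^o) * E) => r \in Refl ->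
    F.2 != 0 /\ forall u, actV r u = u + F.1 u *: F.2)) => r.
  case: (boolP (r \in Refl)) => [rR|_]; last by exists (0, 0).
  have [l [l1 l0] lP] := ReflP rR.
  have [c cP] : exists c : 'I_n -> k, forall i, act r 'X_i - 'X_i = c i *: l.
    exact: (fin_all_exists (P := fun i c => act r 'X_i - 'X_i = c *: l)).
  have lin : linear_for *:%R (fun u : E => \sum_i u 0 i * c i : k^o).
    move=> d u v; rewrite scaler_sumr -big_split; apply: eq_bigr => i _.
    by rewrite !mxE mulrDl -mulrA.
  pose L := GRing.isLinear.Build k E k^o *:%R _ lin.
  pose f : {linear E -> k^o} := HB.pack (fun u : E => \sum_i u 0 i * c i : k^o) L.
  have fE u : linfun f u = \sum_i u 0 i * c i by rewrite lfunE.
  exists (linfun f, lcoefs l) => _; split=> [|u]; rewrite [(_, _).2]/=.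
    by apply: contraNneq l0 => e; rewrite -(lcoefsK l1) e linear0.
  apply: lform_inj; rewrite lform_actV [(_, _).1]/= fE linearD linearZ /= (lcoefsK l1).
  rewrite scaler_suml {1 2}/lform linear_sum -big_split /=; apply: eq_bigr => i _.
  by rewrite linearZ /= -scalerA -cP scalerBr addrC subrK.
by exists (fun r => (F r).1), (fun r => (F r).2).
Qed.

Lemma memv_bigcap (I : finType) (P : pred I) (U : I -> {vspace E}) v :
  reflect (forall i, P i -> v \in U i) (v \in (\bigcap_(i | P i) U i)%VS).
Proof. by rewrite memvE; apply: (iffP subv_bigcapP) => h i /h; rewrite memvE. Qed.

Section Commuting.
Variables (a : gT -> 'Hom(E, k^o)) (l : gT -> E).
Hypothesis l0 : forall r, r \in Refl -> l r != 0.
Hypothesis aE : forall r u, r \in Refl -> actV r u = u + a r u *: l r.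

Lemma reflections_commute r s u : r \in Refl -> s \in Refl ->
  (a r u * a s (l r)) *: l s = (a s u * a r (l s)) *: l r.
Proof.
move=> rR sR; have : actV s (actV r u) = actV r (actV s u).
  by rewrite -!actVM ?ReflG // (centsP abG _ (ReflG sR) _ (ReflG rR)).
rewrite !(aE _ rR) !(aE _ sR) !linearD !linearZ /= !scalerDl !addrA.
rewrite [u + _ + _]addrAC => /addrI; rewrite -!scalerA; exact.
Qed.

(** The line of [l r] is an eigenline of [r], preserved by the commuting [s]. If [s] moves [l r],
    then [l s] has to lie on it. *)
Lemma reflection_root r s : r \in Refl -> s \in Refl ->
  a r (l r) != 0 -> a s (l r) != 0 -> exists2 c, c != 0 & l s = c *: l r.
Proof.
move=> rR sR ar as_; have e := reflections_commute (l r) rR sR.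
exists ((a r (l r) * a s (l r))^-1 * (a s (l r) * a r (l s))).
  apply: contraNneq (l0 sR) => c0; have := congr1 ( *:%R (a r (l r) * a s (l r))^-1) e.
  by rewrite !scalerA c0 mulVf ?mulf_neq0 // scale1r scale0r => ->.
by rewrite -scalerA -e scalerA mulVf ?mulf_neq0 // scale1r.
Qed.

(** Suppose [a s (l r) != 0]. Applying [a r] to the commutation relation kills its right side, which
    forces [a r (l s) = 0]; the relation itself then makes [l s] vanish. *)
Lemma transvection_root_fixed r s u : r \in Refl -> s \in Refl ->
  a r (l r) = 0 -> a r u != 0 -> a s (l r) = 0.
Proof.
move=> rR sR ar au; apply/eqP/negPn/negP => as_.
have e := reflections_commute u rR sR.
have : a r ((a r u * a s (l r)) *: l s) = a r ((a s u * a r (l s)) *: l r) by rewrite e.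
rewrite !linearZ /= ar scaler0 => /eqP; rewrite mulf_eq0 (negPf (mulf_neq0 au as_)) /= => /eqP ars.
move/eqP: e; rewrite ars mulr0 scale0r scaler_eq0 (negPf (mulf_neq0 au as_)) /=.
by rewrite (negPf (l0 sR)).
Qed.

Definition diagonal_reflections := [set r in Refl | a r (l r) != 0].
Local Notation D := diagonal_reflections.

Definition diag_fixed : {vspace E} := (\bigcap_(r in D) lker (a r))%VS.
Definition all_fixed : {vspace E} := (\bigcap_(g in G) fixedSpace (actV g))%VS.

Lemma diag_fixedP u : reflect (forall r, r \in D -> a r u = 0) (u \in diag_fixed).
Proof.
by apply: (iffP (memv_bigcap _ _ _)) => h r /h; rewrite memv_ker => /eqP.
Qed.

Lemma all_fixedP u : reflect (forall g, g \in G -> actV g u = u) (u \in all_fixed).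
Proof.
by apply: (iffP (memv_bigcap _ _ _)) => h r /h; [move/fixedSpaceP | move=> ?; apply/fixedSpaceP].
Qed.

Lemma all_fixed_gen u : (forall r, r \in Refl -> a r u = 0) -> u \in all_fixed.
Proof.
move=> h; apply/all_fixedP => g; rewrite -G_gen; move: g; apply: gen_ind => [|r g rR gG IH].
  exact: actV1.
rewrite G_gen in gG; by rewrite (actVM _ (ReflG rR) gG) IH aE // h // scale0r addr0.
Qed.

(** A reflection that moves [u] has to be a transvection, and the root along which it moves [u] is
    fixed by every reflection. *)
Lemma diag_fixed_move u g : u \in diag_fixed -> g \in G -> actV g u - u \in all_fixed.
Proof.
move=> uE; have step r : r \in Refl -> actV r u - u \in all_fixed.
  move=> rR; rewrite aE // addrC addKr.
  have [->|au] := eqVneq (a r u) 0; first by rewrite scale0r mem0v.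
  apply/memvZ/all_fixed_gen => s sR; apply: (transvection_root_fixed rR sR _ au).
  apply/eqP/negPn/negP => ar; case/eqP: au.
  by apply: (diag_fixedP _ uE); rewrite inE rR.
rewrite -G_gen; move: g; apply: gen_ind => [|r g rR gG IH]; first by rewrite actV1 subrr mem0v.
rewrite G_gen in gG; rewrite (actVM _ (ReflG rR) gG).
have -> : actV r (actV g u) - u = (actV g u - u) + (actV r u - u).
  rewrite -[in actV r (actV g u)](subrK u (actV g u)) linearD /=.
  by have /all_fixedP/(_ _ (ReflG rR)) -> := IH; rewrite addrA.
by apply: memvD => //; apply: step.
Qed.

Lemma diagonal_basis : exists ws : seq E,
  [/\ free ws, (<<ws>> + diag_fixed = fullv)%VS, (<<ws>> :&: diag_fixed = 0)%VS
    & forall w g, w \in ws -> g \in G -> exists c, actV g w = c *: w].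
Proof.
have [ws wsD [fws ews]] := exists_free_subseq [seq l r | r <- enum D].
have wsP w : w \in ws -> exists2 r, r \in D & w = l r.
  by move=> /wsD/mapP[r rD ->]; exists r; rewrite // -mem_enum.
have DR r : r \in D -> r \in Refl /\ a r (l r) != 0 by rewrite inE => /andP[].
pose m := size ws; pose X : m.-tuple E := in_tuple ws.
have [ri riP] : exists ri : 'I_m -> gT, forall i, ri i \in D /\ ws`_i = l (ri i).
  apply: (fin_all_exists (P := fun (i : 'I_m) r => r \in D /\ ws`_i = l r)) => i.
  by have [r rD e] := wsP ws`_i (mem_nth _ (ltn_ord i)); exists r.
have riR i := DR _ (riP i).1.
have riX i : l (ri i) = ws`_i by have [_ ->] := riP i.
have orth (i j : 'I_m) : j != i -> a (ri i) ws`_j = 0.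
  move=> ji; apply/eqP/negPn/negP; rewrite -riX => aij.
  have [c c0 e] := reflection_root (riR j).1 (riR i).1 (riR j).2 aij.
  have := coord_free i i (X := X) fws; rewrite /= -riX e riX linearZ /= (coord_free (X := X)) // eqxx.
  by rewrite (negPf ji) mulr0 => /eqP; rewrite eq_sym oner_eq0.
have aii i : a (ri i) ws`_i != 0 by rewrite -[in ws`_i]riX; exact: (riR i).2.
exists ws; split=> // [||w g /wsP[r rD ->]].
- apply/eqP; rewrite eqEsubv subvf; apply/subvP => u _.
  (* By [orth] the forms [a (ri i)] are dual to [ws] up to nonzero scalars, so [u'] is the part of
     [u] that they all kill. *)
  pose u' := u - \sum_(i < m) (a (ri i) u / a (ri i) ws`_i) *: ws`_i.
  rewrite -(subrK u' u) memv_add //.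
    rewrite opprB addrC subrK; apply: rpred_sum => i _.
    by apply/memvZ/memv_span/mem_nth.
  have u'0 i : a (ri i) u' = 0.
    rewrite linearB linear_sum (bigD1 i) //= big1 ?addr0 => [|j ji].
      by rewrite linearZ /= -[_ *: _]/(_ * _) divfK ?subrr // -riX (riR i).2.
    by rewrite linearZ /= (orth i j) ?scaler0.
  (* For a diagonal reflection [s] not among the [ri i]: its root lies in the span of [ws], so [s]
     moves some root [ws_j] and shares its line. Commuting with [ri j] then forces [a s u' = 0]. *)
  apply/diag_fixedP => s sD; have [sR as0] := DR _ sD.
  have [j aj] : exists j : 'I_m, a s ws`_j != 0.
    apply/existsP; apply: contraNT as0 => /existsPn h.
    have : l s \in <<ws>>%VS by rewrite ews memv_span // map_f // mem_enum.
    move/(coord_span (X := X)) => /= ->; rewrite linear_sum big1 // => i _.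
    by have := h i; rewrite negbK linearZ /= => /eqP->; rewrite scaler0.
  have aj' : a s (l (ri j)) != 0 by rewrite riX.
  have [c c0 e] := reflection_root (riR j).1 sR (riR j).2 aj'.
  have := reflections_commute u' (riR j).1 sR; rewrite u'0 mul0r scale0r => /esym/eqP.
  rewrite scaler_eq0 (negPf (l0 (riR j).1)) orbF mulf_eq0 e linearZ /= => /orP[/eqP //|].
  by rewrite -[_ *: _]/(_ * _) mulf_eq0 (negPf c0) (negPf (riR j).2).
- apply/eqP; rewrite -subv0; apply/subvP => u; rewrite memv_cap => /andP[uW uE].
  rewrite memv0 (coord_span (X := X) uW) big1 // => i _.
  have : a (ri i) u = 0 by apply: (diag_fixedP _ uE); have [] := riP i.
  rewrite {1}(coord_span (X := X) uW) linear_sum (bigD1 i) //= big1 ?addr0 => [|j ji].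
    rewrite linearZ /= -[_ *: _]/(_ * _) => /eqP; rewrite mulf_eq0 (negPf (aii i)) orbF.
    by move/eqP->; rewrite scale0r.
  by rewrite linearZ /= (orth i j) ?scaler0.
move=> gG; have [rR ar] := DR _ rD.
move: gG; rewrite -G_gen; move: g; apply: gen_ind => [|s g sR gG [c IH]].
  by exists 1; rewrite actV1 scale1r.
rewrite G_gen in gG; rewrite (actVM _ (ReflG sR) gG) IH linearZ /= aE //.
have [->|as0] := eqVneq (a s (l r)) 0; first by exists c; rewrite scale0r addr0.
have [d d0 ->] := reflection_root rR sR ar as0.
by exists (c * (1 + a s (l r) * d)); rewrite -scalerA scalerDl scale1r -scalerA.
Qed.

End Commuting.

(** The order is: roots of diagonal reflections, a complement of [all_fixed] in [diag_fixed], a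
    basis of [all_fixed]. That [z] is a coordinate system is recorded in the two forms used later:
    arbitrary values are reached by a substitution, and the variables are combinations of [z]. *)
Lemma adapted_basis : exists (z : 'I_n -> S) (isw isy : pred 'I_n),
  [/\ forall i, z i \is 1.-homog,
      forall v : 'I_n -> S, exists t : n.-tuple S, forall i, z i \mPo t = v i,
      forall j, exists c : 'I_n -> k, 'X_j = \sum_i c i *: z i &
  [/\ forall i g, isw i -> g \in G -> exists c, act g (z i) = c *: z i,
      forall i, isy i -> ~~ isw i,
      forall i g, isy i -> g \in G -> act g (z i) = z i
    & forall i g, ~~ isw i -> g \in G ->
        exists c : 'I_n -> k, act g (z i) - z i = \sum_(j | isy j) c j *: z j]].
Proof.
have [a [l alP]] := reflection_rank1.
have l0 r rR := (alP r rR).1; have aE r u rR := (alP r rR).2 u.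
have [ws [fws wsE wsI wsP]] := diagonal_basis l0 aE.
pose E' := diag_fixed a l; pose Y := all_fixed.
have YE : (Y <= E')%VS.
  apply/subvP => u /all_fixedP uY; apply/diag_fixedP => r; rewrite inE => /andP[rR _].
  have := aE r u rR; rewrite (uY _ (ReflG rR)) => /esym/eqP.
  by rewrite -subr_eq0 addrC addKr scaler_eq0 (negPf (l0 r rR)) orbF => /eqP.
pose ys := vbasis Y; pose xs := vbasis (E' :\: Y).
have xyE : basis_of E' (xs ++ ys).
  have {1}<- : ((E' :\: Y) + Y = E')%VS by rewrite -{2}(capv_idPr YE) addv_diff_cap.
  by apply: cat_basis; [apply/directv_addP; rewrite capv_diff | exact: vbasisP | exact: vbasisP].
have zsP : basis_of fullv (ws ++ (xs ++ ys)).
  rewrite -wsE; apply: cat_basis => //; first by apply/directv_addP.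
  by rewrite basisEfree fws subvv dim_span.
have zsz : size (ws ++ (xs ++ ys)) == n.
  have := @vector.size_basis _ _ _ _ (in_tuple (ws ++ (xs ++ ys))) zsP.
  by rewrite dimvf dim_matrix mul1r => <-.
pose zs : n.-tuple E := Tuple zsz.
have zsP' : basis_of fullv zs by [].
have zfree : free zs := basis_free zsP'.
have zcoord u : u = \sum_i coord zs i u *: zs`_i := @coord_basis _ _ _ _ zs u zsP' (memvf u).
pose isw (i : 'I_n) := (i < size ws)%N.
pose isy (i : 'I_n) := (size ws + size xs <= i)%N.
have wmem (i : 'I_n) : isw i -> zs`_i \in ws by rewrite /isw => iw; rewrite /= nth_cat iw mem_nth.
have ymem (i : 'I_n) : isy i -> zs`_i \in Y.
  rewrite /isy => iy; have wi : (size ws <= i)%N := leq_trans (leq_addr _ _) iy.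
  rewrite /= nth_cat ltnNge wi /= nth_cat ltnNge leq_subRL // iy /=.
  apply/(basis_mem (vbasisP Y))/mem_nth; rewrite !ltn_subLR ?leq_subRL //.
  by have /eqP := zsz; rewrite !size_cat => zn; apply: leq_trans (ltn_ord i) (eq_leq (esym zn)).
have yspan u : u \in Y -> exists c : 'I_n -> k, u = \sum_(j | isy j) c j *: zs`_j.
  move=> /(coord_basis (vbasisP Y)) ->.
  elim/big_ind: _ => [|_ _ [c ->] [d ->]|m _].
  - by exists (fun=> 0); rewrite big1 // => j _; rewrite scale0r.
  - by exists (fun j => c j + d j); rewrite -big_split; apply: eq_bigr => j _; rewrite scalerDl.
  have mn : (size ws + size xs + m < n)%N.
    have /eqP := zsz; rewrite !size_cat addnA => zn; apply: leq_trans (eq_leq zn).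
    by rewrite ltn_add2l size_tuple.
  exists (fun j => if j == Ordinal mn then coord (vbasis Y) m u else 0).
  rewrite (bigD1 (Ordinal mn)) /=; last exact: leq_addr.
  rewrite eqxx big1 ?addr0 => [|j /andP[_ /negPf->]]; last by rewrite scale0r.
  rewrite nth_cat -addnA ltnNge leq_addr /= addKn nth_cat ltnNge leq_addr /= addKn.
  by [].
have xymem (i : 'I_n) : ~~ isw i -> zs`_i \in E'.
  rewrite /isw -leqNgt => wi; rewrite /= nth_cat ltnNge wi /=.
  apply/(basis_mem xyE)/mem_nth; rewrite ltn_subLR //.
  by have /eqP := zsz; rewrite size_cat => zn; apply: leq_trans (ltn_ord i) (eq_leq (esym zn)).
exists (fun i => lform zs`_i), isw, isy; split.
- by move=> i; exact: lform_homog.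
- move=> v; exists [tuple \sum_i coord zs i (delta_mx 0 j) *: v i | j < n] => i.
  rewrite /lform linear_sum /=.
  under eq_bigr do rewrite comp_mpolyZ comp_mpolyXU -tnth_nth tnth_mktuple scaler_sumr.
  have colE m : \sum_j zs`_i 0 j * coord zs m (delta_mx 0 j) = (i == m)%:R.
    rewrite -(coord_free i m zfree) [in RHS](row_sum_delta zs`_i) linear_sum.
    by apply: eq_bigr => j _; rewrite linearZ.
  rewrite exchange_big (bigD1 i) //= [X in _ + X]big1 ?addr0 => [|m mi];
    under eq_bigr do rewrite scalerA; rewrite -scaler_suml colE.
    by rewrite eqxx scale1r.
  by rewrite eq_sym (negPf mi) scale0r.
- move=> j; exists (fun i => coord zs i (delta_mx 0 j)).
  have -> : 'X_j = lform (delta_mx 0 j).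
    rewrite /lform (bigD1 j) //= mxE !eqxx scale1r big1 ?addr0 // => i ij.
    by rewrite mxE eqxx (negPf ij) scale0r.
  rewrite {1}(zcoord (delta_mx 0 j)) linear_sum; apply: eq_bigr => i _.
  by rewrite linearZ.
split.
- move=> i g /wmem iw gG; have [c e] := wsP _ _ iw gG.
  by exists c; rewrite -lform_actV e linearZ.
- by move=> i; rewrite /isy /isw -leqNgt; apply: leq_trans; exact: leq_addr.
- by move=> i g /ymem/all_fixedP h gG; rewrite -lform_actV h.
move=> i g /xymem zE gG.
have [c e] := yspan _ (diag_fixed_move l0 aE zE gG).
exists c; rewrite -lform_actV -linearB e linear_sum; apply: eq_bigr => j _.
by rewrite linearZ.
Qed.

End AdaptedBasis.

Section AdaptedCoordinates.
Local Open Scope ring_scope.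
Variables (k : fieldType) (n : nat).
Local Notation S := {mpoly k[n]}.
Variable z : 'I_n -> S.
Hypothesis z1 : forall i, z i \is 1.-homog.
Hypothesis zmap : forall v : 'I_n -> S, exists t : n.-tuple S, forall i, z i \mPo t = v i.
Hypothesis zspan : forall j, exists c : 'I_n -> k, 'X_j = \sum_i c i *: z i.

Lemma coord_ind (P : S -> Prop) :
  (forall c, P c%:MP) -> (forall i, P (z i)) ->
  (forall p q, P p -> P q -> P (p + q)) -> (forall p q, P p -> P q -> P (p * q)) ->
  forall p, P p.
Proof.
move=> PC PZ PD PM; apply: mpoly_alg_ind => // j; have [c ->] := zspan j.
elim/big_ind: _ => [|p q|i _]; [by rewrite -mpolyC0 | exact: PD |].
by rewrite -mul_mpolyC; exact: PM.
Qed.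

Lemma lrmorph_coord_ext (phi psi : {lrmorphism S -> S}) :
  (forall i, phi (z i) = psi (z i)) -> phi =1 psi.
Proof.
move=> h; elim/coord_ind => [c|//|p q hp hq|p q hp hq].
- by rewrite !lrmorph_mpolyC.
- by rewrite !rmorphD /= hp hq.
- by rewrite !rmorphM /= hp hq.
Qed.

Lemma coord_free_sum (P : pred 'I_n) (c : 'I_n -> k) : \sum_(i | P i) c i *: z i = 0 ->
  forall i, P i -> c i = 0.
Proof.
move=> h i Pi; have [t tP] := zmap (fun j => (i == j)%:R).
have := congr1 (fun s => s \mPo t) h; rewrite linear_sum (bigD1 i) //= big1 ?addr0.
  rewrite comp_mpolyZ tP eqxx comp_mpoly0 -mul_mpolyC mulr1 => /eqP.
  by rewrite mpolyC_eq0 => /eqP.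
by move=> j /andP[_ ji]; rewrite comp_mpolyZ tP eq_sym (negPf ji) scaler0.
Qed.

Lemma linear_coords s : s \is 1.-homog -> exists c : 'I_n -> k, s = \sum_i c i *: z i.
Proof.
move=> /dhomog1E ->; elim/big_ind: _ => [|_ _ [c ->] [d ->]|j _].
- by exists (fun=> 0); rewrite big1 // => i _; rewrite scale0r.
- by exists (fun i => c i + d i); rewrite -big_split; apply: eq_bigr => i _; rewrite scalerDl.
have [c ->] := zspan j; exists (fun i => s@_U_(j) * c i).
by rewrite scaler_sumr; apply: eq_bigr => i _; rewrite scalerA.
Qed.

Lemma exists_retract (P : pred 'I_n) : exists eps : {lrmorphism S -> S},
  forall i, eps (z i) = if P i then z i else 0.
Proof. by have [t tP] := zmap (fun i => if P i then z i else 0); exists (comp_mpoly t). Qed.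

Section Retract.
Variables (P : pred 'I_n) (eps : {lrmorphism S -> S}).
Hypothesis epsP : forall i, eps (z i) = if P i then z i else 0.

Lemma retract_idem s : eps (eps s) = eps s.
Proof.
apply: (lrmorph_coord_ext (phi := eps \o eps)) => i /=.
by rewrite epsP; case: ifP => Pi; rewrite ?rmorph0 // epsP Pi.
Qed.

Lemma retract_graded : graded eps.
Proof.
move=> j; have [c ->] := zspan j; rewrite linear_sum rpred_sum // => i _.
by rewrite linearZ rpredZ //= epsP; case: ifP => _; rewrite ?rpred0 ?z1.
Qed.

Lemma retract_linear s : s \is 1.-homog ->
  exists c : 'I_n -> k, eps s = \sum_(i | P i) c i *: z i.
Proof.
move=> /linear_coords[c ->]; exists c; rewrite linear_sum [RHS]big_mkcond /=.
by apply: eq_bigr => i _; rewrite linearZ /= epsP; case: ifP => // _; rewrite scaler0.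
Qed.

Lemma retract_span (c : 'I_n -> k) :
  eps (\sum_(i | P i) c i *: z i) = \sum_(i | P i) c i *: z i.
Proof. by rewrite linear_sum; apply: eq_bigr => i Pi; rewrite linearZ /= epsP Pi. Qed.

End Retract.

End AdaptedCoordinates.

Lemma prime_prod_dvd (R : idomainType) (ls : seq R) (u v : R) :
  (forall l, l \in ls -> l != 0%R) ->
  (forall l s r, l \in ls -> (exists w, s * r = l * w)%R ->
     (exists w, s = l * w)%R \/ (exists w, r = l * w)%R) ->
  (forall l, l \in ls -> ~ exists w, u = (l * w)%R) ->
  (exists w, u * v = \prod_(l <- ls) l * w)%R -> (exists w, v = \prod_(l <- ls) l * w)%R.
Proof.
elim: ls v => [|l ls IH] v ls0 lsP lsu.
  by move=> _; exists v; rewrite big_nil mul1r.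
rewrite big_cons => -[w e].
have lm : l \in l :: ls by rewrite mem_head.
have [|//|[v' ev]] := lsP l u v lm.
- by exists (\prod_(j <- ls) j * w)%R; rewrite e mulrA.
- by move=> h; case: (lsu l lm).
have [||||w' ev'] := IH v'; last by exists w'; rewrite ev ev' mulrA.
- by move=> r rl; apply: ls0; rewrite inE rl orbT.
- by move=> r s t rl; apply: lsP; rewrite inE rl orbT.
- by move=> r rl; apply: lsu; rewrite inE rl orbT.
by exists w; apply: (mulfI (ls0 l lm)); rewrite mulrCA -ev e mulrA.
Qed.

(** * Transvections and the transfer *)

Section Transvections.
Local Open Scope ring_scope.
Variables (k : fieldType) (n : nat) (gT : finGroupType) (G : {group gT}).
Local Notation S := {mpoly k[n]}.
Variable act : gT -> {lrmorphism S -> S}.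
Hypothesis actG : graded_action G act.
Local Notation fixed := (fixed act).
Variable Refl : {set gT}.
Hypothesis G_gen : <<Refl>>%g = G.
Hypothesis ReflP : forall r, r \in Refl ->
  exists2 l, l \is 1.-homog /\ l != 0 & forall i, exists c, act r 'X_i - 'X_i = c *: l.
Variables (z : 'I_n -> S) (isw isy : pred 'I_n).
Hypothesis z1 : forall i, z i \is 1.-homog.
Hypothesis zmap : forall v : 'I_n -> S, exists t : n.-tuple S, forall i, z i \mPo t = v i.
Hypothesis zspan : forall j, exists c : 'I_n -> k, 'X_j = \sum_i c i *: z i.
Hypothesis act_w : forall i g, isw i -> g \in G -> exists c, act g (z i) = c *: z i.
Hypothesis isyNw : forall i, isy i -> ~~ isw i.
Hypothesis act_y : forall i g, isy i -> g \in G -> act g (z i) = z i.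
Hypothesis act_x : forall i g, ~~ isw i -> g \in G ->
  exists c : 'I_n -> k, act g (z i) - z i = \sum_(j | isy j) c j *: z j.

Let ReflG r : r \in Refl -> r \in G.
Proof. by move=> rR; rewrite -G_gen mem_gen. Qed.

Definition yspan (s : S) := exists c : 'I_n -> k, s = \sum_(j | isy j) c j *: z j.

Lemma yspanB s t : yspan s -> yspan t -> yspan (s - t).
Proof.
move=> [c ->] [d ->]; exists (fun j => c j - d j); rewrite -sumrB.
by apply: eq_bigr => j _; rewrite scalerBl.
Qed.

Lemma yspan_fixed s : yspan s -> s \in fixed G.
Proof.
move=> [c ->]; rewrite rpred_sum // => j jy; rewrite fixed_scale //.
by apply/fixedP => g gG; rewrite act_y.
Qed.

Lemma yspan_homog s : yspan s -> s \is 1.-homog.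
Proof. by move=> [c ->]; rewrite rpred_sum // => j _; rewrite rpredZ ?z1. Qed.

Lemma reflection_linear r : r \in Refl -> exists2 l, l != 0 &
  forall s, s \is 1.-homog -> exists c, act r s - s = c *: l.
Proof.
move=> rR; have [l [_ l0] lP] := ReflP rR; exists l => // s /dhomog1E ->.
elim/big_ind: _ => [|u v [c hc] [d hd]|j _].
- by exists 0; rewrite rmorph0 subr0 scale0r.
- by exists (c + d); rewrite rmorphD opprD addrACA hc hd scalerDl.
have [c hc] := lP j; exists (s@_U_(j) * c).
by rewrite linearZ -scalerBr hc scalerA.
Qed.

(** The root of [r] is then a multiple of [z i]. Another coordinate [z j] moves within its own line
    or by an element of the span of the y, and neither contains a nonzero multiple of [z i]. *)
Lemma reflection_moves_one r i j : r \in Refl -> isw i -> act r (z i) != z i -> j != i ->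
  act r (z j) = z j.
Proof.
move=> rR iw ri ji; have [l l0 lP] := reflection_linear rR.
have [c ci] := lP _ (z1 i); have [d dj] := lP _ (z1 j).
have [e ei] := act_w iw (ReflG rR).
have c0 : c != 0 by apply: contraNneq ri => c0; rewrite -subr_eq0 ci c0 scale0r.
have lE : l = (c^-1 * (e - 1)) *: z i.
  by rewrite -scalerA scalerBl scale1r -ei ci scalerA mulVf // scale1r.
suff d0 : d = 0 by apply/eqP; rewrite -subr_eq0 dj d0 scale0r.
have e1 : c^-1 * (e - 1) != 0 by apply: contraNneq l0 => e0; rewrite lE e0 scale0r.
apply/eqP/negPn/negP => d0.
have de : d * (c^-1 * (e - 1)) != 0 by rewrite mulf_neq0.
case: (boolP (isw j)) => jw.
  have ij : i != j by rewrite eq_sym.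
  have [f fj] := act_w jw (ReflG rR).
  have h : \sum_m (if m == j then f - 1 else if m == i then - (d * (c^-1 * (e - 1))) else 0) *: z m = 0.
    rewrite (bigD1 j) //= eqxx (bigD1 i) ?ij //= (negPf ij) eqxx.
    rewrite big1 ?addr0 => [|m /andP[/negPf-> /negPf->]]; last by rewrite scale0r.
    by rewrite scalerBl scale1r -fj dj lE scaleNr scalerA subrr.
  have /eqP := coord_free_sum zmap h (i := i) isT.
  by rewrite (negPf ij) eqxx oppr_eq0 (negPf de).
have [f fj] := act_x jw (ReflG rR).
have h : \sum_m ((if isy m then f m else 0) - (if m == i then d * (c^-1 * (e - 1)) else 0)) *: z m = 0.
  under eq_bigr do rewrite scalerBl; rewrite sumrB.
  have -> : \sum_m (if m == i then d * (c^-1 * (e - 1)) else 0) *: z m = d * (c^-1 * (e - 1)) *: z i.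
    by rewrite (bigD1 i) //= eqxx big1 ?addr0 // => m /negPf->; rewrite scale0r.
  rewrite -scalerA -lE -dj fj [X in _ - X]big_mkcond -sumrB big1 // => m _.
  by case: ifP; rewrite ?scale0r subrr.
have := coord_free_sum zmap h (i := i) isT; rewrite /= eqxx.
have -> : isy i = false by apply: contraTF iw => /isyNw.
by rewrite sub0r => /eqP; rewrite oppr_eq0 (negPf de).
Qed.

Definition transvection_set := [set g in G | [forall i, isw i ==> (act g (z i) == z i)]].

Fact transvection_group_set : group_set transvection_set.
Proof.
apply/group_setP; split=> [|g h].
  by rewrite inE group1; apply/forallP => i; rewrite (graded_act1 actG) eqxx implybT.
rewrite !inE => /andP[gG /forallP hg] /andP[hG /forallP hh]; rewrite groupM //.
apply/forallP => i; apply/implyP => iw; rewrite (graded_actM actG) //.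
by have /eqP -> := implyP (hh i) iw; exact: implyP (hg i) iw.
Qed.
Canonical transvection_group := Group transvection_group_set.
Local Notation T := transvection_group.

Lemma transvectionP g : reflect (g \in G /\ forall i, isw i -> act g (z i) = z i) (g \in T).
Proof.
rewrite inE; apply: (iffP andP) => -[gG h]; split=> //.
  by move=> i iw; apply/eqP/(implyP (forallP h i)).
by apply/forallP => i; apply/implyP => /h ->.
Qed.

Lemma transvection_sub : T \subset G.
Proof. by apply/subsetP => g /transvectionP[]. Qed.

Let TG g : g \in T -> g \in G. Proof. exact: subsetP transvection_sub g. Qed.

Lemma reflection_cases r : r \in Refl -> r \in T \/ forall i, ~~ isw i -> act r (z i) = z i.
Proof.
move=> rR; case: (boolP (r \in T)) => [|rT]; [by left | right=> j jw].
have [i iw ri] : exists2 i, isw i & act r (z i) != z i.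
  apply: NNPP => ne; case/negP: rT; apply/transvectionP; split=> [|i iw]; first exact: ReflG.
  by apply/eqP/negPn/negP => h; apply: ne; exists i.
by apply: (reflection_moves_one rR iw ri); apply: contraNneq jw => ->.
Qed.

Variable eps : {lrmorphism S -> S}.
Hypothesis epsP : forall i, eps (z i) = if ~~ isw i then z i else 0.

Lemma eps_idem s : eps (eps s) = eps s.
Proof. exact: (retract_idem zspan epsP). Qed.

Lemma eps_yspan s : yspan s -> eps s = s.
Proof.
move=> [c ->]; rewrite linear_sum; apply: eq_bigr => j jy.
by rewrite linearZ /= epsP isyNw.
Qed.

Lemma eps_act g s : g \in G -> eps (act g s) = act g (eps s).
Proof.
move=> gG; apply: (lrmorph_coord_ext zspan (phi := eps \o act g) (psi := act g \o eps)) => i /=.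
rewrite epsP; case: ifP => iw; last first.
  have [c ->] := act_w (negbFE iw) gG.
  by rewrite linearZ /= epsP iw scaler0 rmorph0.
have [c e] := act_x iw gG.
have -> : act g (z i) = z i + \sum_(j | isy j) c j *: z j by rewrite -e addrC subrK.
by rewrite rmorphD /= epsP iw eps_yspan //; exists c.
Qed.

(** A reflection outside [T] fixes every coordinate that [eps] keeps, so on the image of [eps] the
    group [T] decides about all of [G]. *)
Lemma eps_fixed s : eps s = s -> s \in fixed T -> s \in fixed G.
Proof.
move=> es /fixedP sT; apply/fixedP => g; rewrite -G_gen; move: g.
apply: gen_ind => [|r g rR gG IH]; first exact: (graded_act1 actG).
rewrite G_gen in gG; rewrite (graded_actM actG _ (ReflG rR) gG) IH.
have [/sT //|rw] := reflection_cases rR.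
rewrite -{1}es -[RHS]es.
apply: (lrmorph_coord_ext zspan (phi := act r \o eps) (psi := eps)) => i /=.
by rewrite epsP; case: ifP => iw; rewrite ?rmorph0 ?rw.
Qed.

Lemma eps_linear_act g s : g \in G -> s \is 1.-homog -> yspan (act g (eps s) - eps s).
Proof.
move=> gG s1; have [c ->] := retract_linear zspan epsP s1.
rewrite linear_sum -sumrB; elim/big_ind: _ => [|u v [a ->] [b ->]|i iw].
- by exists (fun=> 0); rewrite big1 // => j _; rewrite scale0r.
- by exists (fun j => a j + b j); rewrite -big_split; apply: eq_bigr => j _; rewrite scalerDl.
have [d e] := act_x iw gG; exists (fun j => c i * d j).
rewrite linearZ /= -scalerBr e scaler_sumr; apply: eq_bigr => j _; by rewrite scalerA.
Qed.

Lemma eps_faithful g h : g \in T -> h \in T ->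
  (forall i, eps (act g 'X_i) = eps (act h 'X_i)) -> g = h.
Proof.
move=> gT' hT' e; apply: (graded_act_faithful actG); rewrite ?TG // => j.
apply: (lrmorph_coord_ext zspan (phi := act g) (psi := act h)) => i.
have [iw|iw] := boolP (isw i).
  by have /transvectionP[_ hg] := gT'; have /transvectionP[_ hh] := hT'; rewrite hg ?hh.
have ee := lrmorph_ext (phi := eps \o act g) (psi := eps \o act h) e (z i).
by move: ee; rewrite /= !eps_act ?TG // epsP iw.
Qed.

Lemma eps_prod_yspan ls : (forall l, l \in ls -> l != 0 /\ yspan l) ->
  eps (\prod_(l <- ls) l) = \prod_(l <- ls) l.
Proof.
move=> lsP; rewrite rmorph_prod /= !big_seq; apply: eq_bigr => l /lsP[_ ly].
exact: eps_yspan.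
Qed.

Lemma prod_yspan_fixed ls : (forall l, l \in ls -> l != 0 /\ yspan l) ->
  \prod_(l <- ls) l \in fixed G.
Proof.
by move=> lsP; rewrite big_seq rpred_prod // => l /lsP[_]; exact: yspan_fixed.
Qed.

Section Transfer.
Variable pi : S -> S.
Hypothesis pi_fixed : forall s, pi s \in fixed G.
Hypothesis pi_lin : forall c s t, c \in fixed G -> pi (c * s + t) = c * pi s + pi t.
(** The inner and outer [eps] gain semilinearity over [fixed T]: for [c] fixed by [T], [eps c] is
    fixed by [G], so the [G]-linearity of [pi] applies to it. *)
Let theta s := eps (pi (eps s)).

Let pi0 : pi 0 = 0.
Proof.
have := pi_lin 0 0 (rpred1 _); rewrite !mul1r addr0 => /esym/eqP.
by rewrite -subr_eq0 addrK => /eqP.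
Qed.

Let thetaD : {morph theta : s t / s + t}.
Proof.
move=> s t; rewrite /theta rmorphD /=.
by have := pi_lin (eps s) (eps t) (rpred1 _); rewrite !mul1r => ->; rewrite rmorphD.
Qed.

Let thetaM c s : c \in fixed T -> theta (c * s) = eps c * theta s.
Proof.
move=> /fixedP cT; rewrite /theta rmorphM /=.
have ecG : eps c \in fixed G.
  apply: eps_fixed; first exact: eps_idem.
  by apply/fixedP => g gT'; rewrite -eps_act ?TG // cT.
have := pi_lin (eps s) 0 ecG; rewrite !addr0 pi0 addr0 => ->.
by rewrite rmorphM /= eps_idem.
Qed.

Let eps_theta s : eps (theta s) = theta s. Proof. exact: eps_idem. Qed.

Let theta_fixed s g : g \in G -> act g (theta s) = theta s.
Proof. by move=> gG; rewrite -eps_act //; have /fixedP -> := pi_fixed (eps s). Qed.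

Definition expansion (ls : seq S) (D : gT -> S) :=
  [/\ forall l, l \in ls -> l != 0 /\ yspan l, forall g, g \in T -> eps (D g) = D g
    & forall s, \prod_(l <- ls) l * theta s = \sum_(g in T) D g * eps (act g s)].

Lemma exists_expansion : exists ls D, expansion ls D.
Proof.
have [_ [ls lsQ ->] [D DP]] := semilinear_expansion_linear_forms actG transvection_sub
  thetaD thetaM (retract_graded z1 zspan epsP) eps_faithful.
have lsP l : l \in ls -> l != 0 /\ yspan l.
  move=> /lsQ[l0 [g [h [i [gT' hT' e]]]]]; split=> //; rewrite e.
  (* The factor is a difference of two displacements of one form, and displacements lie in the span
     of the y. *)
  have -> : eps (act g 'X_i) - eps (act h 'X_i) =
      (act g (eps 'X_i) - eps 'X_i) - (act h (eps 'X_i) - eps 'X_i).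
    by rewrite !eps_act ?TG // opprB addrA subrK.
  by apply: yspanB; apply: eps_linear_act; rewrite ?TG ?dhomog_var.
exists ls, (fun g => eps (D g)); split=> // [g _|s]; first exact: eps_idem.
rewrite -(eps_prod_yspan lsP) -eps_theta -rmorphM DP rmorph_sum.
by apply: eq_bigr => g _; rewrite rmorphM /= eps_idem.
Qed.

Lemma minimal_expansion : exists ls D, expansion ls D /\
  forall l, l \in ls -> ~ forall g, g \in T -> exists r, D g = l * r.
Proof.
have [ls [D]] := exists_expansion; have [m] := ubnP (size ls).
elim: m ls D => // m IH ls D sm [lsP De DP].
case: (classic (exists2 l, l \in ls & forall g, g \in T -> exists r, D g = l * r)); last first.
  by move=> ne; exists ls, D; split=> // l lls h; apply: ne; exists l.
move=> [l lls h]; have [l0 ly] := lsP l lls.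
have [D' D'P] : exists D' : gT -> S, forall g, g \in T -> D g = l * D' g.
  apply: (fin_all_exists (P := fun g r => g \in T -> D g = l * r)) => g.
  case: (boolP (g \in T)) => [/h[r e]|_]; [by exists r | by exists 0].
apply: (IH (rem l ls) (fun g => eps (D' g))).
  by rewrite size_rem // -ltnS prednK //; case: (ls) lls.
split=> [j /mem_rem/lsP //|g _|s]; first exact: eps_idem.
apply: (mulfI l0); rewrite mulrA.
have <- : \prod_(j <- ls) j = l * \prod_(j <- rem l ls) j.
  by rewrite (perm_big _ (perm_to_rem lls)) big_cons.
rewrite DP mulr_sumr; apply: eq_bigr => g gT'.
by rewrite -De // D'P // rmorphM /= (eps_yspan ly) mulrA.
Qed.

(** Uniqueness makes the coefficients conjugate, [D g = act g a], so that [L * theta s] is the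
    transfer of [a * s] when [eps s = s]. Taking [s = 1] exhibits [L] as a transfer; minimality
    keeps [L] prime to the norm of [a], which gives the divisibility. *)
Lemma transfer_divisor kappa : kappa != 0 -> pi 1 = kappa%:MP ->
  exists ls : seq S, [/\ forall l, l \in ls -> l != 0 /\ yspan l,
    forall s, exists r, \sum_(g in T) act g s = \prod_(l <- ls) l * r
    & exists a, \sum_(g in T) act g a = \prod_(l <- ls) l].
Proof.
move=> kappa0 pi1; have [ls [D [[lsP De DP] Dmin]]] := minimal_expansion.
set L := \prod_(l <- ls) l in DP *.
have LG : L \in fixed G := prod_yspan_fixed lsP.
have geps := retract_graded z1 zspan epsP.
have gr g : graded (eps \o act g).
  by move=> i /=; apply: graded_homog => //; exact: graded_act_graded actG g _.
pose zz := separator k n.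
have zzP g h : g \in T -> h \in T -> eps (act g zz) = eps (act h zz) -> g = h.
  move=> gT' hT' e; apply: eps_faithful => //.
  exact: (separatorP (phi := eps \o act g) (psi := eps \o act h)).
(* [L] and the values of [theta] are fixed, so applying [u] to the expansion gives a second one;
   independence over the domain [S] identifies their coefficients. *)
have Dact u g : u \in T -> g \in T -> D (u * g)%g = act u (D g).
  move=> uT gT'; have ugT : (u * g)%g \in T by rewrite groupM.
  apply/eqP; rewrite -subr_eq0; apply/eqP.
  pose C h := D h - act u (D (u^-1 * h)%g).
  have : C (u * g)%g * \prod_(h in T | h != (u * g)%g)
      (eps (act (u * g)%g zz) - eps (act h zz)) = 0.
    apply: (@morphism_independence S S gT T (fun g => eps \o act g) (fun=> True)
      (fun s => s = 0) _ _ C (fun=> zz)) => // [_ _ -> ->|r _ ->|b _]; rewrite ?subr0 ?mulr0 //.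
    rewrite /C; under eq_bigr do rewrite mulrBl; rewrite sumrB -DP.
    apply/eqP; rewrite subr_eq0; apply/eqP.
    have /fixedP LT := LG.
    rewrite -[in LHS](theta_fixed b (TG uT)) -{1}(LT u (TG uT)) -rmorphM /= DP rmorph_sum /=.
    rewrite [RHS](reindex_inj (mulgI u)); apply: eq_big => h; first by rewrite /= groupMl.
    move=> hT'; rewrite rmorphM /= mulKg (graded_actM actG) ?TG //.
    by rewrite [in RHS]eps_act ?TG // eps_act ?TG.
  rewrite /C mulKg => /eqP; rewrite mulf_eq0 => /orP[/eqP //|/prodf_eq0[h /andP[hT' hu]]].
  by rewrite subr_eq0 => /eqP /zzP e; case/eqP: hu; rewrite e.
pose a := D 1%g.
have Da g : g \in T -> D g = act g a by move=> gT'; rewrite -Dact // mulg1.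
have ea : eps a = a by apply: De; exact: group1.
(* A prime [l] dividing the norm divides one conjugate of [a], hence all of them as [l] is fixed:
   every [D g] would be divisible by [l], against minimality. *)
have TrG : forall l, l \in ls -> ~ exists r, \prod_(g in T) act g a = l * r.
  move=> l lls; have [l0 ly] := lsP l lls => h.
  have /fixedP lG := yspan_fixed ly.
  have prime_l := linear_form_prime (yspan_homog ly) l0.
  have [g gT' [r e]] : exists2 g, g \in T & exists r, act g a = l * r.
    apply: NNPP => ne; suff : exists r, 1 = l * r :> S.
      move=> [r /(congr1 (mcoeff 0%MM))]; rewrite mcoeff1 eqxx.
      have : pihomog mdeg 0 (l * r) = 0 by apply: pihomogM_small (yspan_homog ly) _.
      rewrite pihomog0E => /eqP; rewrite mpolyC_eq0 => /eqP -> /eqP.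
      by rewrite oner_eq0.
    move: h; elim/big_ind: _ => [//|p q hp hq /prime_l[]//|g gT' h].
    by case: ne; exists g.
  apply: (Dmin l lls) => h' hT'; exists (act (h' * g^-1)%g r).
  rewrite Da // -{1}(lG (h' * g^-1)%g) ?groupM ?groupV ?TG // -rmorphM /= -e.
  by rewrite -(graded_actM actG) ?groupM ?groupV ?TG // mulgKV.
exists ls; split=> //.
  have base s : eps s = s -> exists r, \sum_(g in T) act g s = L * r.
    move=> es; apply: (prime_prod_dvd _ _ TrG) => [l /lsP[]//|l u v /lsP[l0 ly]|].
      exact: linear_form_prime (yspan_homog ly) l0.
    (* The norm [a * ac] is invariant, so the norm times the transfer of [s] is the transfer of
       [a * (s * ac)], that is [L * theta (s * ac)]; the norm is then cancelled against [L]. *)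
    pose ac := \prod_(g in T | g != 1%g) act g a.
    have aac : \prod_(g in T) act g a = a * ac by rewrite (bigD1 1%g) //= (graded_act1 actG).
    exists (theta (s * ac)); rewrite DP aac mulr_sumr; apply: eq_bigr => g gT'.
    have eac : eps ac = ac.
      rewrite rmorph_prod; apply: eq_bigr => h /andP[hT' _].
      by rewrite /= eps_act ?TG // ea.
    rewrite Da // eps_act ?TG // (rmorphM eps) /= es eac.
    have aG : act g (a * ac) = a * ac.
      by rewrite -aac; have /fixedP -> := prod_act actG a transvection_sub.
    by rewrite -{1}aG -!rmorphM /= -mulrA [ac * s]mulrC.
  (* The w coordinates are fixed by [T] and leave the transfer; the others are absorbed in [v]. The
     extra factor [u] lets the induction treat a product one factor at a time. *)
  suff all s : forall u, (forall v, eps v = v -> exists r, \sum_(g in T) act g (u * v) = L * r) ->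
      forall v, eps v = v -> exists r, \sum_(g in T) act g (s * u * v) = L * r.
    move=> s; have [||r] := all s 1 _ 1; rewrite ?rmorph1 ?mulr1 //; last by exists r.
    by move=> v ev; rewrite mul1r; apply: base.
  elim/(coord_ind zspan): s => [c|i|p q hp hq|p q hp hq] u hu v ev.
  - have [r e] := hu v ev; exists (c%:MP * r); rewrite mulrCA -e mulr_sumr.
    by apply: eq_bigr => g _; rewrite -mulrA rmorphM /= lrmorph_mpolyC.
  - case: (boolP (isw i)) => iw.
      have [r e] := hu v ev; exists (z i * r); rewrite mulrCA -e mulr_sumr.
      apply: eq_bigr => g gT'; rewrite -mulrA rmorphM /=.
      by have /transvectionP[_ ->] := gT'.
    rewrite [z i * u]mulrC -mulrA; apply: hu.
    by rewrite rmorphM /= epsP iw ev.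
  - have [r e] := hp u hu v ev; have [r' e'] := hq u hu v ev; exists (r + r').
    by rewrite mulrDr -e -e' -big_split; apply: eq_bigr => g _; rewrite !mulrDl rmorphD.
  - by rewrite -(mulrA p q u); apply: hp v ev => w; exact: hq.
exists (kappa^-1 *: a).
have := DP 1; rewrite /theta rmorph1 pi1 lrmorph_mpolyC.
have -> : \sum_(g in T) D g * eps (act g 1) = \sum_(g in T) act g a.
  by apply: eq_bigr => g gT'; rewrite !rmorph1 mulr1 Da.
move=> e; have -> : \sum_(g in T) act g (kappa^-1 *: a) = kappa^-1 *: \sum_(g in T) act g a.
  by rewrite scaler_sumr; apply: eq_bigr => g _; rewrite linearZ.
by rewrite -e mulrC mul_mpolyC scalerA mulVf // scale1r.
Qed.

End Transfer.

End Transvections.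

(** * Additive functions on elementary abelian groups *)

Section AdditiveFunctions.
Local Open Scope ring_scope.
Variables (gT : finGroupType) (T : {group gT}) (p : nat) (R : idomainType).
Hypothesis abT : p.-abelem%g T.
Hypothesis ntT : T != 1%g :> {set gT}.
Hypothesis charR : p \in [pchar R].
Local Notation m := ('dim T)%g.
Local Notation e := (rVabelem abT ntT).

Let p_pr : prime p. Proof. by case/andP: charR. Qed.

Lemma card_abelem_dim : #|T| = (p ^ m)%N.
Proof.
have -> : #|T| = #|'rV['F_p]_m|.
  rewrite -(card_imset predT (rVabelem_inj abT ntT)); apply: eq_card => g.
  apply/idP/imsetP => [gT'|[u _ ->]]; last exact: mem_rVabelem.
  by exists (abelem_rV abT ntT g); rewrite ?abelem_rV_K.
by rewrite card_mx mul1n card_Fp.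
Qed.

Definition additive_on (phi : gT -> R) := {in T &, {morph phi : g h / (g * h)%g >-> g + h}}.

Lemma additive_on1 phi : additive_on phi -> phi 1%g = 0.
Proof.
move=> h; have := h 1%g 1%g (group1 T) (group1 T); rewrite mulg1 => /esym/eqP.
by rewrite -subr_eq0 addrK => /eqP.
Qed.

Lemma additive_onX phi g j : additive_on phi -> g \in T -> phi (g ^+ j)%g = (phi g) *+ j.
Proof.
move=> h gT'; elim: j => [|j IH]; first by rewrite expg0 additive_on1.
by rewrite expgS h ?groupX // IH mulrS.
Qed.

Lemma additive_on_coords phi (u : 'rV['F_p]_m) : additive_on phi ->
  phi (e u) = \sum_j (u 0 j : nat)%:R * phi (e (delta_mx 0 j)).
Proof.
move=> h; rewrite {1}(row_sum_delta u).
elim/big_rec2: _ => [|j s v _ <-]; first by rewrite rVabelem0 additive_on1.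
rewrite rVabelemD h ?mem_rVabelem // rVabelemZ additive_onX ?mem_rVabelem //.
by rewrite mulr_natl.
Qed.

Lemma Fp_power_sum c : (c < p.-1)%N -> \sum_(x : 'F_p) ((x : nat)%:R : R) ^+ c = 0.
Proof.
move=> cp; have p0 : p%:R = 0 :> R by case/andP: charR => _ /eqP.
suff : (p %| \sum_(x : 'F_p) (x : nat) ^ c)%N.
  case/dvdnP=> q e1; have := congr1 (fun j => j%:R : R) e1.
  rewrite natr_sum natrM p0 mulr0 => h; rewrite -[RHS]h.
  by apply: eq_bigr => x _; rewrite natrX.
case: (posnP c) => [->|c0].
  by rewrite (eq_bigr (fun=> 1%N)) // sum1_card card_Fp.
have : (\sum_(x : 'F_p) (x : nat) ^ c)%N%:R = 0 :> 'F_p.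
  rewrite natr_sum (eq_bigr (fun x : 'F_p => x ^+ c)); last first.
    by move=> x _; rewrite natrX natr_Zp.
  (* ['X^c - 1] has at most c < p - 1 roots, so some nonzero [l] is not one. Reindexing by [l]
     multiplies the sum by [l ^+ c]. *)
  have [l l0 lc] : exists2 l : 'F_p, l != 0 & l ^+ c != 1.
    apply: NNPP => ne; pose P : {poly 'F_p} := 'X^c - 1.
    have sP : size P = c.+1 by rewrite size_XnsubC.
    have P0 : P != 0 by rewrite -size_poly_gt0 sP.
    have := max_poly_roots P0 (rs := enum [pred x : 'F_p | x != 0]).
    rewrite enum_uniq sP -cardE.
    have -> : #|[pred x : 'F_p | x != 0]| = p.-1.
      by rewrite cardC1 card_Fp.
    rewrite ltnS leqNgt cp => H; suff : false by []; apply: H => //.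
    apply/allP => x; rewrite mem_enum inE => x0.
    rewrite rootE !hornerE subr_eq0; apply/negPn/negP => h.
    by apply: ne; exists x.
  apply/eqP; have : (l ^+ c - 1) * \sum_(x : 'F_p) x ^+ c == 0.
    rewrite mulrBl mul1r subr_eq0; apply/eqP.
    rewrite [RHS](reindex_inj (mulfI l0)) /= mulr_sumr.
    by apply: eq_bigr => x _; rewrite exprMn.
  by rewrite mulf_eq0 subr_eq0 (negPf lc).
move/eqP; rewrite -(dvdn_pcharf (pchar_Fp p_pr)) //.
Qed.

(** The argument of Chevalley and Warning: in coordinates the summand is a polynomial of degree [q]
    below m (p - 1), so each monomial has a coordinate with exponent below p - 1, over which the sum
    is zero. *)
Lemma sum_prod_additive q (phi : 'I_q -> gT -> R) : (forall i, additive_on (phi i)) ->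
  (q < m * p.-1)%N -> \sum_(g in T) \prod_i phi i g = 0.
Proof.
move=> phiP qm; rewrite (reindex_onto e (abelem_rV abT ntT)) /=; last first.
  by move=> g gT'; rewrite abelem_rV_K.
rewrite (eq_bigl predT); last by move=> u; rewrite mem_rVabelem rVabelemK eqxx.
pose x (a : 'F_p) : R := (a : nat)%:R.
pose b i j := phi i (e (delta_mx 0 j)).
transitivity (\sum_(u : 'rV['F_p]_m) \sum_(f : {ffun 'I_q -> 'I_m})
    \prod_i (x (u 0 (f i)) * b i (f i))).
  apply: eq_bigr => u _; rewrite -(bigA_distr_bigA (fun i j => x (u 0 j) * b i j)).
  by apply: eq_bigr => i _; rewrite additive_on_coords.
rewrite exchange_big big1 //= => f _.
under eq_bigr do rewrite big_split /=.
rewrite -mulr_suml [X in X * _](_ : _ = 0) ?mul0r //.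
pose c j := #|[pred i | f i == j]|.
transitivity (\sum_(u : 'rV['F_p]_m) \prod_j x (u 0 j) ^+ c j).
  apply: eq_bigr => u _; rewrite (partition_big f predT) //=; apply: eq_bigr => j _.
  rewrite (eq_bigr (fun=> x (u 0 j))); last by move=> i /eqP->.
  by rewrite prodr_const.
rewrite (reindex (fun v : {ffun 'I_m -> 'F_p} => \row_j v j)) /=; last first.
  exists (fun u : 'rV['F_p]_m => [ffun j => u 0 j]) => [v _|u _].
    by apply/ffunP => j; rewrite ffunE mxE.
  by apply/rowP => j; rewrite mxE ffunE.
under eq_bigr do under eq_bigr do rewrite mxE.
rewrite -(bigA_distr_bigA (fun j a => x a ^+ c j)).
have [j cj] : exists j, (c j < p.-1)%N.
  apply/existsP; apply: contraLR qm => /existsPn h; rewrite -leqNgt.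
  rewrite -{1}(card_ord q) -sum1_card (partition_big f predT) //=.
  rewrite -{1}(card_ord m) -sum_nat_const; apply: leq_sum => j _.
  by have := h j; rewrite -leqNgt /c -sum1_card.
by rewrite (bigD1 j) //= Fp_power_sum // mul0r.
Qed.

Lemma additive_dependent q (phi : 'I_q -> gT -> R) : (forall i, additive_on (phi i)) ->
  (m < q)%N -> exists2 c : 'I_q -> R, exists i, c i != 0 &
    forall g, g \in T -> \sum_i c i * phi i g = 0.
Proof.
move=> phiP mq.
(* The values on a basis are padded with zero columns to a square matrix; its determinant vanishes,
   and a kernel vector exists over the domain [R]. *)
pose M : 'M[R]_q := \matrix_(i, j) oapp (fun j' => phi i (e (delta_mx 0 j'))) 0 (insub (j : nat)).
have [v v0 vM] : exists2 v : 'rV_q, v != 0 & v *m M = 0.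
  apply/det0P; rewrite (expand_det_col M (Ordinal mq)) big1 // => i _.
  by rewrite mxE insubF /= ?ltnn // mul0r.
exists (fun i => v 0 i).
  by apply/existsP; apply: contraNT v0 => /existsPn h; apply/eqP/rowP => i; rewrite mxE; apply/eqP/negPn/h.
move=> g gT'; rewrite -(abelem_rV_K abT ntT gT').
under eq_bigr do rewrite additive_on_coords // mulr_sumr.
rewrite exchange_big big1 //= => j _.
have := congr1 (fun N : 'rV_q => N 0 (widen_ord (ltnW mq) j)) vM; rewrite !mxE => h.
under eq_bigr do rewrite mulrCA; rewrite -mulr_sumr.
rewrite (eq_bigr (fun i => v 0 i * M i (widen_ord (ltnW mq) j))) ?h ?mulr0 // => i _.
rewrite mxE; case: insubP => [j' _ e1|]; last by rewrite /= ltn_ord.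
by congr (_ * phi i (e (delta_mx 0 _))); apply: val_inj; rewrite e1.
Qed.

End AdditiveFunctions.

(** * The minimal list of columns *)

Lemma classic_min (A : Type) (P : A -> Prop) (f : A -> nat) :
  (exists x, P x) -> exists2 x, P x & forall y, P y -> (f x <= f y)%N.
Proof.
move=> [x Px]; have [m] := ubnP (f x); elim: m x Px => // m IH x Px xm.
case: (classic (exists2 y, P y & (f y < f x)%N)) => [[y Py yx]|ne].
  by apply: (IH y Py); apply: leq_trans yx _.
exists x => // y Py; rewrite leqNgt; apply/negP => yx; apply: ne; by exists y.
Qed.

Lemma perm_nseq (A : eqType) (c : A) (K : seq A) q : (q <= count_mem c K)%N ->
  exists K0, perm_eq K (nseq q c ++ K0).
Proof.
move=> h; exists (nseq (count_mem c K - q) c ++ filter (predC (pred1 c)) K).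
rewrite catA -nseqD subnKC // perm_sym.
have <- : filter (pred1 c) K = nseq (count_mem c K) c.
  by rewrite -size_filter; apply/all_pred1P; apply: filter_all.
by rewrite perm_filterC.
Qed.

Section MinimalMonomial.
Local Open Scope ring_scope.
Variables (k : fieldType) (n : nat) (gT : finGroupType) (G : {group gT}).
Local Notation S := {mpoly k[n]}.
Variable act : gT -> {lrmorphism S -> S}.
Hypothesis actG : graded_action G act.
Local Notation fixed := (fixed act).
Variables (T : {group gT}) (p : nat).
Hypothesis sTG : T \subset G.
Hypothesis abT : p.-abelem%g T.
Hypothesis ntT : T != 1%g :> {set gT}.
Hypothesis chark : p \in [pchar k].
Variables (z : 'I_n -> S) (epsy : {lrmorphism S -> S}).
Hypothesis z1 : forall i, z i \is 1.-homog.
Hypothesis zspan : forall j, exists c : 'I_n -> k, 'X_j = \sum_i c i *: z i.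
Hypothesis z_move : forall i t, t \in T -> act t (z i) - z i \in fixed T.
Hypothesis epsy_idem : forall s, epsy (epsy s) = epsy s.
Hypothesis epsy_graded : graded epsy.
Hypothesis epsy_move : forall i t, t \in T -> epsy (act t (z i) - z i) = act t (z i) - z i.
Hypothesis epsy_fixed : forall s, epsy s \in fixed T.
Variables (L : S) (N : nat).
Hypothesis L0 : L != 0.
Hypothesis LN : L \is N.-homog.
Hypothesis epsyL : epsy L = L.
Hypothesis transfer_dvd : forall s, exists r, \sum_(t in T) act t s = L * r.
Hypothesis transfer_hit : exists a, \sum_(t in T) act t a = L.

Local Notation m := ('dim T)%g.
Let p_pr : prime p. Proof. by case/andP: chark. Qed.
Let charS : p \in [pchar S].
Proof. by rewrite (pchar_lalg S). Qed.

Local Notation column := ('I_n * nat)%type.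
(* The column [(i, a)] stands for [z i ^+ (p ^ a)] and its displacement under [T]; *)
(* [pos] lists the columns by increasing weight. *)
Definition pos (c : column) := (c.2 * n + c.1)%N.
Definition wt (c : column) := (p ^ c.2)%N.
Definition next (c : column) : column := (c.1, c.2.+1).
Definition zpow (c : column) : S := z c.1 ^+ wt c.
Definition zdiff (c : column) (t : gT) : S := (act t (z c.1) - z c.1) ^+ wt c.

Lemma pos_inj : injective pos.
Proof.
move=> [i a] [j b]; rewrite /pos /= => e.
have n0 : (0 < n)%N := leq_ltn_trans (leq0n i) (ltn_ord i).
have ea : a = b.
  have := congr1 (fun x => x %/ n)%N e.
  by rewrite !divnMDl // !divn_small ?addn0.
rewrite ea in e *; congr (_, _); apply: val_inj.
by have /addnI := e.
Qed.

Lemma wt_pos c d : (wt c < wt d)%N -> (pos c < pos d)%N.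
Proof.
rewrite /wt ltn_exp2l ?prime_gt1 // /pos => cd.
apply: leq_trans (_ : c.2.+1 * n <= _)%N; first by rewrite mulSn addnC ltn_add2r.
by rewrite (leq_trans _ (leq_addr _ _)) // leq_mul2r cd orbT.
Qed.

Lemma pchar_exprD (a b : S) e : (a + b) ^+ (p ^ e) = a ^+ (p ^ e) + b ^+ (p ^ e).
Proof. by rewrite exprDn_pchar // pnatX pnatE ?charS. Qed.

Lemma act_zpow c t : act t (zpow c) = zpow c + zdiff c t.
Proof. by rewrite /zpow rmorphXn /= -pchar_exprD addrC subrK. Qed.

Lemma zdiffE c t : zdiff c t = act t (zpow c) - zpow c.
Proof. by rewrite act_zpow addrC addKr. Qed.

Lemma zpow_next c : zpow (next c) = zpow c ^+ p.
Proof. by rewrite /zpow /wt /= expnSr exprM. Qed.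

Lemma zdiff_next c t : zdiff (next c) t = zdiff c t ^+ p.
Proof. by rewrite /zdiff /wt /= expnSr exprM. Qed.

Lemma wt_next c : wt (next c) = (wt c * p)%N.
Proof. by rewrite /wt expnSr. Qed.

Lemma wt_gt0 c : (0 < wt c)%N. Proof. by rewrite expn_gt0 prime_gt0. Qed.

Lemma zpow_homog c : zpow c \is (wt c).-homog.
Proof. by have := dhomogMn (wt c) (z1 c.1); rewrite mul1n. Qed.

Lemma zdiff_homog c t : zdiff c t \is (wt c).-homog.
Proof.
rewrite zdiffE rpredB ?zpow_homog //; apply: graded_homog; last exact: zpow_homog.
exact: graded_act_graded actG t.
Qed.

Lemma epsy_zdiff c t : t \in T -> epsy (zdiff c t) = zdiff c t.
Proof. by move=> tT; rewrite rmorphXn /= epsy_move. Qed.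

Let TG t : t \in T -> t \in G. Proof. exact: (subsetP sTG). Qed.

Lemma zdiff_additive c : additive_on T (zdiff c).
Proof.
move=> s t sT tT; rewrite /= -pchar_exprD; congr (_ ^+ _).
rewrite (graded_actM actG) ?TG //.
have /fixedP/(_ s sT) := z_move c.1 tT; rewrite rmorphB /= => e.
by rewrite -e [in RHS]addrC addrA subrK.
Qed.

(** For [s = 1] this is the sum of products of columns, for an empty list the transfer of [s]. The
    mixed form allows [tr_cons] to move one column at a time from the list into [s]. *)
Definition tr (s : S) (J : seq column) := \sum_(t in T) act t s * \prod_(c <- J) zdiff c t.
Definition wtl (J : seq column) := (\sum_(c <- J) wt c)%N.

Lemma tr_cons s c J : tr s (c :: J) = tr (s * zpow c) J - zpow c * tr s J.
Proof.
rewrite /tr mulr_sumr -sumrB; apply: eq_bigr => t _.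
by rewrite big_cons rmorphM /= zdiffE; ring.
Qed.

Lemma tr_perm s J J' : perm_eq J J' -> tr s J = tr s J'.
Proof. by move=> e; apply: eq_bigr => t _; rewrite (perm_big _ e). Qed.

Lemma tr_dvd s J : exists r, tr s J = L * r.
Proof.
elim: J s => [|c J IH] s.
  have [r e] := transfer_dvd s; exists r; rewrite -e; apply: eq_bigr => t _.
  by rewrite big_nil mulr1.
have [r e] := IH (s * zpow c); have [r' e'] := IH s.
by exists (r - zpow c * r'); rewrite tr_cons e e'; ring.
Qed.

Lemma tr_homog s J d : s \is d.-homog -> tr s J \is (d + wtl J).-homog.
Proof.
move=> sd; rewrite rpred_sum // => t _; apply: dhomogM.
  exact: graded_homog (graded_act_graded actG t) sd.
rewrite /wtl; elim: J => [|c J IH]; first by rewrite !big_nil dhomog1.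
by rewrite !big_cons dhomogM // zdiff_homog.
Qed.

Lemma tr_low s J d : s \is d.-homog -> (d + wtl J < N)%N -> tr s J = 0.
Proof.
move=> sd dN; have h := tr_homog J sd; have [r e] := tr_dvd s J.
by rewrite -(pihomog_dE h) e; apply: pihomogM_small LN dN.
Qed.

Lemma tr1_low J : (wtl J < N)%N -> tr 1 J = 0.
Proof. by move=> JN; apply: tr_low (dhomog1 _ _) _. Qed.

(** At total degree [N] the correction term of [tr_cons] has degree below [N], so, being a multiple
    of [L], it is zero. *)
Lemma tr_eq s J d : s \is d.-homog -> (d + wtl J = N)%N ->
  tr s J = tr (s * \prod_(c <- J) zpow c) [::].
Proof.
elim: J s d => [|c J IH] s d sd; first by rewrite big_nil mulr1.
rewrite /wtl big_cons -/(wtl J) => dN.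
rewrite tr_cons (tr_low sd (J := J)) ?mulr0 ?subr0; last first.
  by rewrite -dN ltn_add2l -[X in (X < _)%N]add0n ltn_add2r wt_gt0.
rewrite (IH _ (d + wt c)%N) ?dhomogM ?zpow_homog //; last by rewrite -addnA.
by rewrite big_cons mulrA.
Qed.

Lemma coord_monomials s : exists r : seq (k * seq 'I_n), 
  s = \sum_(u <- r) u.1 *: \prod_(i <- u.2) z i.
Proof.
elim/(coord_ind zspan): s => [c|i|s t [r ->] [r' ->]|s t [r ->] [r' ->]].
- by exists [:: (c, [::])]; rewrite big_seq1 /= big_nil -mul_mpolyC mulr1.
- by exists [:: (1, [:: i])]; rewrite big_seq1 /= big_seq1 scale1r.
- by exists (r ++ r'); rewrite big_cat.
exists [seq (u.1 * v.1, u.2 ++ v.2) | u <- r, v <- r'].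
rewrite big_allpairs_dep mulr_suml; apply: eq_bigr => u _; rewrite mulr_sumr.
by apply: eq_bigr => v _; rewrite big_cat /= -scalerAl -scalerAr scalerA.
Qed.

(** The transfer is graded and [L] is the transfer of [a], so some monomial of [a] of degree [N] has
    nonzero transfer. Its factors, taken as columns of weight one, have the same trace. *)
Lemma exists_monomial : exists J, wtl J = N /\ tr 1 J != 0.
Proof.
have [a aL] := transfer_hit; have [r ar] := coord_monomials a.
have LE : L = \sum_(u <- r) u.1 *: pihomog mdeg N (tr (\prod_(i <- u.2) z i) [::]).
  have trE : \sum_(t in T) act t a = \sum_(u <- r) u.1 *: tr (\prod_(i <- u.2) z i) [::].
    rewrite ar; under eq_bigr do rewrite linear_sum; rewrite exchange_big; apply: eq_bigr => u _ /=.
    rewrite /tr scaler_sumr; apply: eq_bigr => t _.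
    by rewrite linearZ big_nil mulr1.
  rewrite -{1}(pihomog_dE LN) -aL trE linear_sum; apply: eq_bigr => u _.
  by rewrite linearZ.
have [u ur u0] : exists2 u, u \in r & pihomog mdeg N (tr (\prod_(i <- u.2) z i) [::]) != 0.
  apply: NNPP => ne; case/eqP: L0; rewrite LE big_seq big1 // => u ur.
  have [->|h] := eqVneq (pihomog mdeg N (tr (\prod_(i <- u.2) z i) [::])) 0.
    by rewrite scaler0.
  by case: ne; exists u.
pose J := [seq (i, 0%N) : column | i <- u.2].
have Jz : \prod_(c <- J) zpow c = \prod_(i <- u.2) z i by rewrite big_map.
have Jw : wtl J = size u.2.
  by rewrite /wtl big_map -sum1_size; apply: eq_bigr => i _; rewrite /wt expn0.
have zh : \prod_(i <- u.2) z i \is (size u.2).-homog.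
  elim: (u.2) => [|i s IH] /=; first by rewrite big_nil dhomog1.
  by rewrite big_cons -add1n dhomogM.
have sN : size u.2 = N.
  apply/eqP; apply: contraNT u0 => h; apply/eqP.
  apply: pihomog_ne0 h _; have := tr_homog [::] zh.
  by rewrite /wtl big_nil addn0.
exists J; rewrite Jw sN; split=> //.
rewrite (tr_eq (d := 0%N)) ?dhomog1 ?Jw // mul1r Jz.
by apply: contraNneq u0 => ->; rewrite linear0.
Qed.

Definition posl (J : seq column) := (\sum_(c <- J) pos c)%N.

Lemma exists_minimal : exists J, [/\ wtl J = N, tr 1 J != 0,
   forall J', wtl J' = N -> tr 1 J' != 0 -> (size J <= size J')%N
 & forall J', wtl J' = N -> tr 1 J' != 0 -> size J' = size J -> (posl J <= posl J')%N].
Proof.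
have [J1 [J1N J10] J1min] := classic_min size exists_monomial.
have [J [JN [J0 Js]] Jmin] := classic_min (P := fun J => wtl J = N /\ tr 1 J != 0 /\ size J = size J1)
  posl (ex_intro _ J1 (conj J1N (conj J10 erefl))).
exists J; split=> // J' J'N J'0; first by rewrite Js; apply: J1min.
by rewrite Js => s'; apply: Jmin.
Qed.

Section Minimal.
Variable J : seq column.
Hypothesis JN : wtl J = N.
Hypothesis J0 : tr 1 J != 0.
Hypothesis Jsize : forall J', wtl J' = N -> tr 1 J' != 0 -> (size J <= size J')%N.
Hypothesis Jpos : forall J', wtl J' = N -> tr 1 J' != 0 -> size J' = size J -> (posl J <= posl J')%N.
Local Notation C := (undup J).

Lemma wtl_cons c K : wtl (c :: K) = (wt c + wtl K)%N.
Proof. by rewrite /wtl big_cons. Qed.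
Lemma posl_cons c K : posl (c :: K) = (pos c + posl K)%N.
Proof. by rewrite /posl big_cons. Qed.
Lemma wtl_rem c : c \in J -> wtl J = (wt c + wtl (rem c J))%N.
Proof. by move=> cJ; rewrite /wtl (perm_big _ (perm_to_rem cJ)) big_cons. Qed.
Lemma posl_rem c : c \in J -> posl J = (pos c + posl (rem c J))%N.
Proof. by move=> cJ; rewrite /posl (perm_big _ (perm_to_rem cJ)) big_cons. Qed.

(* Replacing [c] by an earlier column kills the trace, by minimality. *)
Lemma tr_replace c d : c \in J -> (pos d < pos c)%N -> tr 1 (d :: rem c J) = 0.
Proof.
move=> cJ dc; have wdc : (wt d <= wt c)%N.
  by rewrite leqNgt; apply: contraTN dc => /wt_pos h; rewrite -leqNgt ltnW.
have wN : (wtl (d :: rem c J) <= N)%N.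
  by rewrite -JN wtl_cons (wtl_rem cJ) leq_add2r.
move: wN; rewrite leq_eqVlt => /orP[/eqP wN|]; last exact: tr1_low.
apply/eqP/negPn/negP => h.
have := Jpos wN h; rewrite posl_cons (posl_rem cJ) leq_add2r leqNgt dc => H.
by suff : false by []; apply: H; rewrite /= size_rem // prednK //; case: (J) cJ.
Qed.

Lemma tr_mul c K : tr 1 (c :: K) = \sum_(t in T) zdiff c t * \prod_(d <- K) zdiff d t.
Proof. by apply: eq_bigr => t _; rewrite rmorph1 mul1r big_cons. Qed.

(* The last column of a relation could be exchanged in [J] for earlier ones. *)
Lemma C_independent (g : column -> S) :
  (forall t, t \in T -> \sum_(c <- C) g c * zdiff c t = 0) -> forall c, c \in C -> g c = 0.
Proof.
move=> gC c0 c0C; apply/eqP/negPn/negP => g0.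
pose B := (\max_(c <- C) pos c)%N.
have posB c : c \in C -> (pos c <= B)%N by move=> cC; apply: (leq_bigmax_seq (F := pos)).
have [c [cC gc] cmax] := classic_min (P := fun c => c \in C /\ g c != 0)
  (fun c => B - pos c)%N (ex_intro _ c0 (conj c0C g0)).
have cJ : c \in J by rewrite -mem_undup.
case/eqP: (mulf_neq0 gc J0).
have -> : tr 1 J = tr 1 (c :: rem c J) by apply/tr_perm/perm_to_rem.
have gCc t : t \in T -> g c * zdiff c t = - \sum_(d <- C | d != c) g d * zdiff d t.
  move=> /gC; rewrite (bigD1_seq c) ?undup_uniq //= => /eqP.
  by rewrite addr_eq0 => /eqP.
rewrite tr_mul mulr_sumr.
transitivity (- \sum_(d <- C | d != c) g d * tr 1 (d :: rem c J)).
  under [X in - X]eq_bigr do rewrite tr_mul mulr_sumr.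
  rewrite exchange_big -sumrN; apply: eq_bigr => t tT /=.
  rewrite mulrA gCc // mulNr mulr_suml; congr (- _).
  by apply: eq_bigr => d _; rewrite mulrA.
rewrite big_seq_cond big1 ?oppr0 // => d /andP[dC dc].
have [->|gd] := eqVneq (g d) 0; first by rewrite mul0r.
rewrite tr_replace ?mulr0 //; have := cmax d (conj dC gd).
have := posB d dC; have := posB c cC.
have : pos d != pos c by rewrite (inj_eq pos_inj).
move: (pos c) (pos d) B {posB cmax} => a b e ab ae be; rewrite leq_sub2lE // => ba.
by rewrite ltn_neqAle ab.
Qed.

(** The p-th power of the column [c] is the column [next c], of p times the weight. *)
Lemma collapse c K : (p <= count_mem c K)%N ->
  exists K', [/\ tr 1 K' = tr 1 K, wtl K' = wtl K & (size K' < size K)%N].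
Proof.
case/perm_nseq => K0 e; exists (next c :: K0); split.
- rewrite (tr_perm 1 e); apply: eq_bigr => t _.
  by rewrite big_cons [in RHS]big_cat big_nseq iter_mulr_1 zdiff_next.
- by rewrite /wtl (perm_big _ e) big_cons [in RHS]big_cat big_nseq wt_next iter_addn_0 mulnC.
- by rewrite (perm_size e) size_cat size_nseq /= -[X in (X < _)%N]add1n ltn_add2r prime_gt1.
Qed.

Lemma count_small c : (count_mem c J <= p.-1)%N.
Proof.
rewrite -ltnS prednK ?prime_gt0 // ltnNge; apply/negP => /collapse[K' [e1 e2 e3]].
by have := Jsize (etrans e2 JN); rewrite e1 leqNgt e3 => /(_ J0).
Qed.

Lemma tr_short K : (size K < m * p.-1)%N -> tr 1 K = 0.
Proof.
move=> h; have e := @sum_prod_additive _ _ _ _ abT ntT charS (size K) (fun i => zdiff (tnth (in_tuple K) i)).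
rewrite -[RHS]e //; last by move=> i; apply: zdiff_additive.
by apply: eq_bigr => t _; rewrite rmorph1 mul1r big_tnth.
Qed.

Lemma column_dependent (cs : seq column) : uniq cs -> (m < size cs)%N ->
  exists g : column -> S, (exists2 c, c \in cs & g c != 0) /\
    forall t, t \in T -> \sum_(c <- cs) g c * zdiff c t = 0.
Proof.
move=> ucs h; have [g [i gi] gP] := @additive_dependent _ _ _ _ abT ntT (size cs)
  (fun i => zdiff (tnth (in_tuple cs) i)) (fun i => @zdiff_additive _) h.
pose g' c := oapp g 0 (insub (index c cs)).
have g'E j : g' (tnth (in_tuple cs) j) = g j.
  rewrite /g' (tnth_nth (tnth (in_tuple cs) i)) /= index_uniq // insubT //= => hj.
  by congr g; apply: val_inj.
exists g'; split; first by exists (tnth (in_tuple cs) i); rewrite ?mem_tnth ?g'E.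
by move=> t tT; rewrite -[RHS](gP t tT) big_tnth; apply: eq_bigr => j _; rewrite g'E.
Qed.

Lemma size_count : size J = (\sum_(c <- C) count_mem c J)%N.
Proof.
rewrite -(perm_size (perm_count_undup J)) size_flatten sumnE /shape -map_comp big_map.
by apply: eq_bigr => c _ /=; rewrite size_nseq.
Qed.

Lemma size_J_ge : (m * p.-1 <= size J)%N.
Proof. by rewrite leqNgt; apply: contra J0 => /tr_short->. Qed.

Lemma size_J_le : (size J <= size C * p.-1)%N.
Proof.
rewrite size_count -sum1_size big_distrl /=; apply: leq_sum => c _.
by rewrite mul1n count_small.
Qed.

(** More than m additive functions are dependent, so independence bounds the number of columns by m.
    Conversely m (p - 1) columns with repetition are needed for a nonzero trace, and none occurs
    more than p - 1 times. *)
Lemma size_C : size C = m.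
Proof.
have p1 : (0 < p.-1)%N by rewrite -ltnS prednK ?prime_gt1 ?prime_gt0.
apply/eqP; rewrite eqn_leq; apply/andP; split.
  rewrite leqNgt; apply/negP => /(column_dependent (undup_uniq J))[g [[c cC gc] gP]].
  by case/eqP: gc; apply: C_independent gP _ cC.
by rewrite -(leq_pmul2r p1) (leq_trans size_J_ge size_J_le).
Qed.

Lemma count_C c : c \in C -> count_mem c J = p.-1.
Proof.
move=> cC; apply/eqP; rewrite eqn_leq count_small leqNgt; apply/negP => h.
have := size_J_ge; rewrite leqNgt size_count => /negP; apply.
rewrite -size_C -sum1_size big_distrl (bigD1_seq c) ?undup_uniq //=.
rewrite [X in (_ < X)%N](bigD1_seq c) ?undup_uniq //= -addSn leq_add ?mul1n //.
by apply: leq_sum => d _; rewrite ?mul1n count_small.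
Qed.

(** After the exchange [d] occurs p times; collapsing leaves a list shorter than m (p - 1), whose
    trace is zero. *)
Lemma tr_exchange c d : c \in C -> d \in C -> d != c -> tr 1 (d :: rem c J) = 0.
Proof.
move=> cC dC dc; have cJ : c \in J by rewrite -mem_undup.
have : (p <= count_mem d (d :: rem c J))%N.
  rewrite /= eqxx count_mem_rem eq_sym (negPf dc) subn0 count_C //.
  by rewrite add1n prednK ?prime_gt0.
case/collapse=> K [<- _ sK]; apply: tr_short; apply: leq_trans sK _.
by rewrite /= size_rem // prednK -?size_C ?size_J_le //; case: (J) cJ.
Qed.

Lemma tr1_quotient K e : wtl K = (N + e)%N ->
  exists r, [/\ tr 1 K = L * r, r \is e.-homog & epsy r = r].
Proof.
move=> Ke; have h : tr 1 K \is (N + e).-homog by rewrite -Ke; apply: tr_homog (dhomog1 _ _).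
have epsy_tr : epsy (tr 1 K) = tr 1 K.
  rewrite rmorph_sum; apply: eq_bigr => t tT /=.
  rewrite !rmorph1 !mul1r rmorph_prod; apply: eq_bigr => c _; exact: epsy_zdiff.
have [r e1] := tr_dvd 1 K; exists (epsy (pihomog mdeg e r)); split.
- by rewrite -{1}epsy_tr -(pihomog_dE h) e1 (pihomogM _ _ LN) [LHS]rmorphM /= epsyL.
- exact: graded_homog epsy_graded (pihomogP _ _ _).
- exact: epsy_idem.
Qed.

(** The products over [rem c J] act as a dual basis: paired with a column [d] of [C] they give a
    nonzero multiple of [L] if [d = c] and 0 otherwise. Pairing them with the column [j] reads off
    its coefficients, which are polynomials because every trace is a multiple of [L]. [tr_replace]
    gives the condition on positions. *)
Lemma column_relation j : j \notin C -> exists gam : column -> S, 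
  [/\ forall c, c \in C -> [/\ gam c \is (wt j - wt c).-homog, epsy (gam c) = gam c
         & gam c != 0 -> (wt c <= wt j)%N && (pos c < pos j)%N],
      forall t, t \in T -> zdiff j t = \sum_(c <- C) gam c * zdiff c t
    & (forall t, t \in T -> zdiff j t = 0) -> forall c, c \in C -> gam c = 0].
Proof.
move=> jC; have [kap kap0 Jk] : exists2 kap : k, kap != 0 & tr 1 J = kap *: L.
  have [|r [e1 r0 _]] := @tr1_quotient J 0%N; first by rewrite addn0.
  exists (r@_0); last by rewrite e1 {1}(dhomog0E r0) mulrC mul_mpolyC.
  by apply: contraNneq J0 => h; rewrite e1 (dhomog0E r0) h mulr0.
have tr_j c : c \in C -> exists r, [/\ tr 1 (j :: rem c J) = L * r,
    r \is (wt j - wt c).-homog, epsy r = r & r != 0 -> (wt c <= wt j)%N && (pos c < pos j)%N].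
  move=> cC; have cJ : c \in J by rewrite -mem_undup.
  have [e|ne] := eqVneq (tr 1 (j :: rem c J)) 0.
    by exists 0; rewrite e mulr0 rpred0 rmorph0 eqxx.
  have cj : (pos c < pos j)%N.
    rewrite ltn_neqAle (inj_eq pos_inj); apply/andP; split.
      by apply: contraNneq jC => <-.
    by rewrite leqNgt; apply: contra ne => h; rewrite tr_replace.
  have wcj : (wt c <= wt j)%N.
    by rewrite leqNgt; apply: contraTN cj => /wt_pos h; rewrite -leqNgt ltnW.
  have [|r [e1 e2 e3]] := @tr1_quotient (j :: rem c J) (wt j - wt c)%N.
    by rewrite wtl_cons -JN (wtl_rem cJ) addnAC subnKC.
  by exists r; split=> // _; rewrite wcj cj.
have [r rP] : exists r : column -> S, forall c, c \in C -> [/\ tr 1 (j :: rem c J) = L * r c,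
    r c \is (wt j - wt c).-homog, epsy (r c) = r c & r c != 0 -> (wt c <= wt j)%N && (pos c < pos j)%N].
  have := fin_all_exists (fun c : seq_sub C => tr_j (val c) (valP c)).
  case=> r rP; exists (fun c => oapp r 0 (insub c)) => c cC.
  by rewrite insubT /=; apply: rP (Sub c cC).
exists (fun c => kap^-1 *: r c); split.
- move=> c cC; have [e1 e2 e3 e4] := rP c cC; split; first exact: rpredZ.
    by rewrite linearZ /= e3.
  by rewrite scaler_eq0 negb_or => /andP[_ /e4].
- have uC : uniq (j :: C) by rewrite /= jC undup_uniq.
  have [|del [[c cC del0] delP]] := column_dependent uC; first by rewrite /= size_C.
  have dj0 : del j != 0.
    apply/eqP => h; move: cC; rewrite inE => /predU1P[cj|cC].
      by move: del0; rewrite cj h eqxx.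
    case/eqP: del0; apply: (C_independent (g := del)) _ cC => t tT.
    by rewrite -[RHS](delP t tT) big_cons h mul0r add0r.
  (* Multiplying the dependence by the product over [rem d J] and summing over [T] leaves the terms
     of [j] and [d] only. *)
  have delc d : d \in C -> del d * kap%:MP = - del j * r d.
    move=> dC; have dJ : d \in J by rewrite -mem_undup.
    apply: (mulIf L0); rewrite -!mulrA mul_mpolyC -Jk (tr_perm 1 (perm_to_rem dJ)).
    have [+ _ _ _] := rP d dC; rewrite [r d * _]mulrC => <-.
    have : del j * tr 1 (j :: rem d J) + \sum_(e <- C) del e * tr 1 (e :: rem d J) = 0.
      transitivity (\sum_(e <- j :: C) del e * tr 1 (e :: rem d J)); first by rewrite big_cons.
      under eq_bigr do rewrite tr_mul mulr_sumr.
      rewrite exchange_big big1 //= => t tT.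
      transitivity ((\sum_(e <- j :: C) del e * zdiff e t) * \prod_(b <- rem d J) zdiff b t).
        by rewrite mulr_suml; apply: eq_bigr => e _; rewrite mulrA.
      by rewrite delP // mul0r.
    rewrite (bigD1_seq d) ?undup_uniq //= big_seq_cond big1 ?addr0; last first.
      by move=> e /andP[eC ed]; rewrite tr_exchange ?mulr0.
    by rewrite mulNr => /eqP; rewrite addrC addr_eq0 => /eqP.
  move=> t tT; apply/eqP; rewrite -subr_eq0 -(mulrI_eq0 _ (mulfI dj0)); apply/eqP.
  rewrite -[RHS](delP t tT) big_cons mulrBr; congr (_ + _).
  rewrite mulr_sumr -sumrN big_seq [RHS]big_seq; apply: eq_bigr => d dC.
  rewrite -scalerAl -scalerAr mulrA -scalerN -mulNr -mulNr -delc // -mul_mpolyC.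
  by rewrite [del d * _]mulrC !mulrA -mpolyCM mulVf // mul1r.
move=> h c cC; have [e1 _ _ _] := rP c cC.
suff -> : r c = 0 by rewrite scaler0.
apply: (mulfI L0); rewrite -e1 mulr0 tr_mul big1 // => t tT.
by rewrite h // mul0r.
Qed.

Lemma exists_invariant j : j \notin C -> exists P, [/\ P \in fixed T, P \is (wt j).-homog,
    exists gam : column -> S, P = zpow j - \sum_(c <- C) gam c * zpow c /\
      forall c, c \in C -> [/\ gam c \is (wt j - wt c).-homog, epsy (gam c) = gam c
         & gam c != 0 -> (wt c <= wt j)%N && (pos c < pos j)%N]
  & (forall t, t \in T -> zdiff j t = 0) -> P = zpow j].
Proof.
move=> /column_relation[gam [gamP colj gam0]].
exists (zpow j - \sum_(c <- C) gam c * zpow c); split.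
- apply/fixedP => t tT; rewrite rmorphB rmorph_sum /= act_zpow colj //.
  have -> : \sum_(c <- C) act t (gam c * zpow c) =
      \sum_(c <- C) gam c * zpow c + \sum_(c <- C) gam c * zdiff c t.
    rewrite -big_split; apply: eq_big_seq => c cC /=; rewrite rmorphM /= act_zpow mulrDr.
    have [_ e _] := gamP c cC; rewrite -e.
    by have /fixedP -> := epsy_fixed (gam c).
  by ring.
- rewrite rpredB ?zpow_homog // big_seq rpred_sum // => c cC; have [e _ h] := gamP c cC.
  have [->|/h/andP[wc _]] := eqVneq (gam c) 0; first by rewrite mul0r rpred0.
  by rewrite -(subnK wc) dhomogM ?zpow_homog // subnK.
- by exists gam.
by move=> /gam0 h; rewrite big_seq big1 ?subr0 // => c cC; rewrite h ?mul0r.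
Qed.

Lemma zdiff_C_neq0 c : c \in C -> exists2 t, t \in T & zdiff c t != 0.
Proof.
rewrite mem_undup => cJ; apply: NNPP => ne; case/eqP: J0.
rewrite (tr_perm 1 (perm_to_rem cJ)) tr_mul big1 // => t tT.
have [->|h] := eqVneq (zdiff c t) 0; first by rewrite mul0r.
by case: ne; exists t.
Qed.

End Minimal.

Lemma exists_column_basis : exists C : seq column, [/\ uniq C, size C = m,
  forall c, c \in C -> exists2 t, t \in T & zdiff c t != 0 &
  forall j, j \notin C -> exists P, [/\ P \in fixed T, P \is (wt j).-homog,
    exists gam : column -> S, P = zpow j - \sum_(c <- C) gam c * zpow c /\
      forall c, c \in C -> epsy (gam c) = gam c /\ (gam c != 0 -> (pos c < pos j)%N)
  & (forall t, t \in T -> zdiff j t = 0) -> P = zpow j]].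
Proof.
have [J [JN J0 Jsize Jpos]] := exists_minimal; exists (undup J); split.
- exact: undup_uniq.
- exact: size_C.
- exact: zdiff_C_neq0.
move=> j /(exists_invariant JN J0 Jsize Jpos)[P [e1 e2 [gam [e3 h]] e4]].
exists P; split=> //; exists gam; split=> // c /h[_ -> h']; split=> //.
by move=> /h' /andP[].
Qed.

End MinimalMonomial.

(** * Spanning families and invariants *)

Section FixedRing.
Local Open Scope ring_scope.
Variables (k : fieldType) (n : nat).
Local Notation S := {mpoly k[n]}.

Definition spanned (t : n.-tuple S) (es : seq S) (s : S) :=
  exists b : nat -> S, s = \sum_(j < size es) (b j \mPo t) * es`_j.

Lemma spanned_widen t es s N : (size es <= N)%N -> spanned t es s ->
  exists b : nat -> S, s = \sum_(j < N) (b j \mPo t) * es`_j.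
Proof.
move=> h [b ->]; exists b; rewrite (big_ord_widen _ (fun j => (b j \mPo t) * es`_j) h).
rewrite big_mkcond; apply: eq_bigr => j _; case: ltnP => // js.
by rewrite nth_default ?mulr0.
Qed.

Variables (gT : finGroupType) (G : {group gT}) (act : gT -> {lrmorphism S -> S}).
Hypothesis actG : graded_action G act.
Local Notation fixed := (fixed act).
Variable T : {group gT}.
Hypothesis sTG : T \subset G.

Let TG g : g \in T -> g \in G. Proof. exact: (subsetP sTG). Qed.

Lemma act_independent (C : gT -> S) :
  (forall s, \sum_(g in T) C g * act g s = 0) -> forall g, g \in T -> C g = 0.
Proof.
move=> h g gT'.
have /eqP := @morphism_independence S S gT (mem T) (fun g => act g) (fun=> True) (fun s => s = 0)
  (fun a b ea eb => etrans (congr2 (fun x y => x - y) ea eb) (subrr 0))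
  (fun r a ea => etrans (congr1 (fun x => r * x) ea) (mulr0 r))
  C (fun=> separator k n) I (fun _ _ _ => I) (fun b _ => h b) g gT'.
rewrite mulf_eq0 => /orP[/eqP //|].
rewrite prodf_seq_eq0 => /hasP[u _ /andP[/andP[uT ug]]]; rewrite subr_eq0 => /eqP e.
case/eqP: ug; apply/esym/(graded_act_faithful actG); rewrite ?TG //.
by apply: separatorP e; exact: graded_act_graded actG _.
Qed.

(* The matrix [act g e_j] is regular since the group elements are independent, so *)
(* the coordinates of an invariant [s] are those of [s * 1]. *)
Lemma fixed_of_spanned (t : n.-tuple S) es : (forall i, tnth t i \in fixed T) ->
  es`_0 = 1 -> (size es <= #|T|)%N -> (forall s, spanned t es s) ->
  forall s, s \in fixed T -> exists q, s = q \mPo t.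
Proof.
move=> tT es0 esT esP s sT.
have qT (q : S) g : g \in T -> act g (q \mPo t) = q \mPo t.
  move=> gT'; elim/mpoly_alg_ind: q => [c|i|p q hp hq|p q hp hq].
  - by rewrite comp_mpolyC lrmorph_mpolyC.
  - by by rewrite comp_mpolyXU -tnth_nth; have /fixedP := tT i; apply.
  - by rewrite !rmorphD /= hp hq.
  - by rewrite !rmorphM /= hp hq.
pose M : 'M[S]_#|T| := \matrix_(a, j) act (enum_val a) es`_j.
have detM : \det M != 0.
  apply/negP => /det0P[v v0 vM]; case/eqP: v0; apply/rowP => a; rewrite mxE.
  pose C g := v 0 (enum_rank_in (group1 T) g).
  have <- : C (enum_val a) = v 0 a by rewrite /C enum_valK_in.
  apply: act_independent (enum_valP a) => u; have [b ->] := spanned_widen esT (esP u).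
  under eq_bigr => g gT'.
    rewrite rmorph_sum mulr_sumr /=.
    under eq_bigr => j _ do rewrite rmorphM /= qT // mulrCA.
    over.
  rewrite exchange_big big1 //= => j _; rewrite -mulr_sumr.
  suff -> : \sum_(g in T) C g * act g es`_j = (v *m M) 0 j by rewrite vM mxE mulr0.
  by rewrite mxE big_enum_val; apply: eq_bigr => c _; rewrite /C enum_valK_in mxE.
have [b sb] := spanned_widen esT (esP s).
pose w : 'cV[S]_#|T| := \col_j ((b j \mPo t) - s *+ (j == 0%N :> nat)).
have Mw : M *m w = 0.
  apply/colP => a; rewrite !mxE.
  under eq_bigr => j _ do rewrite !mxE mulrBr.
  rewrite sumrB.
  have aT := enum_valP a; have /fixedP/(_ _ aT) := sT; rewrite {1}sb rmorph_sum /=.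
  under eq_bigr => j _ do rewrite rmorphM /= qT // mulrC.
  move=> ->; apply/eqP; rewrite subr_eq0; apply/eqP.
  rewrite (bigD1 (Ordinal (cardG_gt0 T))) //= mulr1n es0 rmorph1 mul1r big1 ?addr0 // => j j0.
  by rewrite (_ : _ == _ = false) ?mulr0 //; apply: contraNF j0.
have : \det M *: w = 0 by rewrite -mul_scalar_mx -mul_adj_mx -mulmxA Mw mulmx0.
move=> /colP/(_ (Ordinal (cardG_gt0 T))); rewrite !mxE eqxx mulr1n => /eqP.
rewrite mulf_eq0 (negPf detM) subr_eq0 => /eqP e.
by exists (b 0%N).
Qed.

End FixedRing.

Lemma free_family_card (k : fieldType) (V : lmodType k) (I K : finType) (x : I -> V) (y : K -> V)
    (A : I -> K -> k) :
  (forall a : I -> k, (\sum_i a i *: x i = 0)%R -> forall i, a i = 0%R) ->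
  (forall i, x i = \sum_j A i j *: y j)%R -> (#|I| <= #|K|)%N.
Proof.
move=> xfree xA; rewrite leqNgt; apply/negP => h.
pose B : 'M[k]_(#|I|, #|K|) := (\matrix_(i, j) A (enum_val i) (enum_val j))%R.
have : kermx B != 0%R.
  rewrite kermx_eq0 /row_free; apply: contraTneq h => e.
  by rewrite -leqNgt -e rank_leq_col.
case/rowV0Pn => v /sub_kermxP vB; case/eqP; apply/rowP => i; rewrite mxE.
have <- : v 0%R (enum_rank (enum_val i)) = v 0%R i by rewrite enum_valK.
apply: (xfree (fun i => v 0%R (enum_rank i))).
under eq_bigr do rewrite xA scaler_sumr.
rewrite exchange_big big1 //= => j _; under eq_bigr do rewrite scalerA.
rewrite -scaler_suml (reindex_onto enum_val enum_rank) /=; last by move=> *; rewrite enum_rankK.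
rewrite [X in (X *: _)%R](_ : _ = (v *m B)%R 0%R (enum_rank j)); last first.
  rewrite mxE; apply: eq_big => [a|a _]; first by rewrite enum_valK eqxx.
  by rewrite mxE enum_valK enum_rankK.
by rewrite vB mxE scale0r.
Qed.

Lemma card_le_sum (I K : finType) (P : pred K) (Q : I -> pred K) :
  (forall x, P x -> exists i, Q i x) -> (#|P| <= \sum_i #|Q i|)%N.
Proof.
move=> h; under eq_bigr do rewrite -sum1_card big_mkcond.
rewrite exchange_big -sum1_card big_mkcond; apply: leq_sum => x _ /=.
case: ifP => // /h[i Qi]; rewrite (bigD1 i) //= (_ : (x \in Q i) = true) //; exact: Qi.
Qed.

(** * Algebraic independence by counting monomials *)

Section Counting.
Local Open Scope ring_scope.
Variables (k : fieldType) (n : nat).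
Local Notation S := {mpoly k[n]}.
Variables (t : n.-tuple S) (es : seq S).
Hypothesis esP : forall s, spanned t es s.

Definition bspan N (s : S) := exists2 b : nat -> S,
  forall j, (j < size es)%N -> (msize (b j) <= N)%N & s = \sum_(j < size es) (b j \mPo t) * es`_j.

Lemma bspan_mono N N' s : (N <= N')%N -> bspan N s -> bspan N' s.
Proof. by move=> h [b bN ->]; exists b => // j /bN/leq_trans->. Qed.

Lemma bspan0 N : bspan N 0.
Proof.
by exists (fun=> 0) => [j _|]; rewrite ?msize0 // big1 // => j _; rewrite comp_mpoly0 mul0r.
Qed.

Lemma bspanD N s s' : bspan N s -> bspan N s' -> bspan N (s + s').
Proof.
move=> [b bN ->] [b' bN' ->]; exists (fun j => b j + b' j) => [j js|].
  by rewrite (leq_trans (msizeD_le _ _)) // geq_max bN ?bN'.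
by rewrite -big_split; apply: eq_bigr => j _; rewrite rmorphD mulrDl.
Qed.

Lemma bspanM N M p s : (msize p <= M)%N -> bspan N s -> bspan (M + N) ((p \mPo t) * s).
Proof.
move=> pM [b bN ->]; exists (fun j => p * b j) => [j js|].
  have [->|p0] := eqVneq p 0; first by rewrite mul0r msize0.
  have [->|b0] := eqVneq (b j) 0; first by rewrite mulr0 msize0.
  by rewrite msizeM // (leq_trans (leq_pred _)) // leq_add ?bN.
by rewrite mulr_sumr; apply: eq_bigr => j _; rewrite rmorphM mulrA.
Qed.

Lemma exists_bspan s : exists N, bspan N s.
Proof.
have [b ->] := esP s; exists (\max_(j < size es) msize (b j))%N; exists b => // j js.
exact: (leq_bigmax (Ordinal js)).
Qed.

Lemma exists_bspan_all (r : seq S) : exists N, forall s, s \in r -> bspan N s.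
Proof.
elim: r => [|s r [N h]]; first by exists 0%N.
have [M hM] := exists_bspan s; exists (maxn N M) => s'; rewrite inE => /predU1P[->|/h].
  exact: bspan_mono (leq_maxr _ _) hM.
exact: bspan_mono (leq_maxl _ _).
Qed.

(** Re-expanding a variable times a member of [es] costs a bounded amount [D], so the size of the
    coefficients grows linearly with the degree. *)
Lemma bspan_monomials : exists D, forall m : 'X_{1..n}, bspan (D + mdeg m * D) 'X_[m].
Proof.
have [D h] := exists_bspan_all (1 :: [seq 'X_i * e | i <- enum 'I_n, e <- es]).
exists D => m.
have hX i s N : bspan N s -> bspan (D + N) ('X_i * s).
  move=> [b bN ->]; rewrite mulr_sumr; elim/big_ind: _ => [||j _].
  - exact: bspan0.
  - exact: bspanD.
  rewrite mulrCA addnC; apply: bspanM; first exact: bN.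
  by apply: h; rewrite inE; apply/orP; right; apply/allpairsP; exists (i, es`_j);
    rewrite mem_enum mem_nth.
have hXe i e s N : bspan N s -> bspan (N + e * D) ('X_i ^+ e * s).
  move=> hs; elim: e => [|e IH]; first by rewrite addn0 mul1r.
  by rewrite exprS -mulrA mulSn addnCA; apply: hX.
rewrite mpolyXE_id mdegE.
suff : forall r : seq 'I_n, bspan (D + (\sum_(i <- r) m i)%N * D) (\prod_(i <- r) 'X_i ^+ m i).
  by apply.
elim=> [|i r IH]; first by rewrite !big_nil addn0; apply: h; rewrite inE eqxx.
by rewrite !big_cons mulnDl addnCA addnC; apply: hXe.
Qed.

Section Relation.
Variable F : S.
Hypothesis F0 : F != 0.
Hypothesis Ft : F \mPo t = 0.
Variable R : nat.
Local Notation u0 := (mlead F).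
Local Notation K := {f : {ffun 'I_n -> 'I_R.+1} | [exists i, f i < u0 i]%N}.

Let mon (f : 'I_n -> nat) : S := \prod_i tnth t i ^+ f i.

Definition reduced s := exists a : K -> k, s = \sum_f a f *: mon (fun i => val f i).

Lemma reduced0 : reduced 0.
Proof. by exists (fun=> 0); rewrite big1 // => f _; rewrite scale0r. Qed.

Lemma reducedD s s' : reduced s -> reduced s' -> reduced (s + s').
Proof.
move=> [a ->] [b ->]; exists (fun f => a f + b f).
by rewrite -big_split; apply: eq_bigr => f _; rewrite scalerDl.
Qed.

Lemma reducedZ c s : reduced s -> reduced (c *: s).
Proof.
move=> [a ->]; exists (fun f => c * a f).
by rewrite scaler_sumr; apply: eq_bigr => f _; rewrite scalerA.
Qed.

Lemma reduced_sum (I : eqType) (r : seq I) (E : I -> S) :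
  (forall i, i \in r -> reduced (E i)) -> reduced (\sum_(i <- r) E i).
Proof.
move=> h; rewrite big_seq; elim/big_ind: _ => //; [exact: reduced0|exact: reducedD].
Qed.

Lemma comp_monomial u : 'X_[u] \mPo t = mon u.
Proof. by rewrite comp_mpolyX. Qed.

(** A multiple of the leading monomial is rewritten by the relation into smaller monomials. The
    order refines the degree, so the bound [R] persists. *)
Lemma reduced_monomial (u : 'X_{1..n}) : (mdeg u <= R)%N -> reduced ('X_[u] \mPo t).
Proof.
move: u; apply: (@ltmwf n) => u IH uR; have [u0u|h] := boolP (u0 <= u)%MM.
  have e : (F * 'X_[u - u0]) \mPo t = 0 by rewrite rmorphM /= Ft mul0r.
  have eF : F * 'X_[u - u0] - \sum_(v <- rem u0 (msupp F)) F@_v *: 'X_[v + (u - u0)]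
      = mleadc F *: 'X_[u].
    rewrite [X in X * _ - _](mpolyE F) (perm_big _ (perm_to_rem (mlead_supp F0))) big_cons.
    rewrite mulrDl mulr_suml -addrA -sumrB [X in _ + X]big1 ?addr0 => [|v _]; last first.
      by rewrite -scalerAl -mpolyXD subrr.
    by rewrite -scalerAl -mpolyXD addmC submK.
  have -> : 'X_[u] = (mleadc F)^-1 *: (F * 'X_[u - u0]
      - \sum_(v <- rem u0 (msupp F)) F@_v *: 'X_[v + (u - u0)]).
    by rewrite eF scalerA mulVf ?mleadc_eq0 // scale1r.
  rewrite linearZ; apply: reducedZ; rewrite linearB /= e sub0r -scaleN1r; apply: reducedZ.
  rewrite linear_sum; apply: reduced_sum => v vF /=.
  rewrite linearZ; apply: reducedZ.
  have vu : (v < u0)%O.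
    move: vF; rewrite mem_rem_uniq ?msupp_uniq // inE => /andP[vu vF].
    by rewrite Order.POrderTheory.lt_neqAle vu msupp_le_mlead.
  have vlt : ((v + (u - u0))%MM < u)%O 
    by have := ltmc_add2r (u - u0)%MM v u0; rewrite vu [X in (X < _)%O]addmC submK // => ->.
  apply: IH => //; apply: leq_trans uR; rewrite leqNgt; apply/negP => /lt_mdeg_ltmc.
  by rewrite Order.POrderTheory.lt_gtF.
have uiR i : (u i < R.+1)%N.
  by rewrite ltnS; apply: leq_trans uR; rewrite mdegE (bigD1 i) //= leq_addr.
pose f : {ffun 'I_n -> 'I_R.+1} := [ffun i => Ordinal (uiR i)].
have fK : [exists i, f i < u0 i]%N.
  by move: h; rewrite negb_forall => /existsP[i]; rewrite -ltnNge => hi; apply/existsP; exists i; rewrite ffunE.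
exists (fun g => (g == Sub f fK)%:R); rewrite (bigD1 (Sub f fK)) //= eqxx scale1r.
rewrite big1 ?addr0 => [|g /negPf->]; last by rewrite scale0r.
by rewrite comp_monomial; apply: eq_bigr => i _; rewrite ffunE.
Qed.

Lemma reduced_comp (p : S) : (msize p <= R.+1)%N -> reduced (p \mPo t).
Proof.
move=> pR; rewrite (mpolyE p) linear_sum; apply: reduced_sum => u up /=.
rewrite linearZ; apply: reducedZ; apply: reduced_monomial.
by rewrite -ltnS; apply: leq_trans (msize_mdeg_lt up) pR.
Qed.

Lemma card_reduced : (#|{: K}| <= mdeg u0 * R.+1 ^ n.-1)%N.
Proof.
rewrite card_sig mdegE big_distrl /=.
pose Fm i : pred {ffun 'I_n -> 'I_R.+1} := family (fun j : 'I_n => if j == i then [pred x : 'I_R.+1 | x < u0 i]%N else predT).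
apply: leq_trans (_ : \sum_i #|Fm i| <= _)%N.
  apply: card_le_sum => f /existsP[i fi]; exists i; apply/familyP => j.
  by case: ifP => [/eqP->|].
apply: leq_sum => i _; rewrite /Fm card_family foldrE big_map big_enum (bigD1 i) //= eqxx.
rewrite leq_mul //.
  rewrite cardE -(size_map val) -[leqRHS](size_iota 0); apply: uniq_leq_size.
    by rewrite map_inj_uniq ?enum_uniq //; exact: val_inj.
  by move=> _ /mapP[x + ->]; rewrite mem_enum mem_iota.
rewrite (eq_bigr (fun=> R.+1)) => [|j /negPf->]; last by rewrite card_ord.
by rewrite prod_nat_const cardC1 card_ord.
Qed.

End Relation.

Lemma free_monomials M : forall a : {ffun 'I_n -> 'I_M.+1} -> k,
  \sum_f a f *: \prod_i ('X_i : S) ^+ f i = 0 -> forall f, a f = 0.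
Proof.
move=> a e f; pose u (g : {ffun 'I_n -> 'I_M.+1}) : 'X_{1..n} := [multinom (g i : nat) | i < n].
have uE (g : {ffun 'I_n -> 'I_M.+1}) : \prod_i ('X_i : S) ^+ g i = 'X_[u g].
  by rewrite mpolyXE_id; apply: eq_bigr => i _; rewrite mnmE.
have := congr1 (fun p => p@_(u f)) e; rewrite linear_sum (bigD1 f) //= [X in _ + X]big1 => [|g gf].
  by rewrite addr0 uE mcoeffZ mcoeffX eqxx mulr1 mcoeff0.
rewrite uE mcoeffZ mcoeffX (_ : _ == _ = false) ?mulr0 //; apply: contraNF gf => /eqP h.
by apply/eqP/ffunP => i; apply: val_inj; have := congr1 (fun v : 'X_{1..n} => v i) h; rewrite !mnmE.
Qed.

(* A relation would leave only [O(M ^ n.-1)] reduced monomials in [t] to span the *)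
(* [M.+1 ^ n] monomials in the variables. *)
Theorem alg_independent_of_spanned F : F \mPo t = 0 -> F = 0.
Proof.
move=> Ft; apply/eqP/negPn/negP => F0; have [D hD] := bspan_monomials.
(* [R] bounds the coefficient sizes for monomials with exponents at most [M], and
   [R.+1 <= E * M.+1]. The value of [M] turns the count into [M.+1 ^ n <= M * M.+1 ^ n.-1]; the case
   [n = 0] is apart, with [c = 0]. *)
pose c := mdeg (mlead F); pose q := size es; pose E := (D + n * D).+1.
pose M := (c * E ^ n.-1 * q)%N; pose R := (D + n * M * D)%N.
have card_le : ((M.+1) ^ n <= c * R.+1 ^ n.-1 * q)%N.
  have -> : (M.+1 ^ n)%N = #|{: {ffun 'I_n -> 'I_M.+1}}| by rewrite card_ffun !card_ord.
  apply: leq_trans (_ : #|{: {f : {ffun 'I_n -> 'I_R.+1} | [exists i, f i < mlead F i]%N} * 'I_q}| <= _)%N.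
    pose y (fj : {f : {ffun 'I_n -> 'I_R.+1} | [exists i, f i < mlead F i]%N} * 'I_q) : S :=
      (\prod_i tnth t i ^+ val fj.1 i) * es`_(fj.2).
    have : forall f : {ffun 'I_n -> 'I_M.+1}, exists a : {f : {ffun 'I_n -> 'I_R.+1} | [exists i, f i < mlead F i]%N} * 'I_q -> k,
       \prod_i ('X_i : S) ^+ f i = \sum_fj a fj *: y fj.
      move=> f; pose u : 'X_{1..n} := [multinom (f i : nat) | i < n].
      have -> : \prod_i ('X_i : S) ^+ f i = 'X_[u].
        by rewrite mpolyXE_id; apply: eq_bigr => i _; rewrite mnmE.
      have [b bN ->] := hD u.
      have bR j : (j < q)%N -> reduced F R (b j \mPo t).
        move=> jq; apply: (reduced_comp F0 Ft); apply: leq_trans (bN _ jq) _.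
        rewrite leqW // leq_add2l leq_mul2r; apply/orP; right; rewrite mdegE.
        rewrite -[X in (_ <= X * _)%N]card_ord -sum1_card big_distrl /=; apply: leq_sum => i _.
        by rewrite mul1n mnmE -ltnS.
      have [a aP] := fin_all_exists (fun j : 'I_q => bR j (ltn_ord j)).
      exists (fun fj => a fj.2 fj.1).
      rewrite -(pair_bigA _ (fun f j => a j f *: y (f, j))) exchange_big.
      apply: eq_bigr => j _ /=; rewrite aP mulr_suml; apply: eq_bigr => g _.
      by rewrite -scalerAl.
    case/fin_all_exists => a aP.
    exact: free_family_card (@free_monomials M) aP.
  by rewrite card_prod card_ord leq_mul2r card_reduced orbT.
have RE : (R.+1 <= E * M.+1)%N.
  rewrite /R /E mulSn mulnS [(n * M * D)%N]mulnAC; move: (n * D)%N => x; nia.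
have [n0|n0] := posnP n.
  move: card_le; rewrite (_ : c = 0%N) ?mul0n ?leqn0 ?expn_eq0 //.
  by rewrite /c mdegE big1 // => i; have := ltn_ord i; rewrite {2}n0.
have : (M.+1 * M.+1 ^ n.-1 <= M * M.+1 ^ n.-1)%N.
  rewrite -expnS prednK //; apply: leq_trans card_le _.
  rewrite /M [leqRHS]mulnAC leq_mul2r; apply/orP; right.
  rewrite -mulnA leq_mul2l -expnMn; apply/orP; right.
  by case: (posnP n.-1) => [->|h]; rewrite ?expn0 ?leq_exp2r.
by rewrite leq_pmul2r ?expn_gt0 // ltnn.
Qed.

End Counting.

Lemma prod_count (R : comNzRingType) (I : eqType) (F : I -> R) (M K : seq I) :
  uniq M -> {subset K <= M} ->
  (\prod_(c <- K) F c = \prod_(c <- M) F c ^+ count_mem c K)%R.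
Proof.
move=> uM; elim: K => [|c K IH] KM; first by rewrite big_nil big1.
rewrite big_cons IH; last by move=> d dK; apply: KM; rewrite inE dK orbT.
have cM : c \in M by apply: KM; rewrite inE eqxx.
rewrite [in LHS](bigD1_seq c) //= [RHS](bigD1_seq c) //= eqxx exprS mulrA; congr (_ * _)%R.
by apply: eq_bigr => d dc; rewrite eq_sym (negPf dc).
Qed.

Section SpannedModule.
Local Open Scope ring_scope.
Variables (k : fieldType) (n : nat).
Local Notation S := {mpoly k[n]}.
Variables (t : n.-tuple S) (es : seq S).

Lemma spanned0 : spanned t es 0.
Proof. by exists (fun=> 0); rewrite big1 // => j _; rewrite comp_mpoly0 mul0r. Qed.

Lemma spannedD s s' : spanned t es s -> spanned t es s' -> spanned t es (s + s').
Proof.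
move=> [b ->] [b' ->]; exists (fun j => b j + b' j).
by rewrite -big_split; apply: eq_bigr => j _; rewrite rmorphD mulrDl.
Qed.

Lemma spannedM q s : spanned t es s -> spanned t es ((q \mPo t) * s).
Proof.
move=> [b ->]; exists (fun j => q * b j).
by rewrite mulr_sumr; apply: eq_bigr => j _; rewrite rmorphM mulrA.
Qed.

Lemma spanned_gen s : s \in es -> spanned t es s.
Proof.
move=> ses; exists (fun j => (j == index s es)%:R).
have h : (index s es < size es)%N by rewrite index_mem.
rewrite (bigD1 (Ordinal h)) //= eqxx rmorph1 mul1r nth_index // big1 ?addr0 // => j jh.
by rewrite (_ : (_ == _) = false) ?rmorph0 ?mul0r //; apply: contraNF jh => e; apply/eqP/val_inj/eqP.
Qed.

Lemma spanned_sum (I : eqType) (r : seq I) (E : I -> S) :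
  (forall i, i \in r -> spanned t es (E i)) -> spanned t es (\sum_(i <- r) E i).
Proof. by move=> h; rewrite big_seq; elim/big_ind: _ => //; [exact: spanned0|exact: spannedD]. Qed.

End SpannedModule.

(** * Spanning by monomials in the columns *)

Section ColumnSpan.
Local Open Scope ring_scope.
Variables (k : fieldType) (n p : nat) (z : 'I_n -> {mpoly k[n]}).
Local Notation S := {mpoly k[n]}.
Hypothesis chark : p \in [pchar k].
Hypothesis zspan : forall j, exists c : 'I_n -> k, 'X_j = \sum_i c i *: z i.
Local Notation column := ('I_n * nat)%type.
Local Notation zpow := (zpow p z).
Variables (C M : seq column) (e : 'I_n -> nat) (t : n.-tuple S) (gam : 'I_n -> column -> S).
Hypothesis uniqM : uniq M.
Hypothesis CM : forall c, (c.2 < e c.1)%N -> c \in M.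
Hypothesis tE : forall i, tnth t i = zpow (i, e i) - \sum_(c <- C) gam i c * zpow c.
Hypothesis gamP : forall i c, c \in C -> (exists q, gam i c = q \mPo t) /\
  (gam i c != 0 -> (pos c < pos (i, e i))%N).

Let p_pr : prime p. Proof. by case/andP: chark. Qed.

Let mon (f : {ffun 'I_(size M) -> 'I_p}) : S :=
  \prod_j zpow (tnth (in_tuple M) j) ^+ f j.
Let f0 : {ffun 'I_(size M) -> 'I_p} := [ffun=> Ordinal (prime_gt0 p_pr)].

(** The zero exponent [f0] comes first because [fixed_of_spanned] expects 1 at index 0. *)
Definition column_monomials : seq S := [seq mon f | f <- f0 :: rem f0 (enum {: {ffun 'I_(size M) -> 'I_p}})].

Lemma column_monomials0 : column_monomials`_0 = 1.
Proof. by rewrite /= /mon big1 // => j _; rewrite ffunE. Qed.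

Lemma size_column_monomials : size column_monomials = (p ^ size M)%N.
Proof.
rewrite size_map -(perm_size (perm_to_rem _)) ?mem_enum //.
by rewrite -cardE card_ffun !card_ord.
Qed.

Lemma mem_column_monomials f : mon f \in column_monomials.
Proof. by rewrite map_f // -(perm_mem (perm_to_rem _)) ?mem_enum. Qed.

Lemma pchar_expr_sum (I : Type) (r : seq I) (E : I -> S) b :
  (\sum_(i <- r) E i) ^+ (p ^ b) = \sum_(i <- r) E i ^+ (p ^ b).
Proof.
elim: r => [|i r IH]; last by rewrite !big_cons (pchar_exprD chark) IH.
by rewrite !big_nil expr0n expn_eq0 eqn0Ngt prime_gt0.
Qed.

(* Rewriting [zpow (i, a)] with [e i <= a] through [tnth t i] lowers [pos], and [p] *)
(* equal columns merge into the next one. *)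
Lemma spanned_columns K : spanned t column_monomials (\prod_(c <- K) zpow c).
Proof.
have [N] := ubnP (size K); elim: N K => // N IHs K.
have [q] := ubnP (posl K); elim: q K => // q IHp K Kq KN.
have [/hasP[c cK ce]|noe] := boolP (has (fun c : column => e c.1 <= c.2)%N K).
  pose b := (c.2 - e c.1)%N; pose K' := rem c K.
  have permK := perm_to_rem cK.
  have sK : size K = (size K').+1 by rewrite (perm_size permK).
  have cE : zpow c = (zpow (c.1, e c.1)) ^+ (p ^ b).
    by rewrite /zpow /wt /= -exprM -expnD subnKC.
  have xE : zpow (c.1, e c.1) = tnth t c.1 + \sum_(d <- C) gam c.1 d * zpow d.
    by rewrite tE subrK.
  rewrite (perm_big _ permK) big_cons /= cE xE (pchar_exprD chark) pchar_expr_sum mulrDl.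
  apply: spannedD.
    have -> : tnth t c.1 ^+ (p ^ b) = 'X_(c.1) ^+ (p ^ b) \mPo t.
      by rewrite rmorphXn /= comp_mpolyXU -tnth_nth.
    apply: spannedM; apply: IHs; by rewrite sK in KN.
  rewrite mulr_suml; apply: spanned_sum => d dC.
  have [[u ->] gd] := gamP c.1 dC; have [u0|/gd posd] := eqVneq (u \mPo t) 0.
    rewrite u0 mul0r expr0n expn_eq0 eqn0Ngt prime_gt0 //= mul0r; exact: spanned0.
  rewrite exprMn -rmorphXn -mulrA; apply: spannedM.
  have -> : zpow d ^+ (p ^ b) = zpow (d.1, d.2 + b)%N by rewrite /zpow /wt /= -exprM -expnD.
  rewrite -(big_cons _ _ _ _ xpredT) /=; apply: IHp; last by rewrite /= -sK.
  rewrite posl_cons; apply: leq_trans _ (Kq : (posl K <= q)%N).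
  rewrite /posl (perm_big _ permK) big_cons -/(posl K') ltn_add2r.
  move: posd ce; rewrite /pos /= => posd ce.
  by rewrite -[X in (_ < X * n + _)%N](subnKC ce) -/b !mulnDl ![(_ + b * n)%N]addnC -!addnA ltn_add2l.
have KM : {subset K <= M}.
  by move=> c cK; apply: CM; rewrite ltnNge; apply: contra noe => ce; apply/hasP; exists c.
have [/hasP[c cK cp]|nop] := boolP (has (fun c => p <= count_mem c K)%N K).
  have [K0 permK] := perm_nseq cp.
  have -> : \prod_(d <- K) zpow d = \prod_(d <- next c :: K0) zpow d.
    by rewrite (perm_big _ permK) big_cons big_cat big_nseq iter_mulr_1 zpow_next.
  apply: IHs; apply: leq_trans (KN : (size K <= N)%N).
  by rewrite (perm_size permK) size_cat size_nseq /= -[X in (X < _)%N]add1n ltn_add2r prime_gt1.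
rewrite (prod_count zpow uniqM KM) big_tnth.
have cp j : (count_mem (tnth (in_tuple M) j) K < p)%N.
  rewrite ltnNge; apply: contra nop => h; apply/hasP; exists (tnth (in_tuple M) j) => //.
  by rewrite -has_pred1 has_count; apply: leq_trans h; rewrite prime_gt0.
have -> : \prod_j zpow (tnth (in_tuple M) j) ^+ count_mem (tnth (in_tuple M) j) K
   = mon [ffun j => Ordinal (cp j)] by apply: eq_bigr => j _; rewrite ffunE.
exact/spanned_gen/mem_column_monomials.
Qed.

Lemma spanned_all s : spanned t column_monomials s.
Proof.
have [r ->] := coord_monomials zspan s; apply: spanned_sum => u _.
rewrite -mul_mpolyC -(comp_mpolyC _ t); apply: spannedM.
have -> : \prod_(i <- u.2) z i = \prod_(c <- [seq (i, 0%N) | i <- u.2]) zpow c.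
  by rewrite big_map.
exact: spanned_columns.
Qed.

End ColumnSpan.

(** * Polynomial invariants of the transvection group *)

Section TransvectionInvariants.
Local Open Scope ring_scope.
Variables (k : fieldType) (n : nat) (gT : finGroupType) (G T : {group gT}).
Local Notation S := {mpoly k[n]}.
Variable act : gT -> {lrmorphism S -> S}.
Hypothesis actG : graded_action G act.
Local Notation fixed := (fixed act).
Hypothesis sTG : T \subset G.
Hypothesis abT : abelian T.
Variables (z : 'I_n -> S) (isw isy : pred 'I_n).
Hypothesis z1 : forall i, z i \is 1.-homog.
Hypothesis zspan : forall j, exists c : 'I_n -> k, 'X_j = \sum_i c i *: z i.
Hypothesis zmap : forall v : 'I_n -> S, exists t : n.-tuple S, forall i, z i \mPo t = v i.
Hypothesis isyNw : forall i, isy i -> ~~ isw i.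
Hypothesis act_w : forall i g, isw i -> g \in T -> act g (z i) = z i.
Hypothesis act_y : forall i g, isy i -> g \in T -> act g (z i) = z i.
Hypothesis act_x : forall i g, ~~ isw i -> g \in T ->
  exists c : 'I_n -> k, act g (z i) - z i = \sum_(j | isy j) c j *: z j.
Variable eps : {lrmorphism S -> S}.
Hypothesis epsP : forall i, eps (z i) = if ~~ isw i then z i else 0.
Variable ls : seq S.
Hypothesis lsP : forall l, l \in ls -> l != 0 /\ yspan z isy l.
Hypothesis transfer_dvd : forall s, exists r, \sum_(g in T) act g s = \prod_(l <- ls) l * r.
Hypothesis transfer_hit : exists a, \sum_(g in T) act g a = \prod_(l <- ls) l.

Let TG g : g \in T -> g \in G. Proof. exact: (subsetP sTG). Qed.

Lemma transvection_move i g : g \in T -> yspan z isy (act g (z i) - z i).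
Proof.
move=> gT'; have [iw|iw] := boolP (isw i); last exact: act_x.
by exists (fun=> 0); rewrite act_w // subrr big1 // => j _; rewrite scale0r.
Qed.

Lemma yspan_fixedT s : yspan z isy s -> s \in fixed T.
Proof.
move=> [c ->]; rewrite rpred_sum // => j jy; rewrite fixed_scale //.
by apply/fixedP => g gG; rewrite act_y.
Qed.

Lemma transvectionX i g m : g \in T -> act (g ^+ m)%g (z i) = z i + (act g (z i) - z i) *+ m.
Proof.
move=> gT'; elim: m => [|m IH]; first by rewrite expg0 (graded_act1 actG) addr0.
rewrite expgS (graded_actM actG) ?TG ?groupX // IH rmorphD rmorphMn /=.
have /fixedP -> // := yspan_fixedT (transvection_move i gT').
by rewrite mulrS addrA addrCA subrr addr0.
Qed.

(** Displacements are fixed, so [g ^+ m] displaces by m times the displacement of [g]. The order of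
    a nontrivial element thus vanishes in [k], which has a characteristic p, and then p-th powers
    are trivial. *)
Lemma transvections_abelem : T != 1%g :> {set gT} -> exists2 p, p \in [pchar k] & p.-abelem%g T.
Proof.
move=> /trivgPn[g gT' g1].
have [i gi] : exists i, act g (z i) - z i != 0.
  apply: NNPP => ne; case/eqP: g1; apply: (graded_act_faithful actG); rewrite ?TG // => j.
  apply: (lrmorph_coord_ext zspan) => i; rewrite (graded_act1 actG).
  by apply/eqP; rewrite -subr_eq0; apply/negPn/negP => h; apply: ne; exists i.
have gz : (#[g]%g)%:R == 0 :> k.
  have /eqP := transvectionX i #[g]%g gT'; rewrite expg_order (graded_act1 actG).
  rewrite -subr_eq0 opprD addrA subrr sub0r oppr_eq0 -scaler_nat scaler_eq0 (negPf gi) orbF.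
  by [].
have [p pk] := natf0_pchar (order_gt0 g) gz; exists p => //.
have p_pr : prime p by case/andP: pk.
rewrite abelemE // abT; apply/exponentP => h hT.
apply: (graded_act_faithful actG); rewrite ?groupX ?TG // => j.
apply: (lrmorph_coord_ext zspan) => l.
rewrite transvectionX // (graded_act1 actG) -scaler_nat (pcharf0 pk) scale0r addr0.
by [].
Qed.

Definition polynomial_in (t : n.-tuple S) s := exists q : S, s = q \mPo t.

Lemma transvection_invariants : exists t : n.-tuple S,
  [/\ forall i, tnth t i \in fixed T /\ exists d, tnth t i \is d.-homog,
      forall i, if isw i then tnth t i = z i else eps (tnth t i) = tnth t i,
      forall s, s \in fixed T -> polynomial_in t s
    & forall q, q \mPo t = 0 -> q = 0].
Proof.
have [T1|ntT] := eqVneq (T : {set gT}) 1%g.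
  exists [tuple z i | i < n]; have tE i : tnth [tuple z i | i < n] i = z i by rewrite tnth_mktuple.
  have gen s : polynomial_in [tuple z i | i < n] s.
    elim/(coord_ind zspan): s => [c|i|s t [q ->] [q' ->]|s t [q ->] [q' ->]].
    - by exists c%:MP; rewrite comp_mpolyC.
    - by exists 'X_i; rewrite comp_mpolyXU -tnth_nth tE.
    - by exists (q + q'); rewrite rmorphD.
    - by exists (q * q'); rewrite rmorphM.
  split=> [i|i|s _|q].
  - rewrite tE; split; last by exists 1%N.
    by apply/fixedP => g; rewrite T1 => /set1gP->; rewrite (graded_act1 actG).
  - by case: ifP => iw; rewrite tE // epsP iw.
  - exact: gen.
  apply: (@alg_independent_of_spanned _ _ _ [:: 1]) => s; have [r ->] := gen s.
  by exists (fun=> r); rewrite big_ord1 /= mulr1.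
have [p chark abelT] := transvections_abelem ntT.
have [epsy epsyP] := exists_retract zmap isy.
have epsy_yspan s : yspan z isy s -> epsy s = s by move=> [c ->]; apply: retract_span epsyP c.
have epsy_fixed s : epsy s \in fixed T.
  apply/fixedP => g gT'; apply: (lrmorph_coord_ext zspan (phi := act g \o epsy) (psi := epsy)) => i /=.
  by rewrite epsyP; case: ifP => iy; rewrite ?rmorph0 ?act_y.
have L0 : \prod_(l <- ls) l != 0.
  by rewrite prodf_seq_neq0; apply/allP => l /lsP[].
have LN : \prod_(l <- ls) l \is (size ls).-homog.
  have : forall l, l \in ls -> l \is 1.-homog.
    by move=> l /lsP[_ [c ->]]; rewrite rpred_sum // => j _; rewrite rpredZ ?z1.
  elim: (ls) => [|l r IH] h /=; first by rewrite big_nil dhomog1.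
  rewrite big_cons -add1n dhomogM ?h ?inE ?eqxx // IH // => x xr.
  by apply: h; rewrite inE xr orbT.
have epsyL : epsy (\prod_(l <- ls) l) = \prod_(l <- ls) l.
  rewrite rmorph_prod /= !big_seq; apply: eq_bigr => l /lsP[_ ly]; exact: epsy_yspan.
have [C [uC sC Cnz CP]] := exists_column_basis actG sTG abelT ntT chark z1 zspan
  (fun i t tT => yspan_fixedT (transvection_move i tT)) (retract_idem zspan epsyP)
  (retract_graded z1 zspan epsyP) (fun i t tT => epsy_yspan _ (transvection_move i tT))
  epsy_fixed L0 LN epsyL transfer_dvd transfer_hit.
(* The exponent of the leading term of the generator [i] is the first level at which its columns
   leave the finite list [C]; the lower ones all belong to [C]. *)
have exE (i : 'I_n) : exists a : nat, (i, a) \notin C /\ forall b, (b < a)%N -> (i, b) \in C.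
  have ex : exists a, (i, a) \notin C.
    apply: NNPP => ne; have sub : {subset [seq (i, a) | a <- iota 0 (size C).+1] <= C}.
      by move=> _ /mapP[a _ ->]; apply/negPn/negP => h; apply: ne; exists a.
    have u : uniq [seq (i, a) | a <- iota 0 (size C).+1].
      by rewrite map_inj_uniq ?iota_uniq // => a b [].
    by have := uniq_leq_size u sub; rewrite size_map size_iota ltnn.
  exists (ex_minn ex); case: ex_minnP => a aC amin; split=> // b; rewrite ltnNge.
  by apply: contraR => /amin.
have [e eP] := fin_all_exists exE.
have [P PP] := fin_all_exists (fun i => CP _ (proj1 (eP i))).
have gamE i : exists gam : 'I_n * nat -> S, P i = zpow p z (i, e i) - \sum_(c <- C) gam c * zpow p z c /\
   forall c, c \in C -> epsy (gam c) = gam c /\ (gam c != 0 -> (pos c < pos (i, e i))%N).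
  by case: (PP i).
have [gam gamP] := fin_all_exists gamE.
(* Columns in [C] are nonzero functions, so a coordinate fixed by [T] has none there: its generator
   is the coordinate itself, and no w enters a correction term. *)
have still i a : (forall t, t \in T -> act t (z i) = z i) -> (i, a) \notin C.
  move=> h; apply/negP => /Cnz[t tT]; rewrite /zdiff h // subrr expr0n expn_eq0.
  by rewrite eqn0Ngt prime_gt0 ?eqxx //; case/andP: chark.
have Pstill i : (forall t, t \in T -> act t (z i) = z i) -> P i = z i.
  move=> h; have e0 : e i = 0%N.
    by case: (posnP (e i)) => // /(proj2 (eP i)); rewrite (negPf (still _ _ h)).
  have [_ _ _ ->] := PP i; first by rewrite e0 /zpow /wt expn0 expr1.
  move=> t tT; rewrite /zdiff h // subrr expr0n expn_eq0.
  by rewrite eqn0Ngt prime_gt0 ?eqxx //; case/andP: chark.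
pose t := [tuple P i | i < n]; have tE i : tnth t i = P i by rewrite tnth_mktuple.
have epsy_poly s : polynomial_in t (epsy s).
  elim/(coord_ind zspan): s => [c|i|s s' [q e1] [q' e2]|s s' [q e1] [q' e2]].
  - by exists c%:MP; rewrite comp_mpolyC lrmorph_mpolyC.
  - rewrite epsyP; case: ifP => iy; last by exists 0; rewrite comp_mpoly0.
    by exists 'X_i; rewrite comp_mpolyXU -tnth_nth tE Pstill // => g; apply: act_y.
  - by exists (q + q'); rewrite !rmorphD /= e1 e2.
  - by exists (q * q'); rewrite !rmorphM /= e1 e2.
have spanP s : spanned t (column_monomials z chark C) s.
  apply: (@spanned_all _ _ _ _ chark zspan C C e t gam uC) s => [[i a]|i|i c cC] /=.
  - exact: (proj2 (eP i)).
  - by rewrite tE (proj1 (gamP i)).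
  have [<- h] := proj2 (gamP i) c cC; split; first exact: epsy_poly.
  exact: h.
have sizeM : (size (column_monomials z chark C) <= #|T|)%N.
  by rewrite size_column_monomials sC -(card_abelem_dim abelT ntT chark).
exists t; split=> [i|i|s|q].
- by rewrite tE; have [PT Ph _ _] := PP i; split=> //; exists (wt p (i, e i)).
- rewrite tE; case: ifP => iw; first by rewrite Pstill // => g; apply: act_w.
  have [-> gP] := gamP i; rewrite rmorphB rmorph_sum /= rmorphXn /= epsP iw; congr (_ - _).
  apply: eq_big_seq => c cC; have [<- _] := gP c cC; rewrite rmorphM /=; congr (_ * _).
    apply: (lrmorph_coord_ext zspan (phi := eps \o epsy) (psi := epsy)) => j /=.
    by rewrite epsyP; case: ifP => jy; rewrite ?rmorph0 // epsP isyNw.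
  rewrite rmorphXn /= epsP; case: ifP => // /negbFE cw.
  by have := still c.1 c.2 (fun g => act_w cw); rewrite -surjective_pairing cC.
- apply: (fixed_of_spanned actG sTG _ (column_monomials0 z chark C) sizeM spanP) => i.
  by rewrite tE; case: (PP i).
exact: alg_independent_of_spanned spanP q.
Qed.

End TransvectionInvariants.

(** * From the transvections to the whole group *)

Section PowerSubstitution.
Local Open Scope ring_scope.
Variables (k : fieldType) (n : nat) (m : 'I_n -> nat).
Local Notation S := {mpoly k[n]}.

Lemma power_substitution_inj (q : S) : (forall i, 0 < m i)%N ->
  q \mPo [tuple ('X_i : S) ^+ m i | i < n] = 0 -> q = 0.
Proof.
move=> m0 e; apply/mpolyP => v; rewrite mcoeff0.
pose mu (u : 'X_{1..n}) : 'X_{1..n} := [multinom (m i * u i)%N | i < n].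
move: e; rewrite {1}(mpolyE q) linear_sum /= => e.
have := congr1 (fun p : S => p@_(mu v)) e; rewrite linear_sum mcoeff0 /=.
have term u : (q@_u *: 'X_[u] \mPo [tuple ('X_i : S) ^+ m i | i < n])@_(mu v) = q@_u *+ (u == v).
  rewrite linearZ mcoeffZ /= comp_mpolyX.
  under eq_bigr do rewrite tnth_mktuple -exprM.
  have -> : \prod_i ('X_i : S) ^+ (m i * u i) = 'X_[mu u].
    by rewrite mpolyXE_id; apply: eq_bigr => i _; rewrite mnmE.
  rewrite mcoeffX -[RHS]mulr_natr; congr (_ * (nat_of_bool _)%:R); apply/eqP/eqP => [h|-> //].
  apply/mnmP => i; have := congr1 (fun w : 'X_{1..n} => w i) h.
  by rewrite !mnmE => /eqP; rewrite eqn_pmul2l // => /eqP.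
under eq_bigr do rewrite term.
have [vq|vq] := boolP (v \in msupp q); last by move=> _; rewrite memN_msupp_eq0.
rewrite (bigD1_seq v) ?msupp_uniq //= eqxx big1 ?addr0 // => u /negPf->.
by rewrite mulr0n.
Qed.

End PowerSubstitution.

(** * Invariants of a diagonal action generated by reflections *)

Section DiagonalInvariants.
Local Open Scope ring_scope.
Variables (k : fieldType) (n : nat) (gT : finGroupType) (G : {group gT}).
Local Notation S := {mpoly k[n]}.
Variable act : gT -> {lrmorphism S -> S}.
Hypothesis actG : graded_action G act.
Local Notation fixed := (fixed act).
Variable Refl : {set gT}.
Hypothesis G_gen : <<Refl>>%g = G.
Variable t : n.-tuple S.
Hypothesis t_homog : forall i, exists d, tnth t i \is d.-homog.
Hypothesis t_indep : forall q : S, q \mPo t = 0 -> q = 0.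
Hypothesis t_gen : forall s, s \in fixed G -> polynomial_in t s.
Hypothesis t_char : forall i g, g \in G -> exists c, act g (tnth t i) = c *: tnth t i.
Hypothesis Refl_one : forall r i j, r \in Refl -> act r (tnth t i) != tnth t i -> j != i ->
  act r (tnth t j) = tnth t j.

(** By independence of [t], an invariant involves only monomials of trivial character. The powers
    taken are the orders [m i] of the characters [chi i]. *)
Lemma diagonal_invariants : exists f : n.-tuple S,
  [/\ forall i, tnth f i \in fixed G, forall i, exists d, tnth f i \is d.-homog,
      forall q, q \mPo f = 0 -> q = 0 & forall s, s \in fixed G -> polynomial_in f s].
Proof.
have t0 i : tnth t i != 0.
  apply/eqP => h; have /eqP : 'X_i = 0 :> S by apply: t_indep; rewrite comp_mpolyXU -tnth_nth.
  by rewrite -msupp_eq0 msuppX.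
have [chi chiP] : exists chi : 'I_n -> gT -> k,
    forall i g, g \in G -> act g (tnth t i) = chi i g *: tnth t i.
  apply: (fin_all_exists (P := fun i (c : gT -> k) => forall g, g \in G -> act g (tnth t i) = c g *: tnth t i)) => i.
  apply: (fin_all_exists (P := fun g c => g \in G -> act g (tnth t i) = c *: tnth t i)) => g.
  by case: (boolP (g \in G)) => [/(t_char i)[c h]|_]; [exists c | exists 0].
have tI i c d : c *: tnth t i = d *: tnth t i -> c = d.
  by move=> /eqP; rewrite -subr_eq0 -scalerBl scaler_eq0 (negPf (t0 i)) orbF subr_eq0 => /eqP.
have chi1 i : chi i 1%g = 1.
  by apply: (tI i); rewrite -chiP // (graded_act1 actG) scale1r.
have chiM i g h : g \in G -> h \in G -> chi i (g * h)%g = chi i g * chi i h.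
  move=> gG hG; apply: (tI i); rewrite -chiP ?groupM // (graded_actM actG) // !chiP //.
  by rewrite linearZ /= chiP // scalerA mulrC.
have chiX i g e : g \in G -> chi i (g ^+ e)%g = chi i g ^+ e.
  by move=> gG; elim: e => [|e IH]; rewrite ?expg0 ?chi1 // expgS chiM ?groupX // IH exprS.
have exm i : exists m, (0 < m)%N && [forall g in G, chi i g ^+ m == 1].
  exists #|G|; rewrite cardG_gt0; apply/forall_inP => g gG.
  by rewrite -chiX // expg_cardG // chi1.
pose m i := ex_minn (exm i).
have mP i : [/\ (0 < m i)%N, forall g, g \in G -> chi i g ^+ m i = 1 &
    forall e, (forall g, g \in G -> chi i g ^+ e = 1) -> (m i %| e)%N].
  rewrite /m; case: ex_minnP => d /andP[d0 /forall_inP dG] dmin; split=> // [g /dG/eqP //|e eG].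
  have : ~~ (0 < e %% d)%N.
    apply/negP => ed; have := ltn_pmod e d0; rewrite ltnNge dmin // ed; apply/forall_inP => g gG.
    have := eG g gG; rewrite {1}(divn_eq e d) exprD mulnC exprM (eqP (dG g gG)) expr1n mul1r.
    by move/eqP.
  by rewrite -eqn0Ngt.
have act_mon g (u : 'X_{1..n}) : g \in G ->
    act g ('X_[u] \mPo t) = (\prod_i chi i g ^+ u i) *: ('X_[u] \mPo t).
  move=> gG; rewrite comp_mpolyX rmorph_prod /= -scaler_prod.
  by apply: eq_bigr => i _; rewrite rmorphXn /= chiP // exprZn.
pose f := [tuple tnth t i ^+ m i | i < n].
have fE i : tnth f i = tnth t i ^+ m i by rewrite tnth_mktuple.
exists f; split=> [i|i|q|s sG].
- apply/fixedP => g gG; rewrite fE rmorphXn /= chiP // exprZn.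
  by have [_ -> // _] := mP i; rewrite scale1r.
- by have [d h] := t_homog i; exists (d * m i)%N; rewrite fE dhomogMn.
- move=> qf; apply: (power_substitution_inj (m := m)) => [i|]; first by case: (mP i).
  apply: t_indep; rewrite -qf.
  elim/mpoly_alg_ind: q {qf} => [c|i|p q hp hq|p q hp hq].
  + by rewrite !comp_mpolyC.
  + by rewrite !comp_mpolyXU -!tnth_nth fE tnth_mktuple rmorphXn /= comp_mpolyXU -tnth_nth.
  + by rewrite !rmorphD /= hp hq.
  + by rewrite !rmorphM /= hp hq.
have [q sq] := t_gen sG.
have coefq g u : g \in G -> u \in msupp q -> \prod_i chi i g ^+ u i = 1.
  move=> gG uq.
  have : q = \sum_(v <- msupp q) (q@_v * \prod_i chi i g ^+ v i) *: 'X_[v].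
    apply/eqP; rewrite -subr_eq0; apply/eqP/t_indep.
    have /fixedP/(_ g gG) := sG; rewrite sq => h.
    have e : act g (q \mPo t) = \sum_(v <- msupp q) (q@_v * \prod_i chi i g ^+ v i) *: ('X_[v] \mPo t).
      rewrite {1}(mpolyE q) [X in act g X]linear_sum [LHS]linear_sum; apply: eq_bigr => v _ /=.
      by rewrite !linearZ /= act_mon // scalerA.
    rewrite linearB /= -[X in X - _]h e [X in _ - X]linear_sum -sumrB big1 // => v _.
    by rewrite /= linearZ subrr.
  move/(congr1 (fun p : S => p@_u)); rewrite linear_sum (bigD1_seq u) ?msupp_uniq //=.
  rewrite [X in _ + X]big1 => [|v vu]; last by rewrite mcoeffZ mcoeffX (negPf vu) mulr0.
  rewrite addr0 mcoeffZ mcoeffX eqxx mulr1 -{1}[q@_u]mulr1 => /mulfI h.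
  by rewrite -h // -?mcoeff_msupp.
(* A generator with [chi i r != 1] moves only the i-th element of [t], so triviality of the whole
   character at [r] is triviality of [chi i r ^+ u i]. *)
have mu u i : u \in msupp q -> (m i %| u i)%N.
  move=> uq; have [_ _ h] := mP i; apply: h => g; rewrite -G_gen; move: g.
  apply: gen_ind => [|r g rR gG IH]; first by rewrite chi1 expr1n.
  have rG : r \in G by rewrite -G_gen mem_gen.
  rewrite G_gen in gG; rewrite chiM // exprMn IH mulr1.
  have [->|c1] := eqVneq (chi i r) 1; first by rewrite expr1n.
  rewrite -(coefq r u rG uq) (bigD1 i) //= big1 ?mulr1 // => j ji.
  rewrite (_ : chi j r = 1) ?expr1n //; apply: (tI j); rewrite -chiP // scale1r.
  apply: (Refl_one rR (i := i)) => //; rewrite chiP //; apply: contraNneq c1 => e.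
  by apply/eqP/(tI i); rewrite scale1r.
exists (\sum_(u <- msupp q) q@_u *: 'X_[[multinom (u i %/ m i)%N | i < n]]).
rewrite sq {1}(mpolyE q) [LHS]linear_sum [RHS]linear_sum; apply: eq_big_seq => u uq /=.
rewrite !linearZ /= !comp_mpolyX; congr (_ *: _); apply: eq_bigr => i _.
by rewrite mnmE fE -exprM mulnC divnK // mu.
Qed.

End DiagonalInvariants.

Section Backward.
Local Open Scope ring_scope.
Variables (k : fieldType) (n : nat) (gT : finGroupType) (G : {group gT}).
Local Notation S := {mpoly k[n]}.
Variable act : gT -> {lrmorphism S -> S}.
Hypothesis actG : graded_action G act.
Hypothesis abG : abelian G.
Local Notation fixed := (fixed act).
Variable Refl : {set gT}.
Hypothesis G_gen : <<Refl>>%g = G.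
Hypothesis ReflP : forall r, r \in Refl ->
  exists2 l, l \is 1.-homog /\ l != 0 & forall i, exists c, act r 'X_i - 'X_i = c *: l.
Variable pi : S -> S.
Hypothesis pi_fixed : forall s, pi s \in fixed G.
Hypothesis pi_lin : forall c s t, c \in fixed G -> pi (c * s + t) = c * pi s + pi t.
Hypothesis pi_onto : forall a, a \in fixed G -> exists s, pi s = a.
Hypothesis pi_homog : forall d s, s \is d.-homog -> pi s \is d.-homog.

(** By gradedness [pi 1] is a constant, and only the constant term of a preimage of 1 contributes to
    degree 0; so [pi 1] cannot be 0. *)
Lemma retraction_one : exists2 kappa, kappa != 0 & pi 1 = kappa%:MP.
Proof.
have piD s t : pi (s + t) = pi s + pi t by have := pi_lin s t (rpred1 _); rewrite !mul1r.
have pi0 : pi 0 = 0.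
  by have /eqP := piD 0 0; rewrite addr0 -subr_eq0 opprD addrA subrr sub0r oppr_eq0 => /eqP.
have e := dhomog0E (pi_homog (dhomog1 _ _)).
exists ((pi 1)@_0) => //; apply/eqP => h; have pi1 : pi 1 = 0 by rewrite e h.
have [s s1] := pi_onto (rpred1 (fixed G)).
have : pihomog mdeg 0 (1 : S) = 0; last first.
  by rewrite (pihomog_dE (dhomog1 _ _)) => /eqP; rewrite oner_eq0.
rewrite -s1 (pihomog_partitionE (leqnn (msize s))).
elim/big_ind: _ => [|u v hu hv|d _]; first by rewrite pi0 linear0.
  by rewrite piD linearD /= hu hv addr0.
case: (posnP d) => [->|d0].
  rewrite (pihomog0E s) -[_%:MP]mulr1 -[_ * 1]addr0 pi_lin ?fixed_const //.
  by rewrite pi1 pi0 mulr0 addr0 linear0.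
by apply: pihomog_ne0 (pi_homog (pihomogP mdeg d s)); rewrite -lt0n.
Qed.

Theorem polynomial_invariants : exists f : n.-tuple S,
  [/\ forall i, tnth f i \in fixed G, forall i, exists d, tnth f i \is d.-homog,
      forall q, q \mPo f = 0 -> q = 0 & forall s, s \in fixed G -> polynomial_in f s].
Proof.
have [kappa kappa0 pi1] := retraction_one.
have [z [isw [isy [z1 zmap zspan [act_w isyNw act_y act_x]]]]] := adapted_basis actG abG G_gen ReflP.
have [eps epsP] := exists_retract zmap (predC isw).
have [ls [lsP ls_dvd ls_hit]] := transfer_divisor actG G_gen ReflP z1 zmap zspan act_w isyNw
  act_y act_x epsP pi_fixed pi_lin kappa0 pi1.
pose T := transvection_group actG z isw.
have sTG : T \subset G := transvection_sub actG z isw.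
have TG g : g \in T -> g \in G by exact: subsetP sTG g.
have act_wT i g : isw i -> g \in T -> act g (z i) = z i.
  by move=> iw /transvectionP[_]; apply.
have [t [tT tE t_gen t_indep]] := transvection_invariants actG sTG (abelianS sTG abG) z1 zspan
  zmap isyNw act_wT (fun i g iy gT' => act_y i g iy (TG g gT'))
  (fun i g iw gT' => act_x i g iw (TG g gT')) epsP lsP ls_dvd ls_hit.
have t_fixed i : ~~ isw i -> tnth t i \in fixed G.
  move=> iw; have := tE i; rewrite (negPf iw) => e.
  exact: (eps_fixed G_gen ReflP z1 zmap zspan act_w isyNw act_x epsP e (tT i).1).
apply: (diagonal_invariants actG G_gen (t := t)) => //.
- by move=> i; case: (tT i).
- move=> s sG; apply: t_gen; apply/fixedP => g gT'; have /fixedP -> // := sG; exact: TG.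
- move=> i g gG; have [iw|iw] := boolP (isw i).
    by have := tE i; rewrite iw => ->; apply: act_w.
  by exists 1; rewrite scale1r; have /fixedP -> := t_fixed i iw.
move=> r i j rR; have rG : r \in G by rewrite -G_gen mem_gen.
have [iw|iw] := boolP (isw i); last by have /fixedP -> // := t_fixed i iw; rewrite eqxx.
have := tE i; rewrite iw => -> ri ji; have [jw|jw] := boolP (isw j).
  by have := tE j; rewrite jw => ->; apply: (reflection_moves_one G_gen ReflP z1 zmap act_w isyNw act_x rR iw).
by have /fixedP -> := t_fixed j jw.
Qed.

End Backward.

(** * Linear actions on a vector space *)

Section LinearAction.
Local Open Scope ring_scope.
Variables (k : fieldType) (V : vectType k).
Local Notation n := (\dim {:V}).
Local Notation S := {mpoly k[n]}.
Variables (gT : finGroupType) (G : {group gT}) (rho : gT -> 'End(V)).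
Hypothesis rhoG : faithful_linear_action G rho.

Definition coord_aut (g : gT) : {lrmorphism S -> S} :=
  comp_mpoly [tuple linear_form (coord_form i \o rho g^-1%g)%VF | i < n].

Lemma coord_autE g s : coord_aut g s = coord_act rho g s. Proof. by []. Qed.

Lemma coord_formE i (v : V) : coord_form i v = coord (vbasis {:V}) i v.
Proof. by rewrite lfunE. Qed.

Lemma linear_form_coord i : linear_form (coord_form i) = 'X_i :> S.
Proof.
rewrite /linear_form (bigD1 i) //= coord_formE coord_free ?(basis_free (vbasisP _)) // eqxx scale1r.
rewrite big1 ?addr0 // => j ji; rewrite coord_formE coord_free ?(basis_free (vbasisP _)) //.
by rewrite (negPf ji) scale0r.
Qed.

Lemma linear_form_homog (phi : 'Hom(V, k^o)) : linear_form phi \is (1%N).-homog.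
Proof. by rewrite rpred_sum // => i _; rewrite rpredZ ?dhomog_var. Qed.

Lemma linear_form_eq (phi : 'Hom(V, k^o)) : linear_form phi = 0 :> S -> phi = 0.
Proof.
by move=> h; apply/lfunP => v; rewrite -linear_form_eval h rmorph0 lfunE.
Qed.

Lemma vbasis_ext (u v : V) :
  (forall i, coord (vbasis {:V}) i u = coord (vbasis {:V}) i v) -> u = v.
Proof.
move=> h; rewrite (coord_vbasis (memvf u)) (coord_vbasis (memvf v)).
by apply: eq_bigr => i _; rewrite h.
Qed.

Lemma coord_aut_var g i : coord_aut g 'X_i = linear_form (coord_form i \o rho g^-1%g)%VF.
Proof. by rewrite /= comp_mpolyXU -tnth_nth tnth_mktuple. Qed.

Lemma coord_aut_graded : graded_action G coord_aut.
Proof.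
case: rhoG => rho1 rhoM rho_inj; split=> [s|g h gG hG s|g i|g gG h].
- apply: (lrmorph_ext (psi := idfun)) => i /=.
  rewrite -/(coord_aut 1%g _) coord_aut_var invg1 rho1 comp_lfun1r.
  exact: linear_form_coord.
- apply: (lrmorph_ext (phi := coord_aut (g * h)%g) (psi := coord_aut g \o coord_aut h)) => i.
  rewrite /= -!/(coord_aut _ _) !coord_aut_var coord_autE coord_act_linear_form.
  by rewrite invMg rhoM ?groupV // comp_lfunA.
- rewrite coord_aut_var; exact: linear_form_homog.
have e : rho g^-1%g = rho 1%g.
  apply/lfunP => v; apply: vbasis_ext => i.
  have := coord_act_eval rho g 'X_i v; rewrite -coord_autE h !mevalXU => <-.
  by rewrite rho1 lfunE.
by have /eqP := rho_inj _ _ (groupVr gG) (group1 G) e; rewrite eq_invg1 => /eqP.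
Qed.

Lemma fixedSpaceV g : g \in G -> fixedSpace (rho g^-1%g) = fixedSpace (rho g).
Proof.
case: rhoG => rho1 rhoM _; suff sub h : h \in G -> (fixedSpace (rho h) <= fixedSpace (rho h^-1%g))%VS.
  move=> gG; apply/eqP; rewrite eqEsubv sub // andbT -{2}[g]invgK sub ?groupV //.
move=> hG; apply/subvP => v /fixedSpaceP hv; apply/fixedSpaceP.
by rewrite -{1}hv -comp_lfunE -rhoM ?groupV // mulVg rho1 lfunE.
Qed.

(** All the displacements [psi i] vanish on the fixed hyperplane, so each is determined by its value
    at one vector [v0] outside it. They are multiples of any one that is nonzero there. *)
Lemma pseudo_reflection_form r : r \in G -> pseudo_reflection (rho r) ->
  exists2 l, l \is (1%N).-homog /\ l != 0 & forall i, exists c, coord_aut r 'X_i - 'X_i = c *: l.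
Proof.
move=> rG /eqP rP; pose F := fixedSpace (rho r).
have [v0 v0F] : exists v0, v0 \notin F.
  apply: NNPP => ne; have /eqP : F = fullv.
    apply/eqP; rewrite eqEsubv subvf; apply/subvP => v _.
    by apply/negPn/negP => h; apply: ne; exists v.
  by rewrite eqEdim subvf /= -rP ltnn.
have FV v : exists u c, u \in F /\ v = u + c *: v0.
  have : (F + <[v0]>)%VS = fullv.
    have v00 : v0 != 0 by apply: contraNneq v0F => ->; apply: mem0v.
    apply/eqP; rewrite eqEdim subvf /= -rP dimv_disjoint_sum ?dim_vline ?v00 ?addn1 //.
    apply/eqP; rewrite -subv0; apply/subvP => u; rewrite memv_cap memv0 => /andP[uF /vlineP[c e]].
    have [c0|c0] := eqVneq c 0; first by rewrite e c0 scale0r.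
    case/negP: v0F; have -> : v0 = c^-1 *: u by rewrite e scalerA mulVf // scale1r.
    exact: memvZ.
  move=> e; have : v \in (F + <[v0]>)%VS by rewrite e memvf.
  by case/memv_addP => u uF [w /vlineP[c ->] ->]; exists u, c.
pose psi i : 'Hom(V, k^o) := (coord_form i \o rho r^-1%g - coord_form i)%VF.
have psiE i v : psi i v = coord (vbasis {:V}) i (rho r^-1%g v) - coord (vbasis {:V}) i v.
  by rewrite add_lfunE opp_lfunE comp_lfunE !coord_formE.
have psiF i u : u \in F -> psi i u = 0.
  rewrite -[F]fixedSpaceV // => /fixedSpaceP e.
  by rewrite psiE e subrr.
have psiX i : coord_aut r 'X_i - 'X_i = linear_form (psi i).
  rewrite coord_aut_var -linear_form_coord /linear_form -sumrB.
  by apply: eq_bigr => j _; rewrite -scalerBl add_lfunE opp_lfunE.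
have psi_v0 i v c u : u \in F -> v = u + c *: v0 -> psi i v = c * psi i v0.
  by move=> uF ->; rewrite linearD linearZ /= psiF // add0r.
have [i0 i0P] : exists i, psi i v0 != 0.
  apply: NNPP => ne; case/negP: v0F; rewrite -[F]fixedSpaceV //; apply/fixedSpaceP.
  apply: vbasis_ext => i; apply/eqP; rewrite -subr_eq0; apply/negPn/negP => h; apply: ne.
  by exists i; rewrite psiE.
exists (linear_form (psi i0)); first split; first exact: linear_form_homog.
  by apply: contraNneq i0P => /linear_form_eq ->; rewrite lfunE.
move=> i; exists (psi i v0 / psi i0 v0); rewrite psiX /linear_form scaler_sumr.
apply: eq_bigr => j _; rewrite scalerA; congr (_ *: _).
have [u [c [uF e]]] := FV (vbasis {:V})`_j.
rewrite !(psi_v0 _ _ _ _ uF e) [c * _ in RHS]mulrC mulrA divfK // mulrC.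
by [].
Qed.

(** The fixed space contains the kernel of the form [lam], of codimension at most one, and
    faithfulness keeps it from being everything. *)
Lemma form_pseudo_reflection h l : h \in G -> h != 1%g -> l \is (1%N).-homog ->
  (forall i, exists c, coord_aut h 'X_i - 'X_i = c *: l) -> pseudo_reflection (rho h).
Proof.
move=> hG h1 l1 lP; have [rho1 _ rho_inj] := rhoG.
pose lam : 'Hom(V, k^o) := \sum_i l@_U_(i) *: coord_form i.
have lamE v : lam v = l.@[fun i => coord (vbasis {:V}) i v].
  rewrite (dhomog1E l1) linear_sum sum_lfunE; apply: eq_bigr => i _ /=.
  by rewrite lfunE /= coord_formE mevalZ mevalXU.
have sub : (lker lam <= fixedSpace (rho h))%VS.
  apply/subvP => v; rewrite memv_ker => /eqP lv; rewrite -fixedSpaceV //.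
  apply/fixedSpaceP/vbasis_ext => i; have [c e] := lP i.
  have := congr1 (fun s => s.@[fun i => coord (vbasis {:V}) i v]) e.
  rewrite mevalB mevalZ -lamE lv mulr0 coord_autE coord_act_eval !mevalXU => /eqP.
  by rewrite subr_eq0 => /eqP.
have ne : (\dim (fixedSpace (rho h)) < n)%N.
  rewrite ltn_neqAle dimvS ?subvf // andbT; apply: contra h1 => /eqP e; apply/eqP/rho_inj => //.
  apply/lfunP => v; rewrite rho1 lfunE; apply/fixedSpaceP.
  have /eqP -> : fixedSpace (rho h) == fullv by rewrite eqEdim subvf e leqnn.
  exact: memvf.
rewrite /pseudo_reflection eqn_leq ne /=.
have := limg_ker_dim lam {:V}; rewrite capfv => <-.
rewrite -addn1 leq_add ?dimvS //.
by apply: leq_trans (dimvS (subvf _)) _; rewrite dimvf.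
Qed.

End LinearAction.

Theorem mainTheorem1 (k : fieldType) (V : vectType k) (gT : finGroupType)
    (G : {group gT}) (rho : gT -> 'End(V)) :
  faithful_linear_action G rho -> abelian G ->
  (coregular G rho <->
   pseudo_reflection_group G rho /\ direct_summand_property G rho).
Proof.
move=> rhoG abG; have actG := coord_aut_graded rhoG.
split=> [[f [f_fixed _ _ f_gen]]|[G_gen [pi [pi_fixed pi_lin pi_onto pi_homog]]]].
  split.
    set Refl := [set g in G | pseudo_reflection (rho g)].
    have sWG : <<Refl>>%G \subset G by rewrite gen_subG; apply/subsetP => g; rewrite inE => /andP[].
    apply: (reflections_generate actG abG sWG _ (f := f) f_fixed f_gen) => h l hG l1 _ lP.
    (* The identity also satisfies the congruence but is no pseudo-reflection, so its membership is
       seen separately. *)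
    have [->|h1] := eqVneq h 1%g; first exact: group1.
    by rewrite mem_gen // inE hG (form_pseudo_reflection rhoG hG h1 l1 lP).
  have [pi [pi_fixed pi_lin pi_id pi_homog]] := equivariant_retraction actG (f := f) f_fixed f_gen.
  by exists pi; split=> // a aG; exists a; apply: pi_id.
have [f [f1 f2 f3 f4]] : exists f : (\dim {:V}).-tuple {mpoly k[\dim {:V}]},
  [/\ forall i, tnth f i \in fixed (coord_aut rho) G, forall i, exists d, tnth f i \is d.-homog,
      forall q, q \mPo f = 0%R -> q = 0%R & forall s, s \in fixed (coord_aut rho) G -> polynomial_in f s].
  apply: (polynomial_invariants actG abG G_gen _ pi_fixed pi_lin pi_onto pi_homog) => r.
  by rewrite inE => /andP[rG rP]; exact: (pseudo_reflection_form rhoG rG rP).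
by exists f; split.
Qed.
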